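(* Let $(X,G,m)$ be a dynamical system and $(B_n)$ a F\o lner sequence on $G$. Assume that there exists a generic point for $(X,G,m)$ (with respect to $(B_n)$). Then the following assertions are equivalent: (i) The dynamical system $(X,G,m)$ has pure point spectrum. (ii) Every generic point of $X$ is mean almost periodic (with respect to $(B_n)$). (iii) One generic point of $X$ is mean almost periodic (with respect to $(B_n)$). If $(X,G,m)$ is ergodic and the Birkhoff ergodic theorem holds along $(B_n)$, these statements are also equivalent to: (iv) $m$-almost every $x\in X$ is mean almost periodic (with respect to $(B_n)$).
   Context: $G$ is a locally compact, $\sigma$-compact abelian group, written additively, with a fixed Haar measure; $|A|$ denotes the Haar measure of $A\subset G$ and $\int f(t)\,\mathrm{d}t$ integration with respect to it. A dynamical system $(X,G)$ is a compact metrizable space $X$ with a continuous action $G\times X\to X$, $(t,x)\mapsto tx$; a dynamical system $(X,G,m)$ is such a system together with a $G$-invariant Borel probability measure $m$ on $X$. Let $d$ be a metric on $X$ generating the topology. A F\o lner sequence $(B_n)$ is a sequence of (nonempty) open relatively compact subsets of $G$ with $\frac{|(B_n\setminus(t+B_n))\cup((t+B_n)\setminus B_n)|}{|B_n|}\to 0$ as $n\to\infty$ for all $t\in G$. A point $y\in X$ is generic (for $m$, with respect to $(B_n)$) if $\lim_{n}\frac{1}{|B_n|}\int_{B_n}f(ty)\,\mathrm{d}t=\int_X f\,\mathrm{d}m$ for every continuous $f:X\to\mathbb{C}$. The Birkhoff ergodic theorem holds along $(B_n)$ if for every integrable $f:X\to\mathbb{C}$ one has $\lim_{n}\frac{1}{|B_n|}\int_{B_n}f(tx)\,\mathrm{d}t=\int_X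 f\,\mathrm{d}m$ for $m$-almost every $x\in X$. $(X,G,m)$ has pure point spectrum if $L^2(X,m)$ has an orthonormal basis of eigenfunctions, where $f\in L^2(X,m)$, $f\neq 0$, is an eigenfunction if for every $t\in G$ there is $\xi(t)\in\mathbb{C}$ with $f(t\,\cdot)=\xi(t)f$ in $L^2(X,m)$. For bounded measurable $h:G\to\mathbb{R}$ let $\overline{M}(h)=\limsup_{n\to\infty}\frac{1}{|B_n|}\int_{B_n}h(s)\,\mathrm{d}s$, and let $D(x,y)=\overline{M}(s\mapsto d(sx,sy))$ for $x,y\in X$. A subset $A\subset G$ is relatively dense if there is a compact $K\subset G$ with $G=\bigcup_{a\in A}(a+K)$. A point $x\in X$ is mean almost periodic (with respect to $(B_n)$) if for every $\varepsilon>0$ the set $\{t\in G: D(x,tx)<\varepsilon\}$ is relatively dense in $G$; this does not depend on the choice of the metric $d$ generating the topology. *)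

(* Defs.v *)
From HB Require Import structures.
From mathcomp Require Import all_boot all_order all_algebra.
From mathcomp Require Import all_classical all_reals all_analysis.
From mathcomp Require Import complex.

Set Implicit Arguments.
Unset Strict Implicit.
Unset Printing Implicit Defensive.

Import Order.TTheory GRing.Theory Num.Theory.
Import numFieldNormedType.Exports.

Local Open Scope classical_set_scope.
Local Open Scope ring_scope.
Local Open Scope complex_scope.

(* Measurable types must be pointed, hence the two constructions below. The
   distinguished point plays no other role; a space that carries a probability
   measure is nonempty anyway, and a group is pointed at 0. *)
#[short(type="pmetricType")]
HB.structure Definition PointedMetric (R : numDomainType) :=
  {M of Pointed M & Metric R M}.

Definition zpointed (G : topologicalZmodType) : Type := G.
HB.instance Definition _ (G : topologicalZmodType) := Choice.on (zpointed G).
HB.instance Definition _ (G : topologicalZmodType) :=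
  isPointed.Build (zpointed G) 0.

Notation borel_group G :=
  (g_sigma_algebraType (@open G : set (set (zpointed G)))).
Notation borel_space X := (g_sigma_algebraType (@open X)).

Section complex_integration.
Context {d : measure_display} {T : measurableType d} {R : realType}.
Variable mu : {measure set T -> \bar R}.
Implicit Types (f g : T -> R[i]) (E : set (T -> R[i])).

Definition cmeasurable f :=
  measurable_fun setT (fun x => complex.Re (f x)) /\
  measurable_fun setT (fun x => complex.Im (f x)).

Definition cintegrable f :=
  mu.-integrable setT (fun x => (complex.Re (f x))%:E) /\
  mu.-integrable setT (fun x => (complex.Im (f x))%:E).

(* Valued in the regular module R[i]^o, where the library puts the topology. *)
Definition cintegral (D : set T) f : R[i]^o :=
  (\int[mu]_(x in D) complex.Re (f x)) +i*
  (\int[mu]_(x in D) complex.Im (f x)).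

Definition L2norm f : \bar R :=
  Lnorm mu 2%:E (fun x => (Normc.normc (f x))%:E).

(* Elements of L^2 are handled through representatives. *)
Definition in_L2 f := cmeasurable f /\ (L2norm f < +oo)%E.

Definition L2dot f g : R[i] := cintegral setT (fun x => f x * (g x)^*).

(* Distinct members of E are orthogonal normalized functions, so E contains at
   most one representative of each class. *)
Definition L2_orthonormal E :=
  [/\ forall e, E e -> in_L2 e,
      forall e, E e -> L2dot e e = 1 &
      forall e e', E e -> E e' -> e <> e' -> L2dot e e' = 0].

Definition L2_total E :=
  forall f, in_L2 f -> forall eps : R, 0 < eps ->
  exists (n : nat) (c : 'I_n -> R[i]) (e : 'I_n -> T -> R[i]),
    (forall i, E (e i)) /\
    (L2norm (fun x => f x - \sum_(i < n) c i * e i x)%R < eps%:E)%E.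

Definition L2_orthonormal_basis E := L2_orthonormal E /\ L2_total E.

End complex_integration.

Section group.
Context {R : realType} {G : topologicalZmodType}.
Implicit Types (mu : {measure set (borel_group G) -> \bar R}).
Implicit Types (B : nat -> set G) (A : set G).

Definition sigma_compact :=
  exists K : nat -> set G,
    (forall n, compact (K n)) /\ \bigcup_n K n = [set: G].

Definition translate (t : G) A : set G := [set t + s | s in A].

(* Haar measures are nonzero translation-invariant Radon measures; regularity
   is not automatic, as G need not be metrizable. *)
Record haar_measure mu : Prop := HaarMeasure {
  haar_invariant : forall t (A : set (borel_group G)), measurable A ->
    mu (translate t A) = mu A ;
  haar_nonzero : mu setT <> 0%E ;
  haar_compact : forall K : set G, compact K -> (mu K < +oo)%E ;
  haar_outer : forall A : set (borel_group G), measurable A ->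
    mu A = ereal_inf [set mu U | U in [set U : set G | open U /\ A `<=` U]] ;
  haar_inner : forall U : set G, open U ->
    mu U = ereal_sup [set mu K | K in [set K : set G | compact K /\ K `<=` U]]
}.

Record folner mu B : Prop := Folner {
  folner_nonempty : forall n, B n !=set0 ;
  folner_open : forall n, open (B n) ;
  folner_precompact : forall n, precompact (B n) ;
  folner_cvg : forall t,
    fine (mu ((B n `\` translate t (B n)) `|` (translate t (B n) `\` B n)))
      / fine (mu (B n)) @[n --> \oo] --> (0 : R)
}.

Definition average mu B (h : G -> R) (n : nat) : R :=
  (fine (mu (B n)))^-1 * \int[mu]_(s in B n) h s.

Definition caverage mu B (h : G -> R[i]) (n : nat) : R[i]^o :=
  ((fine (mu (B n)))^-1)%:C * cintegral mu (B n) h.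

Definition upper_mean mu B (h : G -> R) : R := limn_sup (average mu B h).

Definition relatively_dense A :=
  exists K : set G, compact K /\ [set: G] = \bigcup_(a in A) translate a K.

End group.

Arguments sigma_compact : clear implicits.

Section dynamical_system.
Context {R : realType} {G : topologicalZmodType} {X : pmetricType R}.
Variable act : G -> X -> X.

Record continuous_action : Prop := ContinuousAction {
  action0 : forall x, act 0 x = x ;
  actionD : forall s t x, act (s + t) x = act s (act t x) ;
  action_continuous : continuous (fun p : G * X => act p.1 p.2)
}.

Variable m : probability (borel_space X) R.

Definition invariant_measure :=
  forall t (A : set (borel_space X)), measurable A -> m (act t @^-1` A) = m A.

Definition ergodic :=
  forall A : set (borel_space X), measurable A ->
    (forall t, act t @^-1` A = A) -> m A = 0%E \/ m A = 1%E.

Definition eigenfunction (f : X -> R[i]) :=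
  [/\ in_L2 m f,
      ~ {ae m, forall x, f x = 0} &
      forall t, exists xi : R[i], {ae m, forall x, f (act t x) = xi * f x}].

Definition pure_point_spectrum :=
  exists E : set (X -> R[i]),
    L2_orthonormal_basis m E /\ (forall e, E e -> eigenfunction e).

Variables (mu : {measure set (borel_group G) -> \bar R}) (B : nat -> set G).

Definition generic (y : X) :=
  forall f : X -> R[i]^o, continuous f ->
    caverage mu B (fun t => f (act t y)) n @[n --> \oo]
      --> cintegral m setT f.

Definition birkhoff :=
  forall f : X -> R[i], cintegrable m f ->
    {ae m, forall x, caverage mu B (fun t => f (act t x)) n @[n --> \oo]
                       --> cintegral m setT f}.

Definition mean_dist (x y : X) : R :=
  upper_mean mu B (fun s => mdist (act s x) (act s y)).

Definition mean_almost_periodic (x : X) :=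
  forall eps : R, 0 < eps ->
    relatively_dense [set t | mean_dist x (act t x) < eps].

End dynamical_system.

(* Main.v *)
(* For a generic point y and t in G, D(y, ty) is the integral over X of
   x |-> d(x, tx), because this function is continuous and G is abelian. Hence
   mean almost periodicity is the same condition for all generic points: the
   pseudometric rho(s, t) = \int d(sx, tx) dm(x) on G is totally bounded.
   If eigenfunctions span L^2, approximating the functions d(., p), p in a
   finite net of X, by combinations of eigenfunctions shows that rho is totally
   bounded. Conversely, if rho is totally bounded then so is the orbit of every
   h in L^2, and the invariant positive form B(g, g') = M_t <g, T_t h><T_t h, g'>,
   M being an ultrafilter limit of Folner averages, is compact and nonzero; its
   top eigenspace is finite-dimensional and invariant, hence contains an
   eigenfunction. Applied in the orthogonal complement of a maximal orthonormal
   family of eigenfunctions, this shows that the family is total. Under the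
   Birkhoff theorem almost every point is generic, since C(X) is separable. *)
Require Import Defs.
From HB Require Import structures.
From mathcomp Require Import all_boot all_order all_algebra.
From mathcomp Require Import all_classical all_reals all_analysis.
From mathcomp Require Import complex measurable_realfun.
From mathcomp Require Import ring lra.

Set Implicit Arguments.
Unset Strict Implicit.
Unset Printing Implicit Defensive.

Import Order.TTheory GRing.Theory Num.Theory.
Import numFieldNormedType.Exports.

Local Open Scope classical_set_scope.
Local Open Scope ring_scope.

(** * Quadratic forms on real Hilbert spaces *)

(** All spectral theory is done over real Hilbert spaces. Complex $L^2$ is the space of pairs of
    real functions with the real part of the Hermitian product, and multiplication by i is one more
    operator J. Maxima of Rayleigh quotients then suffice, but they treat symmetric operators, not
    the isometries T_t. Each T_t is therefore split into the symmetric operators T_t + T_{-t} and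
    J(T_t - T_{-t}). All of these commute since G is abelian, and a common eigenvector of them is an
    eigenvector of every T_t. Functions are never taken modulo null sets: an eigenvector equation
    says that a squared length is 0, and finite dimension means a bound on the size of orthonormal
    families. Squared lengths replace norms, so triangle inequalities carry the factor 2 of (x +
    y)^2 <= 2 x^2 + 2 y^2. The metric d is integrated linearly while $L^2$ integrates squares; the
    two are compared up to eps, with constants depending on eps, by [continuous_modulus] in one
    direction and by an arithmetic-geometric mean inequality in the other. *)

Section symmetric_forms.
Context {R : realType} {V : lmodType R}.
Implicit Types (q : V -> V -> R) (W : set V) (u v w : V).

Record symform q : Prop := SymForm {
  symformC : forall u v, q u v = q v u ;
  symformDl : forall u v w, q (u + v) w = q u w + q v w ;
  symformZl : forall (a : R) u v, q (a *: u) v = a * q u v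
}.

Record linear_subspace W : Prop := Subspace {
  subspace0 : W 0 ;
  subspaceP : forall (a : R) u v, W u -> W v -> W (a *: u + v)
}.

Lemma subspaceD W u v : linear_subspace W -> W u -> W v -> W (u + v).
Proof. by move=> sW Wu Wv; rewrite -[u]scale1r; exact: subspaceP. Qed.

Lemma subspaceZ W (a : R) u : linear_subspace W -> W u -> W (a *: u).
Proof.
by move=> sW Wu; rewrite -[_ *: _]addr0; apply: subspaceP => //; exact: subspace0.
Qed.

Lemma subspaceB W u v : linear_subspace W -> W u -> W v -> W (u - v).
Proof. by move=> sW Wu Wv; rewrite -scaleN1r addrC; exact: subspaceP. Qed.

Section theory.
Variable q : V -> V -> R.
Hypothesis sq : symform q.

Lemma symformDr u v w : q w (u + v) = q w u + q w v.
Proof. by rewrite (symformC sq) (symformDl sq) !(symformC sq w). Qed.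

Lemma symformZr (a : R) u v : q u (a *: v) = a * q u v.
Proof. by rewrite (symformC sq) (symformZl sq) (symformC sq v). Qed.

Lemma symformNl u v : q (- u) v = - q u v.
Proof. by rewrite -scaleN1r (symformZl sq) mulN1r. Qed.

Lemma symformNr u v : q u (- v) = - q u v.
Proof. by rewrite -scaleN1r symformZr mulN1r. Qed.

Lemma symform0l v : q 0 v = 0.
Proof. by rewrite -(scale0r v) (symformZl sq) mul0r. Qed.

Lemma symform0r v : q v 0 = 0.
Proof. by rewrite -(scale0r v) symformZr mul0r. Qed.

Lemma symform_sumr v n (e : 'I_n -> V) : q v (\sum_i e i) = \sum_i q v (e i).
Proof.
by elim/big_ind2 : _ => [|x a y b <- <-|//]; rewrite ?symform0r ?symformDr.
Qed.

Lemma symform_suml v n (e : 'I_n -> V) : q (\sum_i e i) v = \sum_i q (e i) v.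
Proof.
rewrite (symformC sq) symform_sumr; apply: eq_bigr => i _.
by rewrite (symformC sq).
Qed.

Definition symformE := (symformDl sq, symformDr, symformNl, symformNr,
  symformZl sq, symformZr).

Lemma symform_sqD u v : q (u + v) (u + v) = q u u + 2 * q u v + q v v.
Proof. by rewrite !symformE (symformC sq v u); ring. Qed.

Lemma symform_sqB u v : q (u - v) (u - v) = q u u - 2 * q u v + q v v.
Proof. by rewrite !symformE (symformC sq v u); ring. Qed.

Lemma symform_sqZ (a : R) u : q (a *: u) (a *: u) = a ^+ 2 * q u u.
Proof. by rewrite (symformZl sq) symformZr mulrA -expr2. Qed.

Section nonnegative.
Variable W : set V.
Hypotheses (sW : linear_subspace W) (q_ge0 : forall u, W u -> 0 <= q u u).

(** The discriminant argument, for a form that may be degenerate and is nonnegative only on [W]: it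
    will be applied to [lam * dot - B], whose sign is known on one subspace only. *)
Lemma cauchy_schwarz u v : W u -> W v -> q u v ^+ 2 <= q u u * q v v.
Proof.
move=> Wu Wv.
have qs (s t : R) : 0 <= s ^+ 2 * q u u + 2 * s * t * q u v + t ^+ 2 * q v v.
  have := q_ge0 (subspaceD sW (subspaceZ s sW Wu) (subspaceZ t sW Wv)).
  by rewrite symform_sqD !symformE; congr (_ <= _); ring.
have c0 := q_ge0 Wv; have a0 := q_ge0 Wu.
have [qv0|qv0] := eqVneq (q v v) 0.
  have [->|quv0] := eqVneq (q u v) 0; first by rewrite qv0 expr0n/= mulr0.
  (* When [q v v] is 0 the polynomial is affine in its second argument, and this choice makes its
     value the opposite of the square of [q u v]. *)
  have := qs (q u v) (- (q u u + 1) / 2); rewrite qv0 mulr0 addr0.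
  have -> : q u v ^+ 2 * q u u + 2 * q u v * (- (q u u + 1) / 2) * q u v =
    - (q u v ^+ 2) by field.
  by rewrite oppr_ge0 mulr0.
have c1 : 0 < q v v by rewrite lt_neqAle eq_sym qv0.
have := qs (q v v) (- q u v).
have -> : q v v ^+ 2 * q u u + 2 * q v v * - q u v * q u v +
  (- q u v) ^+ 2 * q v v = q v v * (q u u * q v v - q u v ^+ 2) by ring.
by rewrite pmulr_rge0// subr_ge0.
Qed.

Lemma symform_sqD_le u v : W u -> W v ->
  q (u + v) (u + v) <= 2 * q u u + 2 * q v v.
Proof.
move=> Wu Wv; have := q_ge0 (subspaceB sW Wu Wv).
by rewrite symform_sqB symform_sqD; lra.
Qed.

Lemma symform_sqB_le u v : W u -> W v ->
  q (u - v) (u - v) <= 2 * q u u + 2 * q v v.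
Proof.
move=> Wu Wv; have := q_ge0 (subspaceD sW Wu Wv).
by rewrite symform_sqB symform_sqD; lra.
Qed.

End nonnegative.

End theory.

Lemma subspaceT : linear_subspace [set: V].
Proof. by []. Qed.

End symmetric_forms.

(** * Projections, compact forms and common eigenvectors of symmetric operators *)

Section hilbert.
Context {R : realType} {V : lmodType R}.
Variable dot : V -> V -> R.
Implicit Types (u v w g h : V) (W : set V).

Local Notation nsq u := (dot u u).

(* Vectors of zero length are not identified with 0. *)
Record hilbert_form : Prop := HilbertForm {
  hilbert_sym : symform dot ;
  hilbert_ge0 : forall u, 0 <= nsq u ;
  hilbert_complete : forall x : nat -> V,
    (forall eps : R, 0 < eps -> exists N, forall n p,
      (N <= n)%N -> (N <= p)%N -> nsq (x n - x p) <= eps) ->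
    exists l, forall eps : R, 0 < eps -> exists N, forall n,
      (N <= n)%N -> nsq (x n - l) <= eps
}.

(** Closedness for the seminorm, by approximation. Such a [W] contains all vectors of zero length,
    hence every vector at zero distance from it. *)
Definition closed_subspace W := linear_subspace W /\
  forall v, (forall eps : R, 0 < eps -> exists2 w, W w & nsq (v - w) <= eps) ->
    W v.

Hypothesis hV : hilbert_form.
Let sd := hilbert_sym hV.
Let d0 := hilbert_ge0 hV.

Lemma dot_le u v : dot u v ^+ 2 <= nsq u * nsq v.
Proof. by apply: (cauchy_schwarz sd subspaceT (fun u _ => d0 u)). Qed.

Lemma nsqD_le u v : nsq (u + v) <= 2 * nsq u + 2 * nsq v.
Proof. by apply: (symform_sqD_le sd subspaceT (fun u _ => d0 u)). Qed.

Lemma nsqB_le u v : nsq (u - v) <= 2 * nsq u + 2 * nsq v.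
Proof. by apply: (symform_sqB_le sd subspaceT (fun u _ => d0 u)). Qed.

Lemma nsqN u : nsq (- u) = nsq u.
Proof. by rewrite !(symformE sd) opprK. Qed.

Lemma nsqC u v : nsq (u - v) = nsq (v - u).
Proof. by rewrite -nsqN opprB. Qed.

Lemma nsq_normalize u : 0 < nsq u ->
  nsq ((Num.sqrt (nsq u))^-1 *: u) = 1.
Proof.
move=> u0; rewrite (symform_sqZ sd) exprVn sqr_sqrtr ?ltW//.
by rewrite mulVf// gt_eqF.
Qed.

Lemma nsq_eq0_dot u v : nsq u = 0 -> dot u v = 0.
Proof.
move=> u0; have := dot_le u v; rewrite u0 mul0r => h; apply/eqP.
by rewrite -sqrf_eq0 eq_le h sqr_ge0.
Qed.

Lemma exists_small (c eps : R) : 0 < eps -> 0 <= c ->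
  exists N : nat, forall n, (N <= n)%N -> c * n.+1%:R^-1 <= eps.
Proof.
move=> e0 c0; exists (Num.trunc (c / eps)) => n Nn.
rewrite ler_pdivrMr ?ltr0Sn// mulrC -ler_pdivrMr//.
have /ltW := Num.Theory.truncnS_gt (c / eps) => /le_trans; apply.
by rewrite ler_nat.
Qed.

(** A minimising sequence is Cauchy by the parallelogram law, because midpoints stay in [W];
    near-minimality makes [f - x n] almost orthogonal to [W], with an explicit error that vanishes
    in the limit. *)
Lemma projection W f : closed_subspace W ->
  exists2 p, W p & forall u, W u -> dot (f - p) u = 0.
Proof.
move=> [sW cW].
pose A := [set nsq (f - u) | u in W].
have hA : has_inf A.
  split; first by exists (nsq (f - 0)), 0 => //; exact: subspace0.
  by exists 0 => _ [u _ <-].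
have dA u : W u -> inf A <= nsq (f - u).
  by move=> Wu; apply: ge_inf; [exact: (proj2 hA)|exists u].
have /choice[x xP] : forall n : nat, exists u, W u /\
    nsq (f - u) <= inf A + n.+1%:R^-1.
  move=> n; have n0 : 0 < n.+1%:R^-1 :> R by rewrite invr_gt0.
  have [_ [u Wu <-] fu] := inf_adherent n0 hA.
  by exists u; split => //; exact: ltW.
have WxB n : W (x n) by have [] := xP n.
have near_orth n u : W u -> dot (f - x n) u ^+ 2 <= n.+1%:R^-1 * nsq u.
  move=> Wu.
  have [u0|u0] := eqVneq (nsq u) 0.
    by rewrite (symformC sd) nsq_eq0_dot// u0 expr0n/= mulr0.
  have u1 : 0 < nsq u by rewrite lt_neqAle eq_sym u0 d0.
  (* Moving [x n] along [u] by the optimal multiple lowers the squared distance by b^2 / |u|^2, but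
     never below the infimum, which is at most 1/(n+1) away. *)
  have := dA _ (subspaceD sW (WxB n)
    (subspaceZ (dot (f - x n) u / nsq u) sW Wu)).
  rewrite opprD addrA (symform_sqB sd) !(symformZr sd) !(symformZl sd).
  have [_ +] := xP n; set k := n.+1%:R^-1; set b := dot _ u; move=> h1 h2.
  have : b ^+ 2 / nsq u <= k.
    have -> : b ^+ 2 / nsq u = 2 * (b / nsq u * b) -
      b / nsq u * (b / nsq u * nsq u) by field.
    by lra.
  by rewrite ler_pdivrMr.
have xC n p : nsq (x n - x p) <= 2 * (n.+1%:R^-1 + p.+1%:R^-1).
  have := dA _ (subspaceZ 2^-1 sW (subspaceD sW (WxB n) (WxB p))).
  have [_ +] := xP n; have [_ +] := xP p.
  set k := n.+1%:R^-1; set k' := p.+1%:R^-1.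
  have -> : f - 2^-1 *: (x n + x p) = 2^-1 *: ((f - x n) + (f - x p)).
    rewrite addrACA -opprD scalerBr; congr (_ - _).
    by rewrite -mulr2n -(scaler_nat 2 f) scalerA mulVf ?scale1r// pnatr_eq0.
  have -> : x n - x p = (f - x p) - (f - x n).
    by rewrite opprB [RHS]addrC addrA subrK.
  move: (f - x n) (f - x p) => a b.
  rewrite (symformZl sd) (symformZr sd) (symform_sqD sd) (symform_sqB sd).
  by rewrite (symformC sd b); lra.
have [p pP] : exists l, forall eps : R, 0 < eps -> exists N, forall n,
    (N <= n)%N -> nsq (x n - l) <= eps.
  apply: (hilbert_complete hV) => eps e0.
  have [N NP] := exists_small e0 (ler0n R 4); exists N => n q Nn Nq.
  apply: le_trans (xC n q) _; have := NP _ Nn; have := NP _ Nq.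
  by move: (n.+1%:R^-1) (q.+1%:R^-1) => a b; lra.
exists p.
  apply: cW => eps e0; have [N /(_ _ (leqnn _)) NP] := pP _ e0.
  by exists (x N); rewrite // nsqC.
move=> u Wu; apply/eqP; rewrite -sqrf_eq0 eq_le sqr_ge0 andbT.
apply/ler_addgt0Pr => eps e0; rewrite add0r.
have u1 : 0 < nsq u + 1 by rewrite ltr_wpDl.
(* Both summands of [(f - x n) + (x n - p)] get a squared product with [u] of at most eps/4, which
   the factor 2 turns into eps. The added 1 covers a null [u]. *)
have e1 : 0 < eps / 4 / (nsq u + 1) by rewrite !divr_gt0.
have [N1 N1P] := pP _ e1.
have [N2 N2P] := exists_small e1 ler01.
pose n := maxn N1 N2.
have h1 := N1P n (leq_maxl _ _); have := N2P n (leq_maxr _ _); rewrite mul1r => h2.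
have -> : f - p = (f - x n) + (x n - p) by rewrite addrA subrK.
rewrite (symformDl sd).
have := near_orth n _ Wu; have := dot_le (x n - p) u.
set a := dot (f - _) u; set b := dot (x n - p) u => h3 h4.
have h5 : n.+1%:R^-1 * nsq u <= eps / 4.
  apply: (le_trans (ler_wpM2r (d0 u) h2)).
  by rewrite mulrAC ler_pdivrMr// ler_wpM2l ?divr_ge0 ?lerDl// ltW.
have h6 : nsq (x n - p) * nsq u <= eps / 4.
  apply: (le_trans (ler_wpM2r (d0 u) h1)).
  by rewrite mulrAC ler_pdivrMr// ler_wpM2l ?divr_ge0 ?lerDl// ltW.
have : (a + b) ^+ 2 <= 2 * a ^+ 2 + 2 * b ^+ 2 by have := sqr_ge0 (a - b); nra.
have := le_trans h3 h6; have := le_trans h4 h5.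
by move: (a ^+ 2) (b ^+ 2) ((a + b) ^+ 2) => x1 x2 x3; lra.
Qed.

Lemma orthogonal_closed (S : set V) :
  closed_subspace [set w | forall u, S u -> dot w u = 0].
Proof.
split; first split=> [u _|a v w Sv Sw u Su]; first exact: (symform0l sd).
  by rewrite (symformDl sd) (symformZl sd) Sv// Sw// mulr0 addr0.
move=> v vS u Su; apply/eqP; rewrite -sqrf_eq0 eq_le sqr_ge0 andbT.
apply/ler_addgt0Pr => eps e0; rewrite add0r.
have u1 : 0 < nsq u + 1 by rewrite ltr_wpDl.
have e1 : 0 < eps / (nsq u + 1) by rewrite divr_gt0.
have [w Sw vw] := vS _ e1.
have -> : dot v u = dot (v - w) u by rewrite (symformDl sd) (symformNl sd) Sw// subr0.
apply: (le_trans (dot_le _ _)); move: vw; rewrite ler_pdivlMr// => vw.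
by apply: le_trans vw; rewrite ler_wpM2l// lerDl.
Qed.

(** Weak sequential compactness tested against a finite list: Bolzano-Weierstrass is applied once
    per vector of [s], so no diagonal argument occurs. The bound [n <= phi n] carries 1/(n+1)
    estimates over to the subsequence. *)
Lemma subsequence_cauchy (x : nat -> V) (c : R) (s : seq V) :
  (forall n, nsq (x n) <= c) ->
  exists2 phi : nat -> nat, (forall n, n <= phi n)%N &
  forall eps : R, 0 < eps -> exists N, forall n p, (N <= n)%N -> (N <= p)%N ->
    forall u, u \in s -> dot (x (phi n) - x (phi p)) u ^+ 2 <= eps.
Proof.
elim: s x => [|u s IH] x xc.
  by exists id => // eps e0; exists 0%N.
have [phi phin phiC] := IH x xc.
pose a n := dot (x (phi n)) u.
have [psi psii psiC] : exists2 f : nat -> nat, increasing_seq f & cvgn (a \o f).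
  apply: bolzano_weierstrass; exists (c * nsq u + 1); split; first exact: num_real.
  move=> M /ltW cM n _; apply: le_trans cM.
  have h : a n ^+ 2 <= c * nsq u.
    by apply: (le_trans (dot_le _ _)); apply: ler_wpM2r.
  have h0 : 0 <= c * nsq u by apply: le_trans h; exact: sqr_ge0.
  rewrite -(@ler_pXn2r _ 2)// ?nnegrE//; last by rewrite addr_ge0.
  by rewrite real_normK ?num_real//; apply: (le_trans h); nra.
have psin n : (n <= psi n)%N.
  elim: n => // n IHn; apply: (leq_ltn_trans IHn).
  by rewrite ltnNge; apply/negP; have := psii n.+1 n; rewrite !leEnat ltnn => ->.
exists (phi \o psi) => [n|eps e0].
  by apply: (leq_trans (psin n)); exact: phin.
have [N1 N1P] := phiC _ e0.
pose l := lim ((a \o psi) @ \oo).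
have /cvgrPdist_le lP : (a \o psi) n @[n --> \oo] --> l by exact: psiC.
have r0 : 0 < Num.sqrt eps / 2 by rewrite divr_gt0// sqrtr_gt0.
have [N2 _ N2P] := lP _ r0.
exists (maxn N1 N2) => n p; rewrite !geq_max => /andP[n1 n2] /andP[p1 p2] v.
rewrite inE => /orP[/eqP ->|vs]; last first.
  by apply: N1P vs; [exact: leq_trans n1 (psin n)|exact: leq_trans p1 (psin p)].
rewrite (symformDl sd) (symformNl sd) -[leRHS](sqr_sqrtr (ltW e0)).
rewrite -[leLHS]real_normK ?num_real// ler_pXn2r// ?nnegrE ?sqrtr_ge0//.
have := N2P n n2; have := N2P p p2; rewrite /= -/(a (psi n)) -/(a (psi p)) => h1 h2.
rewrite -(subrKA l) [leRHS](splitr (Num.sqrt eps)).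
by apply: (le_trans (ler_normD _ _)); rewrite addrC lerD// distrC.
Qed.

(** Stands for compactness without a weak topology: up to a small multiple of the squared length,
    finitely many linear functionals control the form. *)
Definition compact_form B W := forall eps : R, 0 < eps ->
  exists (s : seq V) (C : R), 0 <= C /\
  forall g, W g -> B g g <= eps * nsq g + C * \sum_(u <- s) dot g u ^+ 2.

(** [lam] is the supremum of the Rayleigh quotient on [W]. The form [lam * dot - B] is nonnegative
    there and small along a maximising sequence; compactness of [B] turns this into norm convergence
    of a subsequence. *)
Lemma top_eigenvector B (C : R) W : closed_subspace W -> symform B ->
  (forall g, 0 <= B g g <= C * nsq g) -> compact_form B W ->
  (exists2 g, W g & 0 < B g g) ->
  exists lam : R, [/\ 0 < lam, forall g, W g -> B g g <= lam * nsq g &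
    exists g, [/\ W g, 0 < nsq g & B g g = lam * nsq g]].
Proof.
move=> [sW cW] sB Bb Bc [g0 Wg0 Bg0].
have C0 : 0 <= C.
  rewrite leNgt; apply/negP => C0; have /andP[_ h] := Bb g0.
  by have := d0 g0; nra.
have B0 g : 0 <= B g g by have /andP[] := Bb g.
have BC g : B g g <= C * nsq g by have /andP[] := Bb g.
pose A := [set B g g | g in [set g | W g /\ nsq g <= 1]].
have normalize g : W g -> 0 < nsq g -> exists2 a, 0 < a &
    a ^+ 2 * nsq g = 1.
  move=> Wg ng; exists (Num.sqrt (nsq g))^-1; first by rewrite invr_gt0 sqrtr_gt0.
  by rewrite exprVn sqr_sqrtr ?ltW// mulVf// gt_eqF.
have hA : has_sup A.
  split; first by exists (B 0 0), 0 => //; split; [exact: subspace0|rewrite (symform0l sd)].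
  exists C => _ [g [_ g1] <-]; apply: (le_trans (BC g)).
  by rewrite ler_piMr.
pose lam := sup A.
have BlamP a g : W g -> a ^+ 2 * nsq g = 1 -> a ^+ 2 * B g g <= lam.
  move=> Wg ag; apply: ub_le_sup; first exact: (proj2 hA).
  exists (a *: g); last by rewrite !(symformE sB) mulrA -expr2.
  split; first exact: subspaceZ.
  by rewrite !(symformE sd) mulrA -expr2 ag.
have Blam g : W g -> B g g <= lam * nsq g.
  move=> Wg; have [ng|ng] := eqVneq (nsq g) 0.
    by rewrite ng mulr0; have := BC g; rewrite ng mulr0.
  have {}ng : 0 < nsq g by rewrite lt_neqAle eq_sym ng d0.
  have [a a0 an] := normalize _ Wg ng; have := BlamP _ _ Wg an.
  have a2 : 0 < a ^+ 2 by rewrite exprn_gt0.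
  by move=> h; rewrite -(ler_pM2l a2) mulrCA an mulr1.
have lam0 : 0 < lam.
  have ng : 0 < nsq g0 by have := BC g0; have := d0 g0; nra.
  have [a a0 an] := normalize _ Wg0 ng; apply: lt_le_trans (BlamP _ _ Wg0 an).
  by rewrite mulr_gt0// exprn_gt0.
exists lam; split => //.
pose q u v := lam * dot u v - B u v.
have sq : symform q.
  split=> *; rewrite /q.
  - by rewrite (symformC sd) (symformC sB).
  - by rewrite (symformDl sd) (symformDl sB); ring.
  - by rewrite (symformZl sd) (symformZl sB); ring.
have q0 g : W g -> 0 <= q g g by move=> Wg; rewrite subr_ge0 Blam.
have /choice[x xP] : forall n : nat, exists u,
    [/\ W u, nsq u <= 1 & lam - n.+1%:R^-1 <= B u u].
  move=> n; have n0 : 0 < n.+1%:R^-1 :> R by rewrite invr_gt0.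
  have [_ [u [Wu nu] <-] Bu] := sup_adherent n0 hA.
  by exists u; split => //; exact: ltW.
have l2 : 0 < lam / 2 by rewrite divr_gt0.
(* The value lam/2 lets half of [lam * nsq z = q z z + B z z] absorb the first term of the
   compactness bound. *)
have [s [K [K0 sK]]] := Bc _ l2.
have [phi phin phiC] := @subsequence_cauchy x 1 s (fun n => let: And3 _ h _ := xP n in h).
pose y n := x (phi n).
have Wy n : W (y n) by have [] := xP (phi n).
have ny n : nsq (y n) <= 1 by have [] := xP (phi n).
have qy n : q (y n) (y n) <= n.+1%:R^-1.
  have [_ h1 h2] := xP (phi n); rewrite /q.
  have h3 : (phi n).+1%:R^-1 <= n.+1%:R^-1 :> R by rewrite lef_pV2 ?posrE// ler_nat ltnS.
  have h4 : lam * nsq (y n) <= lam by rewrite ler_piMr// ltW.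
  by rewrite lerBlDl (le_trans h4)// -lerBlDr (le_trans _ h2)// lerD2l lerN2.
have [l lP] : exists l, forall eps : R, 0 < eps -> exists N, forall n,
    (N <= n)%N -> nsq (y n - l) <= eps.
  apply: (hilbert_complete hV) => eps e0.
  (* For z = [y n - y p] the form [q z z] will be at most 4 * eps * lam / 16, and the functionals
     add at most eps * lam / 4. Hence lam/2 * |z|^2 <= eps * lam / 2. *)
  have e1 : 0 < eps * lam / 4 / (K * (size s)%:R + 1).
    by rewrite !divr_gt0 ?mulr_gt0 ?ltr_wpDl ?mulr_ge0.
  have [N1 N1P] := phiC _ e1.
  have e2 : 0 < eps * lam / 16 by rewrite divr_gt0 ?mulr_gt0.
  have [N2 N2P] := exists_small e2 ler01.
  exists (maxn N1 N2) => n p; rewrite !geq_max => /andP[n1 n2] /andP[p1 p2].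
  have := symform_sqB_le sq sW q0 (Wy n) (Wy p).
  have := N2P _ n2; have := N2P _ p2; rewrite !mul1r => b1 b2.
  have := le_trans (qy n) b2; have := le_trans (qy p) b1.
  have := sK _ (subspaceB sW (Wy n) (Wy p)).
  have : K * \sum_(u <- s) dot (y n - y p) u ^+ 2 <= eps * lam / 4.
    set t := eps * lam / 4 / (K * (size s)%:R + 1).
    have : \sum_(u <- s) dot (y n - y p) u ^+ 2 <= t *+ size s.
      rewrite -(count_predT s) -iter_addr_0 -big_const_seq big_seq [leRHS]big_seq.
      by apply: ler_sum => u us; exact: N1P.
    move=> /(ler_wpM2l K0) /le_trans; apply.
    rewrite -mulr_natl /t mulrCA mulrA [X in X <= _]mulrC.
    rewrite mulrAC ler_pdivrMr ?ltr_wpDl ?mulr_ge0//.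
    rewrite ler_wpM2l ?divr_ge0 ?mulr_ge0 ?ltW//.
    by rewrite mulrC ltrDl.
  set z := y n - y p; rewrite [q z z]/q.
  move: (\sum_(u <- s) _) => S h1 h2 h3 h4 h5.
  rewrite -(ler_pM2l lam0); lra.
have Wl : W l.
  apply: cW => eps e0; have [N /(_ _ (leqnn _)) NP] := lP _ e0.
  by exists (y N); rewrite // nsqC.
have ql : q l l <= 0.
  apply/ler_addgt0Pr => eps e0; rewrite add0r.
  have e1 : 0 < eps / (4 * lam) by rewrite divr_gt0 ?mulr_gt0.
  have [N1 N1P] := lP _ e1.
  have e2 : 0 < eps / 4 by rewrite divr_gt0.
  have [N2 N2P] := exists_small e2 ler01.
  pose n := maxn N1 N2; have := N1P n (leq_maxl _ _).
  have := N2P n (leq_maxr _ _); rewrite mul1r => /(le_trans (qy n)) h1 h2.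
  have := symform_sqB_le sq sW q0 (Wy n) (subspaceB sW (Wy n) Wl).
  rewrite subKr => /le_trans; apply.
  have : q (y n - l) (y n - l) <= lam * nsq (y n - l) by rewrite /q gerBl.
  move: h2; rewrite ler_pdivlMr ?mulr_gt0//.
  by move: (q _ _) h1 (nsq _) (q _ _) => *; lra.
have Bl : B l l = lam * nsq l.
  by apply/eqP; rewrite eq_sym -subr_eq0 eq_le ql q0.
exists l; split => //.
(* The limit is not null: for large n, [B] is at least lam/2 at [y n] but at most lam/8 at
   [y n - l], so [B l l] is positive. *)
have C1 : 0 < C by have := BC g0; have := d0 g0; nra.
have [N1 N1P] : exists N, forall n, (N <= n)%N -> nsq (y n - l) <= lam / (8 * C).
  by apply: lP; rewrite divr_gt0 ?mulr_gt0.
have l4 : 0 < lam / 2 by rewrite divr_gt0.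
have [N2 N2P] := exists_small l4 ler01.
pose n := maxn N1 N2; have := N1P n (leq_maxl _ _).
have := N2P n (leq_maxr _ _); rewrite mul1r => h1 h2.
have h3 : lam / 2 <= B (y n) (y n).
  have [_ _ h3] := xP (phi n); apply: le_trans h3.
  have : (phi n).+1%:R^-1 <= n.+1%:R^-1 :> R by rewrite lef_pV2 ?posrE// ler_nat ltnS.
  by move=> /le_trans /(_ h1); move: (_^-1) => *; lra.
have := symform_sqB_le sB (W:=setT) subspaceT (fun u _ => B0 u) (u:=y n - l) (v:=-l) I I.
rewrite opprK subrK (symformNl sB) (symformNr sB) opprK.
have := BC (y n - l); move: h2; rewrite ler_pdivlMr ?mulr_gt0//.
rewrite Bl -(pmulr_rgt0 _ lam0) => h5 h6 h7.
have h8 : C * nsq (y n - l) <= lam / 8.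
  by rewrite ler_pdivlMr// (_ : _ * 8 = nsq (y n - l) * (8 * C))//; ring.
by lra.
Qed.

Definition top_eigenspace B (lam : R) W := [set g | W g /\ B g g = lam * nsq g].

(** Where the form [lam * dot - B], nonnegative on [W], vanishes on the diagonal, it vanishes
    against all of [W] by Cauchy-Schwarz. The quadratic condition thus becomes a linear one. *)
Lemma top_eigenspaceP B (lam : R) W : closed_subspace W -> symform B ->
  (forall g, W g -> B g g <= lam * nsq g) ->
  forall g, W g ->
    (top_eigenspace B lam W g <-> forall h, W h -> B g h = lam * dot g h).
Proof.
move=> [sW cW] sB Blam.
pose q u v := lam * dot u v - B u v.
have sq : symform q.
  split=> *; rewrite /q.
  - by rewrite (symformC sd) (symformC sB).
  - by rewrite (symformDl sd) (symformDl sB); ring.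
  - by rewrite (symformZl sd) (symformZl sB); ring.
have q0 g : W g -> 0 <= q g g by move=> Wg; rewrite subr_ge0 Blam.
move=> g Wg; split=> [[_ Bg] h Wh|h]; last by split => //; exact: h.
have := cauchy_schwarz sq sW q0 Wg Wh.
rewrite {2}/q Bg subrr mul0r => qgh.
have /eqP : q g h ^+ 2 = 0 by apply/eqP; rewrite eq_le qgh sqr_ge0.
by rewrite sqrf_eq0 subr_eq0 => /eqP.
Qed.

Lemma top_eigenspace_closed B (C lam : R) W : closed_subspace W -> symform B ->
  (forall g, 0 <= B g g <= C * nsq g) -> 0 <= C -> 0 < lam ->
  (forall g, W g -> B g g <= lam * nsq g) ->
  closed_subspace (top_eigenspace B lam W).
Proof.
move=> cW' sB Bb C0 lam0 Blam; have [sW cW] := cW'.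
have EP := top_eigenspaceP cW' sB Blam.
split.
  split=> [|a u v [Wu Eu] [Wv Ev]].
    by split; [exact: subspace0|rewrite (symform0l sB) (symform0l sd) mulr0].
  apply/EP => [|h Wh]; first exact: subspaceP.
  have /EP Eu' : top_eigenspace B lam W u by [].
  have /EP Ev' : top_eigenspace B lam W v by [].
  rewrite !(symformE sB) !(symformE sd) Eu'// Ev'//; ring.
move=> v vE; have Wv : W v.
  by apply: cW => eps /vE[w [Ww _] vw]; exists w.
split => //; apply/eqP; rewrite eq_le Blam//=.
apply/ler_addgt0Pr => eps e0.
have e1 : 0 < eps / (2 * lam) by rewrite divr_gt0 ?mulr_gt0.
have [w [Ww Ew] vw] := vE _ e1.
have /EP wE : top_eigenspace B lam W w by [].
have wv := wE Ww _ (subspaceB sW Wv Ww).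
(* Expanding around [w], the defect lam |v|^2 - B v v equals lam |v - w|^2 minus the value of [B] at
   [v - w], which is nonnegative. *)
rewrite -(subrK w v) (symform_sqD sB) (symform_sqD sd) Ew.
rewrite (symformC sB) wv// (symformC sd).
have /andP[B0 _] := Bb (v - w).
move: vw; rewrite ler_pdivlMr ?mulr_gt0// => vw.
by rewrite (symformC sd w); nra.
Qed.

Definition orthonormal_family n (e : 'I_n -> V) :=
  forall i j, dot (e i) (e j) = (i == j)%:R.

Lemma bessel n (e : 'I_n -> V) u : orthonormal_family e ->
  \sum_i dot (e i) u ^+ 2 <= nsq u.
Proof.
move=> eP; pose p := \sum_i dot (e i) u *: e i.
have pu : dot u p = \sum_i dot (e i) u ^+ 2.
  rewrite (symform_sumr sd); apply: eq_bigr => i _.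
  by rewrite (symformZr sd) (symformC sd u).
have pp : nsq p = \sum_i dot (e i) u ^+ 2.
  rewrite {1}/p (symform_suml sd); apply: eq_bigr => i _.
  rewrite (symformZl sd) (symform_sumr sd) (bigD1 i)//= big1 ?addr0.
    by rewrite (symformZr sd) eP eqxx mulr1.
  by move=> j ji; rewrite (symformZr sd) eP eq_sym (negbTE ji) mulr0.
have := d0 (u - p); rewrite (symform_sqB sd) pu pp.
by move: (\sum_i _) => s; lra.
Qed.

(** Bessel's inequality, summed over [s], gives n <= C * sum of the |u|^2. This is how finite
    dimension is expressed in the presence of null vectors. *)
Lemma orthonormal_family_bound W (s : seq V) (C : R) : 0 <= C ->
  (forall g, W g -> nsq g <= C * \sum_(u <- s) dot g u ^+ 2) ->
  exists N : nat, forall n (e : 'I_n -> V),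
    (forall i, W (e i)) -> orthonormal_family e -> (n <= N)%N.
Proof.
move=> C0 Ws; exists (Num.trunc (C * \sum_(u <- s) nsq u)) => n e We eP.
have : n%:R <= C * \sum_(u <- s) nsq u.
  have -> : n%:R = \sum_(i < n) nsq (e i) :> R.
    rewrite (eq_bigr (fun=> 1)) => [|i _]; last by rewrite eP eqxx.
    by rewrite sumr_const card_ord.
  have /le_trans : \sum_(i < n) nsq (e i) <=
      \sum_(i < n) C * \sum_(u <- s) dot (e i) u ^+ 2.
    by apply: ler_sum => i _; exact: Ws.
  apply; rewrite -mulr_sumr ler_wpM2l// exchange_big/=.
  by apply: ler_sum => u _; exact: bessel.
by move=> h; rewrite Num.Theory.truncn_ge_nat// (le_trans _ h).
Qed.

Section selfadjoint_eigenvector.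
Context {I : Type}.
Variables (S : I -> V -> V) (c : I -> R).
Hypothesis S_adj : forall i u v, dot (S i u) v = dot u (S i v).
Hypothesis S_comm : forall i j u, S i (S j u) = S j (S i u).
Hypothesis S_bound : forall i u, `|dot (S i u) u| <= c i * nsq u.

Definition S_invariant W := forall i u, W u -> W (S i u).

(** Each [S i] is symmetric for [dot] and for [B] alike, so it can be moved across both sides of the
    equation [B g h = lam * dot g h]. *)
Lemma top_eigenspace_invariant B (lam : R) W : closed_subspace W -> symform B ->
  S_invariant W ->
  (forall i u v, B (S i u) v = B u (S i v)) ->
  (forall g, W g -> B g g <= lam * nsq g) ->
  S_invariant (top_eigenspace B lam W).
Proof.
move=> cW sB SW SB Blam i u Eu.
have Wu : W u by case: Eu.
have EP := top_eigenspaceP cW sB Blam.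
apply/EP; [exact: SW|move=> h Wh]; move/EP : Eu => /(_ Wu) Eu.
by rewrite SB S_adj Eu//; exact: SW.
Qed.

(* An invariant subspace of minimal dimension inside the top eigenspace of
   [B] consists of common eigenvectors: otherwise the top eigenspace of some
   [S i] on it would be a smaller one. *)
Lemma selfadjoint_eigenvector B (C : R) W : closed_subspace W -> symform B ->
  (forall g, 0 <= B g g <= C * nsq g) -> 0 <= C -> compact_form B W ->
  (exists2 g, W g & 0 < B g g) ->
  S_invariant W -> (forall i u v, B (S i u) v = B u (S i v)) ->
  exists w, [/\ W w, 0 < nsq w &
    forall i, exists a : R, nsq (S i w - a *: w) = 0].
Proof.
move=> cW sB Bb C0 Bc Bpos SW SB.
have [lam [lam0 Blam [g0 [Wg0 ng0 Eg0]]]] := top_eigenvector cW sB Bb Bc Bpos.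
pose E := top_eigenspace B lam W.
have cE : closed_subspace E by apply: top_eigenspace_closed Blam.
have SE : S_invariant E by exact: top_eigenspace_invariant.
(* On [E] the form is [lam] times the squared length, so compactness at the level lam/2 makes [E]
   finite-dimensional. *)
have [s [K [K0 sK]]] : exists (s : seq V) (K : R), 0 <= K /\
    forall g, E g -> nsq g <= K * \sum_(u <- s) dot g u ^+ 2.
  have l2 : 0 < lam / 2 by rewrite divr_gt0.
  have [s [K [K0 sK]]] := Bc _ l2.
  exists s, (2 / lam * K); split; first by rewrite mulr_ge0// divr_ge0// ltW.
  move=> g [Wg Bg]; have := sK _ Wg; rewrite Bg => h.
  rewrite -(ler_pM2l lam0).
  have -> : lam * (2 / lam * K * \sum_(u <- s) dot g u ^+ 2) =
      2 * (K * \sum_(u <- s) dot g u ^+ 2) by field; rewrite gt_eqF.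
  by move: (K * _) h => *; lra.
have [N NP] := orthonormal_family_bound K0 sK.
(* [P n] says that some closed invariant subspace of [E] with a nonnull vector has dimension at most
   n; the least n is taken below. *)
pose P n := `[< exists F, [/\ closed_subspace F, S_invariant F, F `<=` E,
  (exists2 g, F g & 0 < nsq g) &
  forall k (e : 'I_k -> V), (forall i, F (e i)) -> orthonormal_family e ->
    (k <= n)%N] >].
have exP : exists n, P n.
  by exists N; apply/asboolP; exists E; split => //; exists g0.
case: (ex_minnP exP) => n /asboolP[F [cF SF FE [g Fg ng] Fn]] nmin.
have [sF cFF] := cF.
have n0 : (0 < n)%N.
  apply: (Fn 1%N (fun=> (Num.sqrt (nsq g))^-1 *: g)) => [_|i j].
    exact: subspaceZ.
  by rewrite !ord1 eqxx nsq_normalize.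
exists g; split => //; first by have [] := FE _ Fg.
move=> i.
have c0 : 0 <= c i.
  by have := le_trans (normr_ge0 _) (S_bound i g); rewrite pmulr_lge0.
(* [top_eigenvector] wants a nonnegative form: shifting [S i] by [c i + 1] achieves this, with a
   strict lower bound, and keeps the eigenvectors. *)
pose B' u v := dot (S i u) v + (c i + 1) * dot u v.
have sB' : symform B'.
  split=> *; rewrite /B'.
  - by rewrite S_adj ![dot _ (S i _)](symformC sd) [X in _ * X](symformC sd).
  - by rewrite !S_adj !(symformDl sd); ring.
  - by rewrite !S_adj !(symformZl sd); ring.
have B'b u : nsq u <= B' u u <= (2 * c i + 1) * nsq u.
  have := S_bound i u; rewrite ler_norml /B' => /andP[h1 h2].
  by apply/andP; split; lra.
have C'0 : 0 <= 2 * c i + 1 by lra.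
have B'b0 u : 0 <= B' u u <= (2 * c i + 1) * nsq u.
  by have /andP[h ->] := B'b u; rewrite (le_trans _ h).
have B'c : compact_form B' F.
  move=> eps e0; exists s, ((2 * c i + 1) * K); split; first exact: mulr_ge0.
  move=> u Fu; have /andP[_ /le_trans] := B'b u; apply.
  rewrite -mulrA; apply: (@le_trans _ _ ((2 * c i + 1) * (K * \sum_(v <- s) dot u v ^+ 2))).
    by rewrite ler_wpM2l// sK//; exact: FE.
  by rewrite lerDr mulr_ge0// ltW.
have B'pos : exists2 u, F u & 0 < B' u u.
  by exists g => //; have /andP[h _] := B'b g; rewrite (lt_le_trans ng).
have SB' j u v : B' (S j u) v = B' u (S j v).
  by rewrite /B' S_comm !S_adj.
have [mu [mu0 B'mu [w [Fw nw Ew]]]] := top_eigenvector cF sB' B'b0 B'c B'pos.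
pose E' := top_eigenspace B' mu F.
have cE' : closed_subspace E' by apply: top_eigenspace_closed B'mu.
have SE' : S_invariant E' by exact: top_eigenspace_invariant.
have [FE'|] := pselect (F `<=` E').
  have /(top_eigenspaceP cF sB' B'mu Fg) gP := FE' _ Fg.
  exists (mu - (c i + 1)).
  set z := S i g - _.
  have Fz : F z by apply: subspaceB => //; [exact: SF|exact: subspaceZ].
  have := gP _ Fz; rewrite /B' => h.
  have -> : nsq z = dot (S i g) z - (mu - (c i + 1)) * dot g z.
    by rewrite {1}/z (symformDl sd) (symformNl sd) (symformZl sd).
  by move: (dot _ z) (dot g z) h => *; lra.
move=> /existsNP[u /not_implyP[Fu E'u]]; exfalso.
(* The part of [u] orthogonal to [E'] lengthens every orthonormal family of [E'] by one inside [F].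
   So [E'] has dimension at most n - 1, against minimality. *)
have [p E'p up] := projection u cE'.
have E'F : E' `<=` F by move=> ? [].
pose z := u - p.
have Fz : F z by apply: subspaceB => //; exact: E'F.
have nz : 0 < nsq z.
  rewrite lt_neqAle d0 andbT; apply/eqP => z0; apply: E'u; apply: cE'.2 => eps e0.
  by exists p => //; rewrite -/z -z0 ltW.
pose z' := (Num.sqrt (nsq z))^-1 *: z.
have nz' : nsq z' = 1 by exact: nsq_normalize.
have z'0 v : E' v -> dot z' v = 0.
  by move=> E'v; rewrite (symformZl sd) (up v)// mulr0.
have : P n.-1.
  apply/asboolP; exists E'; split => //.
  - by move=> v /E'F /FE.
  - by exists w.
  move=> k e eE' eP.
  pose e' (j : 'I_k.+1) := oapp e z' (unlift ord_max j).
  rewrite -ltnS prednK//; apply: (Fn _ e') => [j|j l].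
    rewrite /e'; case: unliftP => [j' _|_] /=; last exact: subspaceZ.
    exact: E'F.
  rewrite /e'; case: unliftP => [j' ->|->]; case: unliftP => [l' ->|->] /=.
  - by rewrite eP (inj_eq lift_inj).
  - rewrite eq_sym (negbTE (neq_lift _ _)).
    by rewrite (symformC sd) z'0.
  - by rewrite (negbTE (neq_lift _ _)) z'0.
  - by rewrite nz' eqxx.
by move=> /nmin; rewrite leqNgt prednK// leqnn.
Qed.

End selfadjoint_eigenvector.

End hilbert.

(** * Invariant means and almost periodic unitary actions *)

Section means.
Context {R : realType} {G : topologicalZmodType}.
Implicit Types (phi psi : G -> R).

Definition bounded_continuous phi :=
  continuous (phi : G -> R^o) /\ exists c : R, forall t, `|phi t| <= c.

(** The laws concern bounded continuous functions, the class in which Folner averages are shown to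
    be linear; strong continuity of orbits brings all matrix coefficients used below into it. *)
Record invariant_mean (M : (G -> R) -> R) : Prop := InvariantMean {
  mean_lin : forall (a : R) phi psi,
    bounded_continuous phi -> bounded_continuous psi ->
    M (fun t => a * phi t + psi t) = a * M phi + M psi ;
  mean_ge0 : forall phi, bounded_continuous phi -> (forall t, 0 <= phi t) ->
    0 <= M phi ;
  mean1 : M (fun=> 1) = 1 ;
  mean_shift : forall phi s, bounded_continuous phi ->
    M (fun t => phi (t + s)) = M phi
}.

Lemma bounded_continuous_cst (c : R) : bounded_continuous (fun=> c).
Proof. by split; [move=> t; exact: cvg_cst|exists `|c|]. Qed.

Lemma bounded_continuousD phi psi : bounded_continuous phi ->
  bounded_continuous psi -> bounded_continuous (fun t => phi t + psi t).
Proof.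
move=> [cphi [c cP]] [cpsi [d dP]]; split.
  by move=> t; apply: cvgD; [exact: cphi|exact: cpsi].
by exists (c + d) => t; apply: (le_trans (ler_normD _ _)); exact: lerD.
Qed.

Lemma bounded_continuousM phi psi : bounded_continuous phi ->
  bounded_continuous psi -> bounded_continuous (fun t => phi t * psi t).
Proof.
move=> [cphi [c cP]] [cpsi [d dP]]; split.
  by move=> t; apply: cvgM; [exact: cphi|exact: cpsi].
by exists (c * d) => t; rewrite normrM; exact: ler_pM.
Qed.

Lemma bounded_continuousZ (a : R) phi : bounded_continuous phi ->
  bounded_continuous (fun t => a * phi t).
Proof. by move=> ?; apply: bounded_continuousM => //; exact: bounded_continuous_cst. Qed.

Lemma bounded_continuous_sum (I : Type) (s : seq I) (phi : I -> G -> R) :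
  (forall i, bounded_continuous (phi i)) ->
  bounded_continuous (fun t => \sum_(i <- s) phi i t).
Proof.
move=> bphi; elim: s => [|i s IH].
  rewrite (_ : (fun _ => _) = (fun=> 0)); first exact: bounded_continuous_cst.
  by apply/funext => t; rewrite big_nil.
rewrite (_ : (fun _ => _) = (fun t => phi i t + \sum_(j <- s) phi j t)).
  exact: bounded_continuousD.
by apply/funext => t; rewrite big_cons.
Qed.

Section theory.
Variable M : (G -> R) -> R.
Hypothesis hM : invariant_mean M.

Lemma meanD phi psi : bounded_continuous phi -> bounded_continuous psi ->
  M (fun t => phi t + psi t) = M phi + M psi.
Proof.
move=> bphi bpsi; rewrite -[M phi]mul1r -(mean_lin hM)//; congr M.
by apply/funext => t; rewrite mul1r.
Qed.

Lemma mean0 : M (fun=> 0) = 0.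
Proof.
have := meanD (bounded_continuous_cst 0) (bounded_continuous_cst 0).
rewrite (_ : (fun _ => _) = (fun=> 0)) => [h|]; last by apply/funext => t; rewrite addr0.
by apply: (addrI (M (fun=> 0))); rewrite -h addr0.
Qed.

Lemma meanZ (a : R) phi : bounded_continuous phi ->
  M (fun t => a * phi t) = a * M phi.
Proof.
move=> bphi; rewrite -[RHS]addr0 -mean0 -(mean_lin hM)//; last first.
  exact: bounded_continuous_cst.
by congr M; apply/funext => t; rewrite addr0.
Qed.

Lemma mean_cst (c : R) : M (fun=> c) = c.
Proof.
rewrite -[RHS]mulr1 -(mean1 hM) -meanZ; last exact: bounded_continuous_cst.
by congr M; apply/funext => t; rewrite mulr1.
Qed.

Lemma mean_le phi psi : bounded_continuous phi -> bounded_continuous psi ->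
  (forall t, phi t <= psi t) -> M phi <= M psi.
Proof.
move=> bphi bpsi h.
have : 0 <= M (fun t => -1 * phi t + psi t).
  apply: (mean_ge0 hM); last by move=> t; rewrite mulN1r addrC subr_ge0.
  by apply: bounded_continuousD => //; exact: bounded_continuousZ.
by rewrite (mean_lin hM)// mulN1r addrC subr_ge0.
Qed.

Lemma mean_sum (I : Type) (s : seq I) (phi : I -> G -> R) :
  (forall i, bounded_continuous (phi i)) ->
  M (fun t => \sum_(i <- s) phi i t) = \sum_(i <- s) M (phi i).
Proof.
move=> bphi; elim: s => [|i s IH].
  rewrite big_nil -[RHS]mean0; congr M.
  by apply/funext => t; rewrite big_nil.
rewrite big_cons -IH -meanD//; last exact: bounded_continuous_sum.
by congr M; apply/funext => t; rewrite big_cons.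
Qed.

End theory.
End means.

(** * Total boundedness through finite colourings *)

Section total_boundedness.
Context {R : realType} {G : eqType}.
Implicit Types (rho : G -> G -> R).

(* Colourings make finite joins of totally bounded pseudometrics immediate. *)
Definition totally_bounded rho := forall eps : R, 0 < eps ->
  exists (F : finType) (c : G -> F), forall s t, c s = c t -> rho s t <= eps.

Lemma totally_boundedD rho rho' : totally_bounded rho -> totally_bounded rho' ->
  totally_bounded (fun s t => rho s t + rho' s t).
Proof.
move=> tb tb' eps e0; have e2 : 0 < eps / 2 by rewrite divr_gt0.
have [F [c cP]] := tb _ e2; have [F' [c' cP']] := tb' _ e2.
exists (F * F')%type, (fun t => (c t, c' t)) => s t [h h'].
by rewrite (splitr eps) lerD// ?cP// cP'.
Qed.

(** Both the constant and the comparison function may depend on eps, which is the kind of estimate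
    that density arguments produce. *)
Lemma totally_bounded_le rho : (forall eps : R, 0 < eps ->
    exists (K : R) (rho' : G -> G -> R), [/\ 0 <= K, totally_bounded rho' &
      forall s t, rho s t <= eps + K * rho' s t]) ->
  totally_bounded rho.
Proof.
move=> h eps e0; have e2 : 0 < eps / 2 by rewrite divr_gt0.
have [K [rho' [K0 tb le_rho]]] := h _ e2.
have e3 : 0 < eps / 2 / (K + 1) by rewrite divr_gt0 ?ltr_wpDl.
have [F [c cP]] := tb _ e3; exists F, c => s t /cP.
rewrite ler_pdivlMr ?ltr_wpDl// => st; apply: (le_trans (le_rho s t)).
rewrite [leRHS](splitr eps) lerD2l.
(* [rho'] may be negative, in which case its product with [K] only helps. *)
have [r0|r0] := leP 0 (rho' s t).
  by apply: le_trans st; rewrite mulrC ler_wpM2l ?lerDl.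
by rewrite (@le_trans _ _ 0)// ?(ltW e2)// mulr_ge0_le0// ltW.
Qed.

Lemma totally_bounded_sum (I : Type) (s : seq I) (rho : I -> G -> G -> R) :
  (forall i, totally_bounded (rho i)) ->
  totally_bounded (fun t t' => \sum_(i <- s) rho i t t').
Proof.
move=> tb; elim: s => [|i s IH] eps e0.
  by exists unit, (fun=> tt) => *; rewrite big_nil ltW.
have [F [c cP]] := totally_boundedD (tb i) IH e0.
by exists F, c => *; rewrite big_cons cP.
Qed.

Lemma totally_bounded_net rho (x0 : G) : totally_bounded rho ->
  forall eps : R, 0 < eps ->
  exists s : seq G, forall t, exists2 u, u \in s & rho t u <= eps.
Proof.
move=> tb eps e0; have [F [c cP]] := tb _ e0.
(* One representative is chosen per colour; colours that do not occur receive an arbitrary value. *)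
have /choice[r rP] : forall i, exists u, (exists t, c t = i) -> c u = i.
  by move=> i; have [[t <-]|h] := pselect (exists t, c t = i); [exists t|exists x0].
exists [seq r i | i <- enum F] => t; exists (r (c t)).
  by apply/mapP; exists (c t) => //; rewrite mem_enum.
by apply: cP; rewrite rP//; exists t.
Qed.

End total_boundedness.

(** * An eigenvector from one totally bounded orbit *)

Section unitary_action.
Context {R : realType} {V : lmodType R} {G : topologicalZmodType}.
Variables (dot : V -> V -> R) (T : G -> V -> V) (J : V -> V).
Local Notation nsq u := (dot u u).

(* [J] is multiplication by the imaginary unit on the underlying real space. *)
Record unitary_action : Prop := UnitaryAction {
  actionTD : forall s t u, T (s + t) u = T s (T t u) ;
  actionT0 : forall u, T 0 u = u ;
  actionT_add : forall t u v, T t (u + v) = T t u + T t v ;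
  actionT_scale : forall t (a : R) u, T t (a *: u) = a *: T t u ;
  actionT_isom : forall t u v, dot (T t u) (T t v) = dot u v ;
  actionJ_add : forall u v, J (u + v) = J u + J v ;
  actionJ_scale : forall (a : R) u, J (a *: u) = a *: J u ;
  actionJ_isom : forall u v, dot (J u) (J v) = dot u v ;
  actionJJ : forall u, J (J u) = - u ;
  actionJT : forall t u, J (T t u) = T t (J u)
}.

(** A squared distance, so its triangle inequality has a factor 2. *)
Definition orbit_dist h s t := nsq (T s h - T t h).

Definition strongly_continuous h := forall s (eps : R), 0 < eps ->
  \forall t \near s, orbit_dist h t s <= eps.

Hypotheses (hV : hilbert_form dot) (uA : unitary_action).
Let sd := hilbert_sym hV.
Let d0 := hilbert_ge0 hV.

Lemma actionT_adj t u v : dot (T t u) v = dot u (T (- t) v).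
Proof. by rewrite -(actionT_isom uA (- t)) -(actionTD uA) addNr (actionT0 uA). Qed.

Lemma actionJ_adj u v : dot (J u) v = - dot u (J v).
Proof. by rewrite -(actionJ_isom uA) (actionJJ uA) (symformNl sd). Qed.

Lemma actionT_opp t u : T t (- u) = - T t u.
Proof. by rewrite -scaleN1r (actionT_scale uA) scaleN1r. Qed.

Lemma actionJ_opp u : J (- u) = - J u.
Proof. by rewrite -scaleN1r (actionJ_scale uA) scaleN1r. Qed.

Lemma dot_le_half u v : `|dot u v| <= (nsq u + nsq v) / 2.
Proof.
have := d0 (u - v); rewrite (symform_sqB sd) => h1.
have := d0 (u + v); rewrite (symform_sqD sd) => h2.
by rewrite ler_norml; apply/andP; split; lra.
Qed.

Lemma strongly_continuous_dot g h : strongly_continuous h ->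
  bounded_continuous (fun t => dot g (T t h)).
Proof.
move=> ch; split; last first.
  exists ((nsq g + nsq h) / 2) => t.
  by rewrite -(actionT_isom uA t h); exact: dot_le_half.
move=> s; apply/cvgrPdist_le => /= eps e0.
have e1 : 0 < eps ^+ 2 / (nsq g + 1) by rewrite divr_gt0 ?exprn_gt0 ?ltr_wpDl.
apply: filterS (ch s _ e1) => t; rewrite ler_pdivlMr ?ltr_wpDl// => h1.
rewrite -(symformNr sd) -(symformDr sd) -(@ler_pXn2r _ 2)// ?nnegrE ?(ltW e0)//.
rewrite real_normK ?num_real//; apply: (le_trans (dot_le hV _ _)).
rewrite (nsqC hV); apply: le_trans h1; rewrite mulrC ler_wpM2l//.
by rewrite lerDl.
Qed.

Section orbit_form.
Variables (M : (G -> R) -> R) (h : V).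
Hypotheses (hM : invariant_mean M) (ch : strongly_continuous h).

(** The real part of the mean of <g, T_t h><T_t h, g'>: the products with T_t h and with [J] (T_t h)
    are the real and imaginary parts of <g, T_t h>. Having both terms is what makes the form
    compatible with [J]. *)
Definition orbit_form g g' : R := M (fun t =>
  dot g (T t h) * dot g' (T t h) + dot g (J (T t h)) * dot g' (J (T t h))).

Let bc g : bounded_continuous (fun t => dot g (T t h)).
Proof. exact: strongly_continuous_dot. Qed.

Let bcJ g : bounded_continuous (fun t => dot g (J (T t h))).
Proof.
rewrite (_ : (fun _ => _) = (fun t => -1 * dot (J g) (T t h))).
  exact: bounded_continuousZ.
by apply/funext => t; rewrite actionJ_adj mulN1r opprK.
Qed.

Lemma orbit_form_bc g g' : bounded_continuous (fun t =>
  dot g (T t h) * dot g' (T t h) + dot g (J (T t h)) * dot g' (J (T t h))).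
Proof. by apply: bounded_continuousD; exact: bounded_continuousM. Qed.

Lemma orbit_form_sym : symform orbit_form.
Proof.
split => [u v|u v w|a u v]; rewrite /orbit_form.
- by congr M; apply/funext => t; rewrite mulrC [X in _ + X]mulrC.
- rewrite -(meanD hM)//; try exact: orbit_form_bc.
  by congr M; apply/funext => t; rewrite !(symformDl sd); ring.
- rewrite -(meanZ hM)//; last exact: orbit_form_bc.
  by congr M; apply/funext => t; rewrite !(symformZl sd); ring.
Qed.

Lemma orbit_form_bound g : 0 <= orbit_form g g <= (2 * nsq h) * nsq g.
Proof.
apply/andP; split.
  by apply: (mean_ge0 hM) => [|t]; [exact: orbit_form_bc|rewrite addr_ge0// -expr2 sqr_ge0].
rewrite -[leRHS](mean_cst hM); apply: (mean_le hM).
- exact: orbit_form_bc.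
- exact: bounded_continuous_cst.
move=> t; rewrite -!expr2.
have := dot_le hV g (T t h); have := dot_le hV g (J (T t h)).
by rewrite (actionJ_isom uA) !(actionT_isom uA) => h1 h2; lra.
Qed.

(** Replacing t by t + s under the invariant mean and cancelling the isometry T_s moves the operator
    to the other argument. The form thus commutes with the action. *)
Lemma orbit_formT s g g' : orbit_form (T s g) g' = orbit_form g (T (- s) g').
Proof.
rewrite /orbit_form -[LHS](mean_shift hM s); last exact: (orbit_form_bc (T s g) g').
congr M; apply/funext => t.
rewrite [t + s]addrC (actionTD uA) !(actionJT uA) !(actionT_isom uA).
by rewrite !(actionT_adj (- s)) opprK.
Qed.

Lemma orbit_formJ g g' : orbit_form (J g) g' = - orbit_form g (J g').
Proof.
rewrite -mulN1r -(meanZ hM); last exact: orbit_form_bc.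
congr M; apply/funext => t.
by rewrite !actionJ_adj !(actionJJ uA) !(symformNr sd); ring.
Qed.

Hypothesis tb : totally_bounded (orbit_dist h).

(** Each T_t h is replaced by an element of a finite net of the orbit. With a net at level eps/4,
    each of the two squares in the form costs eps/2 * |g|^2. *)
Lemma orbit_form_compact W : compact_form dot orbit_form W.
Proof.
move=> eps e0; have e4 : 0 < eps / 4 by rewrite divr_gt0.
have [s sP] := totally_bounded_net 0 tb e4.
exists ([seq T u h | u <- s] ++ [seq J (T u h) | u <- s]), 2; split => // g _.
rewrite -[leRHS](mean_cst hM); apply: (mean_le hM).
- exact: orbit_form_bc.
- exact: bounded_continuous_cst.
move=> t; have [u us tu] := sP t.
rewrite big_cat !big_map/= -!expr2.
have term (X : V -> V) : (forall a b, X (a - b) = X a - X b) ->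
    (forall a, nsq (X a) = nsq a) ->
    dot g (X (T t h)) ^+ 2 <= eps / 2 * nsq g + 2 * \sum_(u <- s) dot g (X (T u h)) ^+ 2.
  move=> XB Xn.
  have h1 : dot g (X (T u h)) ^+ 2 <= \sum_(u <- s) dot g (X (T u h)) ^+ 2.
    by rewrite (big_rem u)//= lerDl sumr_ge0// => v _; exact: sqr_ge0.
  have : dot g (X (T t h) - X (T u h)) ^+ 2 <= nsq g * (eps / 4).
    apply: (le_trans (dot_le hV _ _)).
    by rewrite ler_wpM2l// -XB Xn.
  rewrite (symformDr sd) (symformNr sd).
  move: h1; set a := dot g (X (T t h)); set b := dot g _ => h1 h2.
  have : a ^+ 2 <= 2 * (a - b) ^+ 2 + 2 * b ^+ 2 by have := sqr_ge0 (a - 2 * b); nra.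
  by move: (a ^+ 2) ((a - b) ^+ 2) (b ^+ 2) h1 h2 => *; lra.
have h1 := term id (fun _ _ => erefl) (fun _ => erefl).
have JB a b : J (a - b) = J a - J b by rewrite (actionJ_add uA) actionJ_opp.
have h2 := term J JB (fun a => actionJ_isom uA a a).
by move: (dot g _ ^+ 2) (dot g _ ^+ 2) (\sum_(_ <- _) _) (\sum_(_ <- _) _) h1 h2 => *; lra.
Qed.

(** If the form vanished at h, it would by invariance vanish at all T_u h with u in a finite net.
    But a net at level |h|^2 / 2 contains, for every t, some u whose product of T_u h with T_t h is
    at least 3/4 |h|^2, so the sum over the net has a positive mean. *)
Lemma orbit_form_gt0 : 0 < nsq h -> 0 < orbit_form h h.
Proof.
move=> nh; have n2 : 0 < nsq h / 2 by rewrite divr_gt0.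
have [s sP] := totally_bounded_net 0 tb n2.
rewrite lt_neqAle; have /andP[-> _] := orbit_form_bound h; rewrite andbT.
apply/eqP => /esym B0.
have Bu u : orbit_form (T u h) (T u h) = 0.
  by rewrite orbit_formT -(actionTD uA) addNr (actionT0 uA).
have : 0 < \sum_(u <- s) orbit_form (T u h) (T u h).
  rewrite -(mean_sum hM) => [|i]; last exact: orbit_form_bc.
  have n3 : 0 < (3 * nsq h / 4) ^+ 2 by rewrite exprn_gt0// divr_gt0 ?mulr_gt0.
  apply: (lt_le_trans n3); rewrite -[leLHS](mean_cst hM); apply: (mean_le hM).
  - exact: bounded_continuous_cst.
  - by apply: bounded_continuous_sum => i; exact: orbit_form_bc.
  move=> t; have [u us] := sP t; rewrite /orbit_dist => tu.
  have h1 : 3 * nsq h / 4 <= dot (T u h) (T t h).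
    move: tu; rewrite (symform_sqB sd) !(actionT_isom uA) (symformC sd (T t h)).
    by move: (nsq h) (dot _ _) => *; lra.
  have h2 : (3 * nsq h / 4) ^+ 2 <= dot (T u h) (T t h) ^+ 2.
    rewrite ler_pXn2r// ?nnegrE ?divr_ge0 ?mulr_ge0// (le_trans _ h1)//.
    by rewrite divr_ge0// mulr_ge0.
  apply: (le_trans h2); rewrite (big_rem u)//= expr2 -addrA lerDl addr_ge0//.
    by rewrite -expr2 sqr_ge0.
  by apply: sumr_ge0 => v _; rewrite addr_ge0// -expr2 sqr_ge0.
by rewrite big1 ?ltxx.
Qed.

End orbit_form.

Lemma unitary_eigenvector (M : (G -> R) -> R) (W : set V) h :
  invariant_mean M -> closed_subspace dot W ->
  (forall t u, W u -> W (T t u)) -> (forall u, W u -> W (J u)) ->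
  strongly_continuous h -> totally_bounded (orbit_dist h) ->
  W h -> 0 < nsq h ->
  exists w, [/\ W w, 0 < nsq w &
    forall t, exists a b : R, nsq (T t w - (a *: w + b *: J w)) = 0].
Proof.
move=> hM cW WT WJ ch tb Wh nh; have [sW _] := cW.
(* Twice the cosine part of T_i, and twice its sine part up to sign. The second is symmetric because
   [J] and T_t - T_{-t} are both skew and commute. *)
pose S (i : G * bool) u :=
  if i.2 then J (T i.1 u - T (- i.1) u) else T i.1 u + T (- i.1) u.
have J_add u v : J (u + v) = J u + J v by exact: actionJ_add.
have T_add t u v : T t (u + v) = T t u + T t v by exact: actionT_add.
have TC s t u : T s (T t u) = T t (T s u) by rewrite -!(actionTD uA) addrC.
have Sadj i u v : dot (S i u) v = dot u (S i v).
  case: i => t []; rewrite /S/=.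
    rewrite actionJ_adj (symformDl sd) (symformNl sd) !actionT_adj opprK.
    rewrite J_add actionJ_opp (symformDr sd) (symformNr sd) !(actionJT uA).
    by rewrite opprD opprK addrC.
  by rewrite (symformDl sd) (symformDr sd) !actionT_adj opprK addrC.
have Scomm i j u : S i (S j u) = S j (S i u).
  case: i => s b; case: j => t c; rewrite /S.
  by case: b; case: c; rewrite /= ?(J_add, T_add, actionJ_opp, actionT_opp,
    actionJT uA, actionJJ uA) !(TC s) !(TC (- s)) ?opprD ?opprK;
    rewrite ?opprD ?opprK addrACA.
have Sbound i u : `|dot (S i u) u| <= 2 * nsq u.
  have Tu t : `|dot (T t u) u| <= nsq u.
    have := dot_le_half (T t u) u; rewrite (actionT_isom uA).
    by move: (nsq u) => *; lra.
  have TJu t : `|dot (T t u) (J u)| <= nsq u.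
    have := dot_le_half (T t u) (J u); rewrite (actionT_isom uA) (actionJ_isom uA).
    by move: (nsq u) => *; lra.
  case: i => t []; rewrite /S/=.
    rewrite actionJ_adj normrN (symformDl sd) (symformNl sd).
    by apply: (le_trans (ler_normB _ _)); have := TJu t; have := TJu (- t); lra.
  rewrite (symformDl sd).
  by apply: (le_trans (ler_normD _ _)); have := Tu t; have := Tu (- t); lra.
have SW : S_invariant S W.
  move=> [t []] u Wu; rewrite /S/=.
    by apply: WJ; apply: (subspaceB sW); exact: WT.
  by apply: (subspaceD sW); exact: WT.
pose B := orbit_form M h.
have sB : symform B by exact: orbit_form_sym.
have BT s u v : B (T s u) v = B u (T (- s) v) by exact: orbit_formT.
have BJ u v : B (J u) v = - B u (J v) by exact: orbit_formJ.
have SB i u v : B (S i u) v = B u (S i v).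
  case: i => t []; rewrite /S/=.
    rewrite BJ (symformDl sB) (symformNl sB) !BT opprK.
    rewrite J_add actionJ_opp (symformDr sB) (symformNr sB) !(actionJT uA).
    by rewrite opprD opprK addrC.
  by rewrite (symformDl sB) (symformDr sB) !BT opprK addrC.
have Bb := orbit_form_bound hM ch.
have C0 : 0 <= 2 * nsq h by rewrite mulr_ge0.
have Bpos : exists2 g, W g & 0 < B g g by exists h => //; exact: orbit_form_gt0.
have [w [Ww nw Sw]] := selfadjoint_eigenvector hV Sadj Scomm Sbound cW sB Bb C0
  (orbit_form_compact hM ch tb W) Bpos SW SB.
exists w; split => // t.
have [a aP] := Sw (t, false); have [b bP] := Sw (t, true).
exists (a / 2), (- b / 2).
set z := T t w - _.
(* Since 2 T_t is the first operator minus [J] times the second, the complex eigenvalue is (a -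
   ib)/2. *)
have zE : 2 *: z = (S (t, false) w - a *: w) - J (S (t, true) w - b *: w).
  rewrite /S/= !(J_add, actionJ_opp, actionJJ uA, actionJ_scale uA) /z.
  rewrite scalerBr scalerDr !scalerA.
  have -> : 2 * (a / 2) = a by field.
  have -> : 2 * (- b / 2) = - b by field.
  rewrite scaleNr scaler_nat mulr2n !opprD !opprK [RHS]addrACA; congr (_ + _).
  by rewrite addrACA subrr addr0.
have : nsq (2 *: z) <= 0.
  rewrite zE; apply: (le_trans (nsqB_le hV _ _)).
  by rewrite (actionJ_isom uA) aP bP mulr0 addr0.
rewrite (symformZl sd) (symformZr sd) => h1.
by apply/eqP; rewrite eq_le d0 andbT; move: (nsq z) h1 => *; lra.
Qed.

End unitary_action.

(** * Averages along Folner sequences *)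

Section borel_measurability.

Lemma generated_measurable (P : pointedType) (O : set (set P)) (A : set P) :
  O A -> measurable (A : set (g_sigma_algebraType O)).
Proof. exact: sub_sigma_algebra. Qed.

Lemma generated_measurable_fun (P : pointedType) (O : set (set P))
    (R : realType) (f : P -> R) :
  (forall U : set R, open U -> O (f @^-1` U)) ->
  measurable_fun setT (f : g_sigma_algebraType O -> R).
Proof.
move=> Of; apply: (measurability _ (RGenOpens.measurableE R)).
move=> _ [_ [a [b ->] <-]]; rewrite setTI; apply: generated_measurable.
exact/Of/interval_open.
Qed.

Lemma generated_measurable_self (P Q : pointedType) (O : set (set P))
    (O' : set (set Q)) (f : P -> Q) :
  (forall U : set Q, O' U -> O (f @^-1` U)) ->
  measurable_fun setT (f : g_sigma_algebraType O -> g_sigma_algebraType O').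
Proof.
move=> Of; apply: (@measurability _ _ (g_sigma_algebraType O)
  (g_sigma_algebraType O') setT f O' erefl).
move=> _ [A OA <-]; rewrite setTI; apply: generated_measurable; exact: Of.
Qed.

End borel_measurability.

(** Finite subcovers by neighbourhoods indexed by their centres, in the form used for every finite
    net below. *)
Lemma compact_seq_cover (T : topologicalType) (K : set T) (U : T -> set T) :
  compact K -> (forall x, K x -> nbhs x (U x)) ->
  exists2 s : seq T, (forall x, x \in s -> K x) &
    forall y, K y -> exists2 x, x \in s & U x y.
Proof.
move=> /compact_near_coveringP cK KU.
(* The filter of finite lists directed by inclusion: near-covering compactness along it yields one
   list that is large enough for all points. *)
pose F := [set A : set (seq T) | exists s0 : seq T,
    forall s : seq T, {subset s0 <= s} -> A s].
have FF : Filter F.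
  split => [|A B [s sA] [s' s'B]|A B AB [s sA]].
  - by exists [::].
  - exists (s ++ s') => v sv; split.
      by apply: sA => x xs; apply: sv; rewrite mem_cat xs.
    by apply: s'B => x xs; apply: sv; rewrite mem_cat xs orbT.
  - by exists s => v /sA /AB.
have := cK _ F (fun s y => exists x, [/\ x \in s, K x & U x y]) FF.
case=> [x Kx|s0 /(_ s0 (fun _ => id)) s0P].
  exists (U x, [set s : seq T | x \in s]) => /=; last by move=> [y s] /= [Uy xs]; exists x.
  by split; [exact: KU|exists [:: x] => s; apply; rewrite mem_seq1].
exists [seq x <- s0 | `[< K x >]] => [x|y /s0P[x [xs Kx Uxy]]].
  by rewrite mem_filter => /andP[/asboolP].
by exists x; rewrite // mem_filter xs andbT; exact/asboolP.
Qed.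

(** * Haar measure, Folner averages and the invariant mean *)

Section haar.
Context {R : realType} {G : topologicalZmodType}.
Variables (mu : {measure set (borel_group G) -> \bar R}).
Hypotheses (G_hausdorff : hausdorff_space G) (mu_haar : haar_measure mu).

Lemma open_borel (A : set G) : open A -> measurable (A : set (borel_group G)).
Proof. exact: (@generated_measurable (zpointed G)). Qed.

Lemma closed_borel (A : set G) : closed A -> measurable (A : set (borel_group G)).
Proof.
move=> cA; rewrite -(setCK A); apply: measurableC.
by apply: open_borel; exact: closed_openC.
Qed.

Lemma continuous_add (s : G) : continuous (fun t : G => s + t).
Proof.
move=> t; apply: (@cvg_comp _ _ _ (fun t => (s, t)) (fun p => p.1 + p.2) _ (nbhs (s, t))).
  by apply: cvg_pair; [exact: cvg_cst|exact: cvg_id].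
exact: (@add_continuous G (s, t)).
Qed.

Lemma translateE (s : G) (A : set G) : translate s A = (fun t => - s + t) @^-1` A.
Proof.
apply/seteqP; split => [_ [t At <-]|t At] /=; first by rewrite addrA addNr add0r.
by exists (- s + t); rewrite // addrA addrN add0r.
Qed.

Lemma translate_open (s : G) (A : set G) : open A -> open (translate s A).
Proof.
move=> oA; rewrite translateE; apply: open_comp => // t _; exact: continuous_add.
Qed.

Lemma continuous_borel (phi : G -> R) : continuous (phi : G -> R^o) ->
  measurable_fun setT (phi : borel_group G -> R).
Proof.
move=> /continuousP cphi.
exact: (@generated_measurable_fun (zpointed G)).
Qed.

(** Finitely many translates of [U] cover each compact set; if [U] were null, so would be every
    compact set and, by sigma-compactness, the whole group. *)
Lemma haar_open_gt0 (U : set G) : sigma_compact G -> open U -> U !=set0 ->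
  (0 < mu (U : set (borel_group G)))%E.
Proof.
move=> [K [cK KG]] oU [u Uu]; rewrite lt_neqAle measure_ge0 andbT; apply/eqP => U0.
apply: (haar_nonzero mu_haar).
have K0 n : mu (K n : set (borel_group G)) = 0%E.
  have [t Kt|D _ KD] := compact_seq_cover (U := fun t => translate (t - u) U) (cK n).
    apply: open_nbhs_nbhs; split; first exact: translate_open.
    by exists u => //; rewrite subrK.
  have mU (t : G) : mu.-negligible (translate t U : set (borel_group G)).
    have oU' := translate_open t oU.
    apply/negligibleP; first exact: open_borel.
    by rewrite [LHS](haar_invariant mu_haar t (open_borel oU)).
  suff : mu.-negligible (K n : set (borel_group G)).
    move=> /negligibleP -> //; apply: closed_borel.
    exact: compact_closed.
  have neg (s : seq G) : mu.-negligible
      ([set x | exists2 t, t \in s & translate (t - u) U x] : set (borel_group G)).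
    elim: s => [|t s IH].
      by apply: negligibleS (negligible_set0 mu) => x [].
    apply: negligibleS (negligibleU (mU (t - u)) IH) => x [v].
    by rewrite inE => /orP[/eqP ->|vs]; [left|right; exists v].
  by apply: negligibleS (neg D).
have : mu.-negligible (\bigcup_n (K n : set (borel_group G))).
  apply: negligible_bigcup => n; apply/negligibleP; last exact: K0.
  by apply: closed_borel; exact: compact_closed.
have KT : (setT : set (borel_group G)) `<=` \bigcup_n K n.
  by move=> x _; have : [set: G] x by []; rewrite -KG.
by move=> /(negligibleS KT) /negligibleP; apply.
Qed.

Lemma precompact_haar_fin (U : set G) : open U -> precompact U ->
  (mu (U : set (borel_group G)) < +oo)%E.
Proof.
rewrite precompactE => oU cU.
apply: (@le_lt_trans _ _ (mu (closure U : set (borel_group G)))).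
  apply: le_measure; rewrite ?inE; [exact: open_borel| |exact: subset_closure].
  by apply: closed_borel; exact: closed_closure.
exact: (haar_compact mu_haar).
Qed.

Section folner_averages.
Variable B : nat -> set G.
Hypotheses (G_sigma_compact : sigma_compact G) (B_folner : folner mu B).

Let mB n : measurable (B n : set (borel_group G)).
Proof. by apply: open_borel; exact: folner_open B_folner n. Qed.

Let B_fin n : (mu (B n : set (borel_group G)) < +oo)%E.
Proof.
by apply: precompact_haar_fin; [exact: folner_open B_folner n|
  exact: folner_precompact B_folner n].
Qed.

Let B_gt0 n : 0 < fine (mu (B n : set (borel_group G))).
Proof.
rewrite fine_gt0// B_fin andbT.
by apply: haar_open_gt0 => //; [exact: folner_open B_folner n|
  exact: folner_nonempty B_folner n].
Qed.

Lemma bounded_continuous_integrable (A : set (borel_group G)) (phi : G -> R) :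
  measurable A -> (mu A < +oo)%E -> bounded_continuous phi ->
  mu.-integrable A (EFin \o (phi : borel_group G -> R)).
Proof.
move=> mA Afin [cphi [c phic]]; apply: measurable_bounded_integrable => //.
  by apply: measurable_funTS; exact: continuous_borel.
exists c; split; first exact: num_real.
by move=> x cx y _ /=; apply: le_trans (ltW cx); exact: phic.
Qed.

Let integrableB n (phi : G -> R) : bounded_continuous phi ->
  mu.-integrable (B n) (EFin \o (phi : borel_group G -> R)).
Proof. exact: bounded_continuous_integrable. Qed.

Lemma average_lin (a : R) (phi psi : G -> R) n :
  bounded_continuous phi -> bounded_continuous psi ->
  average mu B (fun t => a * phi t + psi t) n =
  a * average mu B phi n + average mu B psi n.
Proof.
move=> bphi bpsi; rewrite /average RintegralD//.
- by rewrite RintegralZl ?mulrDr ?mulrA ?[a * _]mulrC//; exact: integrableB.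
- by apply: (@integrableB n (fun t => a * phi t)); exact: bounded_continuousZ.
- exact: integrableB.
Qed.

Lemma average_ge0 (phi : G -> R) n : (forall t, 0 <= phi t) ->
  0 <= average mu B phi n.
Proof.
move=> phi0; apply: mulr_ge0; first by rewrite invr_ge0 ltW.
exact: Rintegral_ge0.
Qed.

Lemma average_cst (c : R) n : average mu B (fun=> c) n = c.
Proof. by rewrite /average Rintegral_cst// mulrC mulfK// gt_eqF. Qed.

Lemma average_bound (phi : G -> R) (c : R) n : bounded_continuous phi ->
  (forall t, `|phi t| <= c) -> `|average mu B phi n| <= c.
Proof.
move=> bphi phic; have bc := bounded_continuous_cst c (G := G).
rewrite ler_norml; apply/andP; split.
  have := average_ge0 n (phi := fun t => 1 * phi t + c).
  rewrite average_lin// average_cst mul1r -lerBlDr sub0r; apply => t.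
  by rewrite mul1r -lerBlDr sub0r; have := phic t; rewrite ler_norml => /andP[].
have := average_ge0 n (phi := fun t => -1 * phi t + c).
rewrite average_lin// average_cst mulN1r addrC subr_ge0; apply => t.
by rewrite mulN1r addrC subr_ge0; have := phic t; rewrite ler_norml => /andP[].
Qed.

(** Change of variables: the translation by s is Borel and pushes [mu] forward to itself. *)
Lemma translate_Rintegral (s : G) (A : set G) (phi : G -> R) : open A ->
  (mu (A : set (borel_group G)) < +oo)%E -> bounded_continuous phi ->
  \int[mu]_(t in A) phi (t + s) = \int[mu]_(t in translate s A) phi t.
Proof.
move=> oA Afin bphi; pose tau (t : borel_group G) : borel_group G := s + t.
have mtau : measurable_fun setT tau.
  apply: (@generated_measurable_self (zpointed G) (zpointed G)) => U oU.
  by apply: open_comp => // t _; exact: continuous_add.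
have tauA : tau @^-1` translate s A = A.
  apply/seteqP; split => [t [u Au /addrI <-//]|t At]; by exists t.
have mA : measurable (A : set (borel_group G)) by exact: open_borel.
have msA : measurable (translate s A : set (borel_group G)).
  by apply: open_borel; exact: translate_open.
have bphis : bounded_continuous (fun t => phi (s + t)).
  have [cphi [c phic]] := bphi; split; last by exists c.
  by move=> t; apply: continuous_comp; [exact: continuous_add|exact: cphi].
rewrite /Rintegral; congr fine.
have := @integral_pushforward _ _ _ _ _ _ mtau mu (translate s A) (EFin \o phi).
rewrite tauA => /(_ _ _ msA) h.
under eq_integral do rewrite addrC.
rewrite -[LHS]h.
- apply: eq_measure_integral => D mD _.
  transitivity (mu (translate (- s) D)); last exact: haar_invariant.
  congr (mu _); by rewrite translateE opprK; exact: erefl.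
- by apply/measurable_EFinP; apply: continuous_borel; case: bphi.
- exact: (@bounded_continuous_integrable A _ mA Afin bphis).
Qed.

Definition folner_ratio (s : G) (n : nat) : R :=
  fine (mu ((B n `\` translate s (B n)) `|` (translate s (B n) `\` B n)
    : set (borel_group G))) / fine (mu (B n)).

(** The integrals over [B n] and its translate agree on the intersection, and each half of the
    symmetric difference costs at most c times its measure. *)
Lemma average_shift (phi : G -> R) (c : R) s n : bounded_continuous phi ->
  (forall t, `|phi t| <= c) ->
  `|average mu B (fun t => phi (t + s)) n - average mu B phi n| <=
  c * folner_ratio s n.
Proof.
move=> bphi phic; rewrite /average -mulrBr translate_Rintegral//; last first.
  exact: folner_open B_folner n.
set A := translate s (B n).
have oA : open A by apply: translate_open; exact: folner_open B_folner n.
have mA : measurable (A : set (borel_group G)) by exact: open_borel.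
have muA : mu (A : set (borel_group G)) = mu (B n) by exact: haar_invariant.
have A_fin : (mu (A : set (borel_group G)) < +oo)%E by rewrite muA.
have mAB : measurable (A `\` B n : set (borel_group G)) by exact: measurableD.
have mBA : measurable (B n `\` A : set (borel_group G)) by exact: measurableD.
have mI : measurable (A `&` B n : set (borel_group G)) by exact: measurableI.
have sub_fin (D E : set (borel_group G)) : measurable D -> measurable E ->
    D `<=` E -> (mu E < +oo)%E -> (mu D < +oo)%E.
  by move=> mD mE DE; apply: le_lt_trans; apply: le_measure; rewrite ?inE.
have AB_fin : (mu (A `\` B n : set (borel_group G)) < +oo)%E.
  by apply: (sub_fin _ A) => // x [].
have BA_fin : (mu (B n `\` A : set (borel_group G)) < +oo)%E.
  by apply: (sub_fin _ (B n)) => // x [].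
have EA : \int[mu]_(t in A) phi t =
    \int[mu]_(t in A `\` B n) phi t + \int[mu]_(t in A `&` B n) phi t.
  rewrite -Rintegral_setU//; first by rewrite setUC setUIDK.
  - by rewrite setUC setUIDK; exact: bounded_continuous_integrable.
  - by apply/disj_setPS => x [[_ +] [_]].
have EB : \int[mu]_(t in B n) phi t =
    \int[mu]_(t in B n `\` A) phi t + \int[mu]_(t in A `&` B n) phi t.
  rewrite [A `&` _]setIC -Rintegral_setU//; first by rewrite setUC setUIDK.
  - by rewrite setIC.
  - by rewrite setUC setUIDK; exact: integrableB.
  - by apply/disj_setPS => x [[_ +] [_]].
have le_c (D : set (borel_group G)) : measurable D -> (mu D < +oo)%E ->
    `|\int[mu]_(t in D) phi t| <= c * fine (mu D).
  move=> mD Dfin; apply: (le_trans (le_normr_Rintegral mD _)).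
    exact: bounded_continuous_integrable.
  rewrite -(Rintegral_cst mu mD c); apply: le_Rintegral => //.
  - apply: (@bounded_continuous_integrable D (fun t => `|phi t|)) => //.
    have [cphi _] := bphi; split.
      by move=> t; apply: cvg_norm; exact: cphi.
    by exists c => t; rewrite normr_id.
  - by apply: bounded_continuous_integrable => //; exact: bounded_continuous_cst.
rewrite EA EB opprD addrACA subrr addr0 normrM gtr0_norm ?invr_gt0// /folner_ratio mulrA.
rewrite [leRHS]mulrC ler_wpM2l ?invr_ge0 ?(ltW (B_gt0 n))//.
rewrite -/A measureU//; last by apply/seteqP; split=> [x [[_ nA] [Ax _]]|//]; exact: nA.
rewrite fineD ?ge0_fin_numE// mulrDr [leRHS]addrC.
by apply: (le_trans (ler_normB _ _)); apply: lerD; exact: le_c.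
Qed.

(** Averages of a bounded function stay in a compact segment, hence converge along an ultrafilter
    finer than [\oo], for all functions at once. The error in [average_shift] tends to 0 along it,
    which gives invariance. *)
Lemma folner_mean : exists M : (G -> R) -> R, invariant_mean M.
Proof.
have [U [UU UF]] := @ultraFilterLemma _ (\oo : set_system nat) _.
have PU : ProperFilter U by exact: ultra_proper.
pose M phi : R := lim (average mu B phi @ U).
have cvg_mean phi : bounded_continuous phi -> average mu B phi @ U --> (M phi : R).
  move=> bphi; have [_ [c phic]] := bphi.
  have cpt : compact `[-c, c]%classic by exact: segment_compact.
  have [|l [_ lP]] := cpt (average mu B phi @ U) (fmap_proper_filter _ PU).
    apply: (@filterS _ U _ setT) => [n _|]; last exact: filterT.
    by rewrite /= in_itv/= -ler_norml; exact: average_bound.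
  apply/cvg_ex; exists l => V lV.
  (* A cluster point of an ultrafilter is a limit: otherwise the complement of [V] would belong to
     the filter and would have to meet [V]. *)
  have [//|UV] := in_ultra_setVsetC (average mu B phi @^-1` V) UU.
  by have [x [/= nVx Vx]] := lP (~` V) V UV lV.
exists M; split.
- move=> a phi psi bphi bpsi; apply/cvg_lim => //.
  rewrite (_ : average mu B _ = fun n => a * average mu B phi n + average mu B psi n).
    by apply: cvgD; [apply: cvgM; [exact: cvg_cst|]|]; exact: cvg_mean.
  by apply/funext => n; exact: average_lin.
- move=> phi bphi phi0; apply: (@closed_cvg _ _ U _ (average mu B phi) [set x | 0 <= x]).
  + exact: closed_ge.
  + apply: (@filterS _ U _ setT) => [n _|]; last exact: filterT.
    exact: average_ge0.
  + exact: cvg_mean.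
- rewrite /M (_ : average mu B _ = fun=> 1); first by rewrite lim_cst.
  by apply/funext => n; exact: average_cst.
- move=> phi s bphi; have [cphi [c phic]] := bphi.
  have bphis : bounded_continuous (fun t => phi (t + s)).
    split; last by exists c.
    move=> t; apply: continuous_comp; last exact: cphi.
    rewrite (_ : (fun _ => _) = fun t => s + t); first exact: continuous_add.
    by apply/funext => u; rewrite addrC.
  apply/eqP; rewrite -subr_eq0 -normr_le0.
  have h1 : (fun n => `|average mu B (fun t => phi (t + s)) n - average mu B phi n|) @ U
      --> `|M (fun t => phi (t + s)) - M phi|.
    by apply: cvg_norm; apply: cvgB; exact: cvg_mean.
  have h2 : (fun n => c * folner_ratio s n) @ U --> (0 : R).
    rewrite -[X in _ --> X](mulr0 c); apply: cvgM; first exact: cvg_cst.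
    by apply: cvg_trans (folner_cvg B_folner s); exact: cvg_app.
  apply: (ler_cvg_to h1 h2); apply: (@filterS _ U _ setT) => [n _|]; last exact: filterT.
  exact: average_shift.
Qed.

End folner_averages.

End haar.

(** * The real Hilbert space of square-integrable functions *)

Section real_L2.
Context d (T : measurableType d) (R : realType) (P : probability T R).
Notation L2 := (LfunType P (lee1n 2)).

Lemma L2_measurable (f : L2) : measurable_fun setT (f : T -> R).
Proof. exact: measurable_funPT. Qed.

Lemma L2_mul_integrable (f g : L2) :
  P.-integrable setT (EFin \o (fun x => f x * g x)).
Proof. by apply/Lfun1_integrable/Lfun2_mul_Lfun1; exact: LfunP. Qed.

Lemma square_integrable_Lfun2 (f : T -> R) : measurable_fun setT f ->
  P.-integrable setT (EFin \o (fun x => f x ^+ 2)) -> f \in Lfun P 2%:E.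
Proof.
move=> mf /integrableP[_ f2]; rewrite inE; apply/andP; split; rewrite inE//=.
rewrite /finite_norm unlock; apply: poweR_lty.
apply: le_lt_trans f2; rewrite le_eqVlt; apply/orP; left; apply/eqP.
apply: eq_integral => x _ /=.
by rewrite powR_mulrn// normrX.
Qed.

Let P_fin : (P [set: T] < +oo)%E.
Proof. by rewrite probability_setT ltry. Qed.

Lemma bounded_Lfun2 (f : T -> R) (c : R) : measurable_fun setT f ->
  (forall x, `|f x| <= c) -> f \in Lfun P 2%:E.
Proof.
move=> mf fc; apply: square_integrable_Lfun2 => //.
apply: measurable_bounded_integrable => //.
- exact: measurable_funX.
exists (c ^+ 2); split; first exact: num_real.
move=> y /ltW cy x _ /=; apply: le_trans cy.
by rewrite normrX lerXn2r// nnegrE// (le_trans _ (fc x)).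
Qed.

Definition L2_dot (f g : L2) : R := \int[P]_x (f x * g x).

Lemma L2_dot_sym : symform L2_dot.
Proof.
split=> [f g|f g h|a f g]; rewrite /L2_dot.
- by congr Rintegral; apply/funext => x; rewrite mulrC.
- rewrite -RintegralD//; try exact: L2_mul_integrable.
  by congr Rintegral; apply/funext => x; rewrite mulrDl.
- rewrite -RintegralZl//; last exact: L2_mul_integrable.
  by congr Rintegral; apply/funext => x; rewrite -mulrA.
Qed.

Lemma L2_dot_ge0 f : 0 <= L2_dot f f.
Proof. by apply: Rintegral_ge0 => x _; rewrite -expr2 sqr_ge0. Qed.

Lemma EFin_L2_dot (f g : L2) :
  (L2_dot f g)%:E = (\int[P]_x (f x * g x)%:E)%E.
Proof. by rewrite fineK//; apply: integrable_fin_num => //; exact: L2_mul_integrable. Qed.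

Definition L2_of (f : T -> R) (h : f \in Lfun P 2%:E) : L2 := Lfun_Sub (lee1n 2) h.

Lemma L2_norm_integrable (f : L2) : P.-integrable setT (EFin \o (fun x => `|f x|)).
Proof.
have /Lfun1_integrable/integrable_abse : (f : T -> R) \in Lfun P 1 => //.
apply: Lfun_subset12; first exact: fin_num_measure.
exact: LfunP.
Qed.

(** Cauchy-Schwarz against the constant 1, which has length 1 because [P] is a probability. *)
Lemma L1_le_L2 (f : L2) : (\int[P]_x `|f x|) ^+ 2 <= L2_dot f f.
Proof.
have mabs : measurable_fun setT (fun x => `|f x|) by exact: measurableT_comp.
have absL : (fun x => `|f x|) \in Lfun P 2%:E.
  apply: square_integrable_Lfun2 => //.
  rewrite (_ : _ \o _ = EFin \o (fun x => f x * f x)); first exact: L2_mul_integrable.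
  by apply/funext => x /=; rewrite real_normK ?num_real// expr2.
have oneL : (fun=> 1 : R) \in Lfun P 2%:E.
  by apply: (@bounded_Lfun2 _ 1) => // x; rewrite normr1.
have := cauchy_schwarz L2_dot_sym subspaceT (fun u _ => L2_dot_ge0 u)
  (u := L2_of absL) (v := L2_of oneL) I I.
have -> : L2_dot (L2_of absL) (L2_of oneL) = \int[P]_x `|f x|.
  by congr Rintegral; apply/funext => x /=; rewrite mulr1.
have -> : L2_dot (L2_of absL) (L2_of absL) = L2_dot f f.
  congr Rintegral; apply/funext => x /=.
  by rewrite -expr2 real_normK ?num_real// expr2.
have -> : L2_dot (L2_of oneL) (L2_of oneL) = 1.
  rewrite /L2_dot; under eq_Rintegral do rewrite /= mulr1.
  transitivity (1 * fine (P setT)); first exact: Rintegral_cst.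
  by rewrite probability_setT mulr1.
by rewrite mulr1.
Qed.

Lemma L2_dot_eq0 (f : L2) : L2_dot f f = 0 <-> {ae P, forall x, f x = 0}.
Proof.
have mf2 : measurable_fun setT (EFin \o (fun x => f x * f x)).
  by case/integrableP: (L2_mul_integrable f f).
split=> [f0|f0].
  have : (\int[P]_x `|(EFin \o (fun x => f x * f x)%R) x|)%E = 0%E.
    transitivity (\int[P]_x (f x * f x)%:E)%E; last by rewrite -EFin_L2_dot f0.
    by apply: eq_integral => x _; rewrite gee0_abs//= lee_fin -expr2 sqr_ge0.
  move/(ae_eq_integral_abs _ measurableT mf2); apply: filterS => x /(_ I) /= [] /eqP.
  by rewrite mulf_eq0 orbb => /eqP.
rewrite /L2_dot /Rintegral (@ae_eq_integral _ _ _ P setT (cst 0%E))//.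
  by rewrite integral0.
by apply: filterS f0 => x fx _; rewrite fx mulr0.
Qed.

(* Riesz-Fischer: along a fast subsequence the increments are summable in L^1,
   hence almost everywhere, and Fatou identifies the limit. *)
Lemma L2_complete (x : nat -> L2) :
  (forall eps : R, 0 < eps -> exists N, forall n p,
    (N <= n)%N -> (N <= p)%N -> L2_dot (x n - x p) (x n - x p) <= eps) ->
  exists l, forall eps : R, 0 < eps -> exists N, forall n,
    (N <= n)%N -> L2_dot (x n - l) (x n - l) <= eps.
Proof.
move=> xC.
(* Powers of 1/2 have a finite sum. Below, [phi] is a running maximum of the thresholds [N], so that
   later indices also satisfy all earlier ones. *)
pose h k : R := 1 / (2 ^ k.+1)%:R.
have h0 k : 0 < h k by rewrite divr_gt0// ltr0n expn_gt0.
have q0 k : 0 < h k ^+ 2 by rewrite exprn_gt0.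
have /choice[N NP] := fun k => xC _ (q0 k).
pose phi k := (\max_(i < k.+1) N i)%N.
have phiN k j : (k <= j)%N -> (N k <= phi j)%N.
  by rewrite -ltnS => kj; exact: (leq_bigmax (Ordinal kj)).
pose y k : L2 := x (phi k).
have yk k : L2_dot (y k.+1 - y k) (y k.+1 - y k) <= h k ^+ 2.
  by apply: NP; exact: phiN.
pose g k (t : T) : \bar R := `|(y k.+1 - y k) t|%:E.
have mg k : measurable_fun setT (g k).
  by apply/measurable_EFinP; apply: measurableT_comp => //; exact: measurable_funPT.
have g0 k t : (0 <= g k t)%E by rewrite lee_fin.
have intg k : (\int[P]_t g k t <= (h k)%:E)%E.
  have := integrable_fin_num measurableT (L2_norm_integrable (y k.+1 - y k)).
  move=> /fineK <-; rewrite lee_fin -(@ler_pXn2r _ 2)// ?nnegrE ?(ltW (h0 k))//.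
    by apply: le_trans (yk k); exact: L1_le_L2.
  by apply: fine_ge0; apply: integral_ge0 => t _; exact: g0.
pose S t := (\sum_(0 <= k <oo) g k t)%E.
have mS : measurable_fun setT S.
  by apply: ge0_emeasurable_sum.
have intS : P.-integrable setT S.
  apply/integrableP; split => //.
  under eq_integral do rewrite gee0_abs ?nneseries_ge0//.
  rewrite integral_nneseries//.
  apply: (@le_lt_trans _ _ (\sum_(0 <= k <oo) (h k)%:E)%E).
    by apply: lee_nneseries => k *; [apply: integral_ge0 => t _; exact: g0|exact: intg].
  by apply: le_lt_trans (epsilon_trick0 _ _) (ltry _).
(* Outside this set of full measure the sequence is replaced by 0, so that it converges everywhere
   and its limit is measurable. *)
pose A := [set t | S t \is a fin_num].
have mA : measurable A by rewrite -[A]setTI; exact: emeasurable_fin_num.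
pose z k : T -> R := (y k : T -> R) \_ A.
have mz k : measurable_fun setT (z k).
  apply/(measurable_restrictT _ mA); apply: measurable_funTS.
  exact: (L2_measurable (y k)).
have cz t : cvgn (fun k => z k t).
  have [At|nAt] := pselect (A t); last first.
    rewrite (_ : (fun _ => _) = fun=> 0); first exact: is_cvg_cst.
    by apply/funext => k; rewrite /z patchN// notin_setE.
  rewrite (_ : (fun _ => _) = fun k => y k t); last first.
    by apply/funext => k; rewrite /z patchT// inE.
  pose u := telescope (fun k => y k t).
  have : cvgn [normed series u].
    apply: nondecreasing_is_cvgn.
      by apply: nondecreasing_series => i *; exact: normr_ge0.
    exists (fine (S t)) => _ [n _ <-]; rewrite -lee_fin fineK// /series/= -sumEFin.
    exact: nneseries_lim_ge.
  move=> /normed_cvg; rewrite /u telescopeK => c.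
  rewrite (_ : (fun _ => _) = (fun k => (y k t - y 0%N t) + y 0%N t)).
    by apply: is_cvgD => //; exact: is_cvg_cst.
  by apply/funext => k; rewrite subrK.
pose l t := lim (z k t @[k --> \oo]).
have ml : measurable_fun setT l by apply: (measurable_fun_cvg mz) => t _; exact: cz.
have yz j : {ae P, forall t, z j t = y j t}.
  apply: filterS (integrable_ae measurableT intS) => t /(_ I) St.
  by rewrite /z patchT// inE.
(* Fatou in j: the index j + k is past the k-th threshold, so each integral obeys the Cauchy
   estimate at level k. *)
have bound k n : (N k <= n)%N -> (\int[P]_t ((x n t - l t) ^+ 2)%:E <= (h k ^+ 2)%:E)%E.
  move=> kn; pose F j t := ((x n t - z (j + k)%N t) ^+ 2)%:E.
  have mF j : measurable_fun setT (F j).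
    apply/measurable_EFinP; apply: measurable_funX; apply: measurable_funB => //.
  have F0 j t : (0 <= F j t)%E by rewrite lee_fin sqr_ge0.
  have Fl t : limn_einf (F^~ t) = ((x n t - l t) ^+ 2)%:E.
    have cF : F^~ t @ \oo --> ((x n t - l t) ^+ 2)%:E.
      apply: cvg_EFin; first exact: nearW.
      rewrite /F/=; apply: (@cvg_comp _ _ _ _ (fun r : R => r ^+ 2)); last first.
        exact: exprn_continuous.
      apply: cvgB; first exact: cvg_cst.
      by rewrite (cvg_shiftn k (z^~ t)); exact: cz.
    by rewrite is_cvg_limn_einfE; [exact/cvg_lim|apply/cvg_ex; eexists; exact: cF].
  under eq_integral do rewrite -Fl.
  apply: (le_trans (fatou P measurableT mF (fun j t _ => F0 j t))).
  rewrite limn_einf_lim; apply: lime_le; first exact: is_cvg_einfs.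
  apply: nearW => j; apply: (@le_trans _ _ (\int[P]_t F j t)%E).
    by apply: ereal_inf_lbound; exists j => /=.
  have -> : (\int[P]_t F j t = (L2_dot (x n - y (j + k)%N) (x n - y (j + k)%N))%:E)%E.
    rewrite EFin_L2_dot; apply: ae_eq_integral => //.
      by apply/measurable_EFinP; apply: measurable_funM; exact: measurable_funPT.
    by apply: filterS (yz (j + k)%N) => t zt _; rewrite /F zt expr2.
  by rewrite lee_fin; apply: NP => //; apply: phiN; exact: leq_addl.
have lL : l \in Lfun P 2%:E.
  have mxl : measurable_fun setT (fun t => x (N 0%N) t - l t).
    by apply: measurable_funB => //; exact: measurable_funPT.
  have xl : (fun t => x (N 0%N) t - l t) \in Lfun P 2%:E.
    apply: square_integrable_Lfun2 => //; apply/integrableP; split.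
      by apply/measurable_EFinP; exact: measurable_funX.
    apply: le_lt_trans (ltry (h 0%N ^+ 2)); apply: le_trans (bound 0%N _ (leqnn _)).
    rewrite le_eqVlt; apply/orP; left; apply/eqP.
    by apply: eq_integral => t _; rewrite gee0_abs// lee_fin sqr_ge0.
  have [_ cL] := @Lfun_submod_closed _ T R P 2%:E (lee1n 2).
  have xL : (x (N 0%N) : T -> R) \in Lfun P 2%:E by exact: LfunP.
  rewrite (_ : l = (-1) *: (fun t => x (N 0%N) t - l t) + (x (N 0%N) : T -> R)).
    exact: cL xl xL.
  by apply/funext => t; rewrite !fctE scaleN1r opprB subrK.
exists (L2_of lL) => eps e0.
have [k ke] : exists k, h k ^+ 2 <= eps.
  have [k /(_ k (leqnn _))] := exists_small e0 ler01.
  rewrite mul1r => ke; exists k; apply: le_trans ke.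
  have k1 : (k.+1%:R : R) <= (2 ^ k.+1)%:R by rewrite ler_nat ltnW// ltn_expl.
  have h1 : h k <= k.+1%:R^-1.
    by rewrite /h mul1r lef_pV2// posrE ltr0n ?expn_gt0.
  apply: le_trans h1; rewrite expr2 ler_piMr ?(ltW (h0 k))//.
  by rewrite /h mul1r invf_le1 ?ltr0n ?expn_gt0// ler1n expn_gt0.
exists (N k) => n /bound h1; rewrite -lee_fin; apply: le_trans (le_trans h1 _).
  by rewrite EFin_L2_dot.
by rewrite lee_fin.
Qed.

Lemma L2_hilbert : hilbert_form L2_dot.
Proof.
split; [exact: L2_dot_sym|exact: L2_dot_ge0|exact: L2_complete].
Qed.

End real_L2.

(** * Complexification of a real Hilbert space *)

Section hilbert_product.
Context {R : realType} {V : lmodType R}.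
Variable dot : V -> V -> R.
Hypothesis hV : hilbert_form dot.

(** The real part of the Hermitian product, when (u, v) stands for u + iv. *)
Definition dot_prod (p q : V * V) : R := dot p.1 q.1 + dot p.2 q.2.

(* [V * V] is the complexification of [V]; this is multiplication by i. *)
Definition mul_i (p : V * V) : V * V := (- p.2, p.1).

Lemma hilbert_prod : hilbert_form dot_prod.
Proof.
have sd := hilbert_sym hV; have d0 := hilbert_ge0 hV.
split.
- split=> [p q|p q r|a p q]; rewrite /dot_prod/=.
  + by rewrite (symformC sd) [X in _ + X](symformC sd).
  + by rewrite !(symformDl sd) addrACA.
  + by rewrite !(symformZl sd) mulrDr.
- by move=> p; rewrite addr_ge0.
move=> x xC.
have [l1 l1P] : exists l, forall eps : R, 0 < eps -> exists N, forall n,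
    (N <= n)%N -> dot ((x n).1 - l) ((x n).1 - l) <= eps.
  apply: (hilbert_complete hV) => eps /xC[N NP]; exists N => n p Nn Np.
  by apply: le_trans (NP _ _ Nn Np); rewrite lerDl d0.
have [l2 l2P] : exists l, forall eps : R, 0 < eps -> exists N, forall n,
    (N <= n)%N -> dot ((x n).2 - l) ((x n).2 - l) <= eps.
  apply: (hilbert_complete hV) => eps /xC[N NP]; exists N => n p Nn Np.
  by apply: le_trans (NP _ _ Nn Np); rewrite lerDr d0.
exists (l1, l2) => eps e0; have e2 : 0 < eps / 2 by rewrite divr_gt0.
have [N1 N1P] := l1P _ e2; have [N2 N2P] := l2P _ e2.
exists (maxn N1 N2) => n; rewrite geq_max => /andP[n1 n2].
by rewrite (splitr eps) lerD ?N1P ?N2P.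
Qed.

End hilbert_product.

(** * Density of continuous functions *)

Section density.
Context {R : realType} {X : pmetricType R}.
Hypothesis X_compact : compact [set: X].
Variable m : probability (borel_space X) R.
Notation L2 := (LfunType m (lee1n 2)).

Lemma continuous_compact_bounded (f : X -> R) :
  continuous (f : X -> R^o) -> exists c, forall x, `|f x| <= c.
Proof.
move=> cf; have : compact (f @` [set: X]).
  by apply: continuous_compact => //; exact: continuous_subspaceT.
move=> /compact_bounded[c [_ cP]]; exists (c + 1) => x.
by apply: (cP (c + 1)); [rewrite ltrDl|exists x].
Qed.

Lemma continuous_borel_space (f : X -> R) : continuous (f : X -> R^o) ->
  measurable_fun setT (f : borel_space X -> R).
Proof. by move=> /continuousP cf; exact: generated_measurable_fun. Qed.

Lemma continuous_Lfun2 (f : X -> R) : continuous (f : X -> R^o) ->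
  (f : borel_space X -> R) \in Lfun m 2%:E.
Proof.
move=> cf; have [c fc] := continuous_compact_bounded cf.
by apply: (@bounded_Lfun2 _ _ _ _ _ c) => //; exact: continuous_borel_space.
Qed.

Lemma lipschitz_continuous (f : X -> R) (k : R) :
  (forall x y, `|f x - f y| <= k * mdist x y) -> continuous (f : X -> R^o).
Proof.
move=> fL x; apply/cvgrPdist_le => /= eps e0.
pose del := eps / (`|k| + 1).
have k1 : 0 < `|k| + 1 by rewrite ltr_wpDl.
have del0 : 0 < del by rewrite divr_gt0.
apply: filterS (nbhsx_ballx x _ del0) => y.
rewrite ballEmdist/= /del ltr_pdivlMr// => /ltW h.
apply: le_trans (fL x y) (le_trans _ h).
rewrite mulrC ler_wpM2l ?mdist_ge0//.
by apply: (le_trans (ler_norm k)); rewrite lerDl.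
Qed.

(** For the whole space the infimum ranges over the empty set, which is why the lemmas on this
    distance assume [U != setT]. *)
Definition dist_compl (U : set X) (x : X) : R := inf [set mdist x y | y in ~` U].

Lemma dist_compl_lb (U : set X) x : has_lbound [set mdist x y | y in ~` U].
Proof. by exists 0 => _ [y _ <-]; exact: mdist_ge0. Qed.

Lemma dist_compl_lipschitz (U : set X) x y : U != setT ->
  `|dist_compl U x - dist_compl U y| <= 1 * mdist x y.
Proof.
move=> UT; have [y0 Uy0] : exists y0, ~ U y0.
  by apply/existsNP => UT'; move/eqP: UT; apply; apply/seteqP; split.
have le x' y' : dist_compl U x' - dist_compl U y' <= mdist x' y'.
  rewrite lerBlDr -lerBlDl; apply: lb_le_inf; first by exists (mdist y' y0), y0.
  move=> _ [v Uv <-]; rewrite lerBlDl; apply: le_trans (metric_triangle _ y' _).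
  by apply: ge_inf; [exact: dist_compl_lb|exists v].
rewrite mul1r ler_norml le andbT lerNl opprB.
by apply: le_trans (le y x) _; rewrite metric_sym.
Qed.

Lemma dist_compl_gt0 (U : set X) x : U != setT -> open U ->
  (U x -> 0 < dist_compl U x) /\ (~ U x -> dist_compl U x = 0).
Proof.
move=> UT oU; have [y0 Uy0] : exists y0, ~ U y0.
  by apply/existsNP => UT'; move/eqP: UT; apply; apply/seteqP; split.
split=> Ux.
  have /nbhs_ballP[e /= e0 eU] : nbhs x U by exact: open_nbhs_nbhs.
  apply: (lt_le_trans e0); apply: lb_le_inf; first by exists (mdist x y0), y0.
  move=> _ [v Uv <-]; rewrite leNgt; apply/negP => xv; apply: Uv; apply: eU.
  by rewrite ballEmdist.
apply/eqP; rewrite eq_le; apply/andP; split.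
  by rewrite -(mdistxx x); apply: ge_inf; [exact: dist_compl_lb|exists x].
apply: lb_le_inf; first by exists (mdist x y0), y0.
by move=> _ [v _ <-]; exact: mdist_ge0.
Qed.

(** The functions min(1, n * dist_compl U) tend to the indicator of an open U, so [z] has integral 0
    over open sets by dominated convergence, then over Borel sets by Dynkin's theorem. *)
Lemma L2_orthogonal_continuous (z : L2) :
  (forall u : L2, continuous (u : X -> R^o) -> L2_dot z u = 0) ->
  L2_dot z z = 0.
Proof.
move=> zu.
have iz : m.-integrable setT (EFin \o z).
  apply/Lfun1_integrable; apply: Lfun_subset12; first exact: fin_num_measure.
  exact: LfunP.
have zcont (f : X -> R) : continuous (f : X -> R^o) ->
    (\int[m]_x (f x * z x)%:E)%E = 0%E.
  move=> cf; have := EFin_L2_dot z (L2_of (continuous_Lfun2 cf)).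
  rewrite zu// => h; apply: etrans (esym h).
  by apply: eq_integral => x _ /=; rewrite mulrC.
have izA (A : set (borel_space X)) : measurable A -> m.-integrable A (EFin \o z).
  by move=> mA; apply: integrableS iz.
have zT : (\int[m]_x (z x)%:E)%E = 0%E.
  rewrite -[RHS](zcont (fun=> 1)); last exact: cst_continuous.
  by apply: eq_integral => x _; rewrite mul1r.
have zA (A : set (borel_space X)) : measurable A ->
    (\int[m]_(x in A) (z x)%:E)%E = 0%E.
  apply: (@dynkin_induction _ (borel_space X) (@open X)
    (fun A => (\int[m]_(x in A) (z x)%:E)%E = 0%E)) => //.
  - exact: openI.
  - move=> U oU.
    have mU : measurable (U : set (borel_space X)) by exact: generated_measurable.
    have [->//|UT] := eqVneq U setT.
    pose f n x := Num.min 1 (n%:R * dist_compl U x).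
    have dc0 x : 0 <= dist_compl U x.
      have [h1 h2] := dist_compl_gt0 x UT oU.
      by have [/h1/ltW//|/h2 ->] := pselect (U x).
    have cf n : continuous (f n : X -> R^o).
      move=> x; apply: (@continuous_min _ X (fun=> 1) (fun x => n%:R * dist_compl U x)).
        exact: cst_continuous.
      apply: cvgM; first exact: cvg_cst.
      by apply: (@lipschitz_continuous _ 1) => {}x y; exact: dist_compl_lipschitz.
    have f01 n x : 0 <= f n x <= 1.
      by rewrite /f ge_min lexx andbT le_min ler01 mulr_ge0.
    have fU x : f n x @[n --> \oo] --> (\1_U x : R).
      have [h1 h2] := dist_compl_gt0 x UT oU.
      have [Ux|Ux] := pselect (U x); last first.
        rewrite indicE memNset// (_ : (fun _ => _) = fun=> 0); first exact: cvg_cst.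
        by apply/funext => n; rewrite /f h2// mulr0 min_r.
      rewrite indicE mem_set//; apply: cvg_near_cst.
      exists (Num.trunc (dist_compl U x)^-1).+1 => // n /= nk.
      rewrite /f min_l// -ler_pdivrMr ?h1// mul1r.
      apply: le_trans (ltW (Num.Theory.truncnS_gt _)) _.
      by rewrite ler_nat.
    have mz : measurable_fun setT (z : borel_space X -> R) by exact: measurable_funPT.
    have := @dominated_cvg _ _ _ m setT measurableT
      (fun n x => (f n x * z x)%:E) (fun x => (\1_U x * z x)%:E) (fun x => `|z x|%:E).
    move=> /(_ _ _ _ _ _)/wrap[| | | | |c].
    + move=> n; apply/measurable_EFinP; apply: measurable_funM => //.
      exact: continuous_borel_space.
    + move=> x _; apply: cvg_EFin; first exact: nearW.
      by apply: cvgM; [exact: fU|exact: cvg_cst].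
    + by [].
    + exact: L2_norm_integrable.
    + move=> n x _; rewrite abse_EFin lee_fin normrM ler_piMl//.
      by have /andP[h1 h2] := f01 n x; rewrite ger0_norm.
    rewrite integral_mkcond; transitivity (\int[m]_x (\1_U x * z x)%:E)%E.
      apply: eq_integral => x _; rewrite /patch indicE.
      by case: ifP => _; rewrite ?mul1r ?mul0r.
    have : (fun n => \int[m]_x (f n x * z x)%:E)%E @ \oo --> 0%E.
      by under eq_fun do rewrite zcont//; exact: cvg_cst.
    by move=> c'; apply: (cvg_unique _ c c').
  - move=> S mS zS; have := zT.
    rewrite -(setUv S) integral_setU_EFin//.
    + by rewrite zS add0e.
    + exact: measurableC.
    + by rewrite setUv; case/integrableP: iz.
    + by apply/disj_setPCl.
  - move=> F mF tF zF; rewrite integral_bigcup//; last first.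
      by apply: izA; exact: bigcupT_measurable.
    by rewrite eseries0.
apply/L2_dot_eq0.
have : ae_eq m setT (EFin \o z) (cst 0%E).
  by apply: integral_ae_eq => // E _ mE; rewrite integral0; exact: zA.
by apply: filterS => x /(_ I) [].
Qed.

(** The residual of the projection to [W] is orthogonal to all continuous functions, hence null, and
    closedness puts [u] in [W]. *)
Lemma continuous_dense (W : set L2) : closed_subspace (@L2_dot _ _ _ m) W ->
  (forall u : L2, continuous (u : X -> R^o) -> W u) -> forall u, W u.
Proof.
move=> cW Wc u; have [p Wp up] := projection (L2_hilbert m) u cW.
apply: cW.2 => eps e0; exists p => //; rewrite L2_orthogonal_continuous ?ltW//.
by move=> v cv; apply: up; exact: Wc.
Qed.

End density.

(** * Almost periods of the action *)

Section almost_periodic_vectors.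
Context {R : realType} {V : lmodType R} {G : topologicalZmodType}.
Variables (dot : V -> V -> R) (T : G -> V -> V).
Hypothesis hV : hilbert_form dot.
Hypotheses (T_lin : forall t (a : R) u v, T t (a *: u + v) = a *: T t u + T t v)
  (T_isom : forall t u v, dot (T t u) (T t v) = dot u v).
Let sd := hilbert_sym hV.
Let d0 := hilbert_ge0 hV.
Local Notation nsq u := (dot u u).

Lemma orbit_dist_le (a : R) u v s t : orbit_dist dot T (a *: u + v) s t <=
  2 * a ^+ 2 * orbit_dist dot T u s t + 2 * orbit_dist dot T v s t.
Proof.
rewrite /orbit_dist !T_lin.
have -> : a *: T s u + T s v - (a *: T t u + T t v) =
    a *: (T s u - T t u) + (T s v - T t v).
  by rewrite opprD addrACA scalerBr.
apply: (le_trans (nsqD_le hV _ _)).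
by rewrite (symformZl sd) (symformZr sd) lerD2r expr2 !mulrA.
Qed.

Lemma orbit_dist_bound u s t : orbit_dist dot T u s t <= 4 * nsq u.
Proof. by apply: (le_trans (nsqB_le hV _ _)); rewrite !T_isom; lra. Qed.

Lemma orbit_dist_approx u v s t : orbit_dist dot T v s t <=
  8 * nsq (v - u) + 2 * orbit_dist dot T u s t.
Proof.
have := orbit_dist_le 1 (v - u) u s t; rewrite scale1r subrK => /le_trans; apply.
by rewrite expr1n mulr1 lerD2r; have := orbit_dist_bound (v - u) s t; lra.
Qed.

Lemma orbit_dist0 s t : orbit_dist dot T 0 s t = 0.
Proof.
have T0 r : T r 0 = 0.
  have := T_lin r (-1) 0 0; rewrite scaleN1r oppr0 addr0 scaleN1r => ->.
  by rewrite addNr.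
by rewrite /orbit_dist !T0 subrr (symform0l sd).
Qed.

(** Reduces total boundedness of all orbits to those of a total family: continuous functions in one
    direction of the theorem, eigenfunctions in the other. *)
Lemma totally_bounded_orbit_closed :
  closed_subspace dot [set u | totally_bounded (orbit_dist dot T u)].
Proof.
split; first split.
- by move=> eps e0; exists unit, (fun=> tt) => s t _; rewrite orbit_dist0 ltW.
- move=> a u v tu tv; apply: totally_bounded_le => eps e0.
  exists (2 * a ^+ 2 + 2), (fun s t => orbit_dist dot T u s t + orbit_dist dot T v s t).
  split; first by rewrite addr_ge0// mulr_ge0// sqr_ge0.
    exact: totally_boundedD.
  move=> s t; apply: (le_trans (orbit_dist_le _ _ _ _ _)).
  have h1 : 0 <= orbit_dist dot T u s t by exact: d0.
  have h2 : 0 <= orbit_dist dot T v s t by exact: d0.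
  by have := sqr_ge0 a; nra.
- move=> v vW; apply: totally_bounded_le => eps e0.
  have e8 : 0 < eps / 8 by rewrite divr_gt0.
  have [u tu uv] := vW _ e8.
  exists 2, (orbit_dist dot T u); split => // s t.
  by apply: (le_trans (orbit_dist_approx u _ _ _)); rewrite lerD2r; lra.
Qed.

Lemma strongly_continuous_closed :
  closed_subspace dot (strongly_continuous dot T).
Proof.
split; first split.
- by move=> s eps e0; apply: nearW => t; rewrite orbit_dist0 ltW.
- move=> a u v cu cv s eps e0; have a1 : 0 < 2 * a ^+ 2 + 1.
    by rewrite ltr_wpDl// mulr_ge0// sqr_ge0.
  have e1 : 0 < eps / 2 / (2 * a ^+ 2 + 1) by rewrite !divr_gt0.
  have e2 : 0 < eps / 4 by rewrite divr_gt0.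
  near=> t; apply: (le_trans (orbit_dist_le _ _ _ _ _)).
  have : orbit_dist dot T u t s <= eps / 2 / (2 * a ^+ 2 + 1) by near: t; exact: cu.
  rewrite ler_pdivlMr// => hu.
  have hv : orbit_dist dot T v t s <= eps / 4 by near: t; exact: cv.
  have h1 : 0 <= orbit_dist dot T u t s by exact: d0.
  have h2 : 2 * a ^+ 2 * orbit_dist dot T u t s <= eps / 2.
    by apply: le_trans hu; rewrite mulrC ler_wpM2l// lerDl.
  by rewrite (splitr eps) lerD//; lra.
- move=> v vW s eps e0; have e16 : 0 < eps / 16 by rewrite divr_gt0.
  have [u cu uv] := vW _ e16.
  have e4 : 0 < eps / 4 by rewrite divr_gt0.
  apply: filterS (cu s _ e4) => t h.
  by apply: (le_trans (orbit_dist_approx u _ _ _)); lra.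
Unshelve. all: by end_near. Qed.

End almost_periodic_vectors.

Lemma net_totally_bounded (R : realType) (G : choiceType) (rho : G -> G -> R) :
  (forall s t, rho s t = rho t s) ->
  (forall s t u, rho s u <= rho s t + rho t u) ->
  (forall eps : R, 0 < eps ->
    exists s : seq G, forall t, exists2 u, u \in s & rho t u <= eps) ->
  totally_bounded rho.
Proof.
move=> rhoC rho_tri net eps e0; have e2 : 0 < eps / 2 by rewrite divr_gt0.
have [s sP] := net _ e2.
have /choice[c cP] : forall t, exists u : seq_sub s, rho t (val u) <= eps / 2.
  by move=> t; have [u us tu] := sP t; exists (SeqSub us).
exists (seq_sub s), c => t u tu; rewrite (splitr eps).
apply: le_trans (rho_tri _ (val (c t)) _) _; rewrite lerD//.
by rewrite rhoC tu.
Qed.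

(** * The pseudometric of the system on the group *)

Section system.
Context {R : realType} {G : topologicalZmodType} {X : pmetricType R}.
Hypothesis X_compact : compact [set: X].
Variable act : G -> X -> X.
Hypothesis act_cont : continuous_action act.
Variable m : probability (borel_space X) R.
Hypothesis m_inv : invariant_measure act m.

Lemma act_continuous t : continuous (act t).
Proof.
move=> x; apply: (@cvg_comp _ _ _ (fun x => (t, x)) (fun p => act p.1 p.2) _ (nbhs (t, x))).
  by apply: cvg_pair; [exact: cvg_cst|exact: cvg_id].
exact: (action_continuous act_cont (x := (t, x))).
Qed.

Lemma actC s t x : act s (act t x) = act t (act s x).
Proof. by rewrite -!(actionD act_cont) addrC. Qed.

Lemma act_measurable t :
  measurable_fun setT (act t : borel_space X -> borel_space X).
Proof.
apply: generated_measurable_self => U oU.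
by apply: open_comp => // x _; exact: act_continuous.
Qed.

Lemma integrable_act t (g : borel_space X -> \bar R) : m.-integrable setT g ->
  m.-integrable setT (g \o act t) /\
  (\int[m]_x (g \o act t) x = \int[m]_x g x)%E.
Proof.
pose phi : borel_space X -> borel_space X := act t.
move=> ig; have mt : measurable_fun setT phi := act_measurable t.
have mg := measurable_int _ ig.
have push (f : borel_space X -> \bar R) :
    (\int[pushforward m phi]_x f x = \int[m]_x f x)%E.
  by apply: eq_measure_integral => A mA _; exact: m_inv.
have igt : m.-integrable setT (g \o phi).
  apply/integrableP; split; first exact: measurableT_comp.
  case/integrableP : ig => _; apply: le_lt_trans.
  rewrite -[leRHS]push (ge0_integral_pushforward mt) ?preimage_setT//.
  exact: measurableT_comp.
split => //; rewrite -[RHS]push.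
by rewrite (integral_pushforward mt) ?preimage_setT.
Qed.

Lemma mdist_continuous (f g : X -> X) : continuous f -> continuous g ->
  continuous ((fun x => mdist (f x) (g x)) : X -> R^o).
Proof.
move=> cf cg x; apply/cvgrPdist_le => /= eps e0.
have e2 : 0 < eps / 2 by rewrite divr_gt0.
near=> y.
have : ball (f x) (eps / 2) (f y).
  by near: y; exact: (cf x _ (nbhsx_ballx (f x) _ e2)).
rewrite ballEmdist/= => fy.
have : ball (g x) (eps / 2) (g y).
  by near: y; exact: (cg x _ (nbhsx_ballx (g x) _ e2)).
rewrite ballEmdist/= => gy.
have t1 := metric_triangle (f x) (f y) (g x).
have t2 := metric_triangle (f y) (g y) (g x).
have t3 := metric_triangle (f y) (f x) (g y).
have t4 := metric_triangle (f x) (g x) (g y).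
have s1 := metric_sym (f x) (f y); have s2 := metric_sym (g x) (g y).
by rewrite ler_norml; apply/andP; split; lra.
Unshelve. all: by end_near. Qed.

(** Compactness of the space makes joint continuity of the action uniform in the space variable. *)
Lemma act_uniform (s : G) (eps : R) : 0 < eps ->
  \forall t \near s, forall x, mdist (act t x) (act s x) <= eps.
Proof.
move=> e0; have e2 : 0 < eps / 2 by rewrite divr_gt0.
have := X_compact; rewrite compact_near_coveringP => cX.
have := cX G (nbhs s) (fun t x => mdist (act t x) (act s x) <= eps) _.
move=> h; have : \forall t \near s,
    [set: X] `<=` (fun x => mdist (act t x) (act s x) <= eps).
  apply: h => x _.
  have cxs : act p.1 p.2 @[p --> (s, x)] --> act s x.
    exact: (action_continuous act_cont (x := (s, x))).
  have := cxs _ (nbhsx_ballx (act s x) _ e2).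
  rewrite ballEmdist => -[[/= N M] [sN xM] NM].
  (* The product neighbourhood is used both at [t] and at [s], comparing [act t y] with [act s y]
     through [act s x]. The factors are exchanged since the covering lemma puts the space first. *)
  exists (M, N) => //= -[y t] /= [My Nt].
  have := NM (t, y) (conj Nt My); have := NM (s, y) (conj (nbhs_singleton sN) My).
  rewrite /= => h1 h2.
  have := metric_triangle (act t y) (act s x) (act s y).
  by rewrite (metric_sym (act t y) (act s x)); lra.
by apply: filterS => t tP x; exact: tP.
Qed.

Definition orbit_mdist s t : R := \int[m]_x mdist (act s x) (act t x).

Let mdist_act_continuous s t :
  continuous ((fun x => mdist (act s x) (act t x)) : X -> R^o).
Proof. by apply: mdist_continuous; exact: act_continuous. Qed.

Lemma continuous_m_integrable (f : X -> R) : continuous (f : X -> R^o) ->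
  m.-integrable setT (EFin \o (f : borel_space X -> R)).
Proof.
move=> cf; apply/Lfun1_integrable; apply: Lfun_subset12; first exact: fin_num_measure.
exact: continuous_Lfun2.
Qed.

Lemma orbit_mdist_ge0 s t : 0 <= orbit_mdist s t.
Proof. by apply: Rintegral_ge0 => x _; exact: mdist_ge0. Qed.

Lemma orbit_mdistC s t : orbit_mdist s t = orbit_mdist t s.
Proof. by apply: eq_Rintegral => x _; exact: metric_sym. Qed.

Lemma orbit_mdist_triangle s t u :
  orbit_mdist s u <= orbit_mdist s t + orbit_mdist t u.
Proof.
rewrite /orbit_mdist -RintegralD//; try exact: continuous_m_integrable.
apply: le_Rintegral => //; first exact: continuous_m_integrable.
  apply: (@continuous_m_integrable
    (fun x => mdist (act s x) (act t x) + mdist (act t x) (act u x))).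
  by move=> x; apply: cvgD; exact: mdist_act_continuous.
by move=> x _; exact: metric_triangle.
Qed.

Lemma orbit_mdist_shift r s t : orbit_mdist (s + r) (t + r) = orbit_mdist s t.
Proof.
rewrite /orbit_mdist /Rintegral; congr fine.
have [_ <-] := integrable_act r (continuous_m_integrable (@mdist_act_continuous s t)).
by apply: eq_integral => x _; rewrite /= !(actionD act_cont).
Qed.

Lemma orbit_mdist_near s (eps : R) : 0 < eps ->
  \forall t \near s, orbit_mdist t s <= eps.
Proof.
move=> e0; apply: filterS (act_uniform s e0) => t h.
have -> : eps = \int[m]_x eps.
  transitivity (eps * fine (m setT)); last by rewrite (@Rintegral_cst _ _ _ m).
  by rewrite probability_setT mulr1.
apply: le_Rintegral => //; first exact: continuous_m_integrable.
apply: (@continuous_m_integrable (fun=> eps)); exact: cst_continuous.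
Qed.

(** Shift invariance makes t - u an almost period exactly when t is close to u. One way, a finite
    net is itself the compact set; the other way, the compact set is covered by finitely many small
    balls. *)
Lemma orbit_mdist_totally_bounded : totally_bounded orbit_mdist <->
  forall eps : R, 0 < eps -> relatively_dense [set t | orbit_mdist 0 t < eps].
Proof.
split=> [tb eps e0|ap].
  have e2 : 0 < eps / 2 by rewrite divr_gt0.
  have [s sP] := totally_bounded_net 0 tb e2.
  exists [set` s]; split; first by apply: finite_compact; exact: finite_seq.
  apply/seteqP; split => // t _; have [u us tu] := sP t.
  exists (t - u); last by exists u; rewrite // subrK.
  rewrite /= -(orbit_mdist_shift u) add0r subrK orbit_mdistC.
  by apply: (le_lt_trans tu); rewrite ltr_pdivrMr// ltr_pMr// ltr1n.
apply: net_totally_bounded; [exact: orbit_mdistC|exact: orbit_mdist_triangle|].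
move=> eps e0; have e2 : 0 < eps / 2 by rewrite divr_gt0.
have [K [cK KA]] := ap _ e2.
have [u Ku|s _ sP] := compact_seq_cover
    (U := fun u => [set t | orbit_mdist t u <= eps / 2]) cK.
  exact: orbit_mdist_near.
exists s => t; have : [set: G] t by [].
rewrite KA => -[a /= at0 [k Kk <-]]; have [u us ku] := sP _ Kk.
exists u => //; apply: (le_trans (orbit_mdist_triangle _ k _)).
rewrite (splitr eps) lerD// orbit_mdistC -{1}[k]add0r orbit_mdist_shift.
exact: ltW.
Qed.

End system.

(** * Reduction of complex limits to real ones *)

Section complex_convergence.
Context {R : realType}.
Local Open Scope complex_scope.
Implicit Types z : R[i].

Lemma normcC z : `|z| = (Normc.normc z)%:C.
Proof. by case: z => a b; rewrite normc_def. Qed.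

Lemma sqr_normcE z : Normc.normc z ^+ 2 = complex.Re z ^+ 2 + complex.Im z ^+ 2.
Proof. by case: z => a b /=; rewrite sqr_sqrtr// addr_ge0// sqr_ge0. Qed.

Lemma normc_ge0 z : 0 <= Normc.normc z.
Proof. by case: z => a b; exact: sqrtr_ge0. Qed.

Lemma abs_Re_Im_le_normc z :
  `|complex.Re z| <= Normc.normc z /\ `|complex.Im z| <= Normc.normc z.
Proof.
case: z => a b /=; split; rewrite -sqrtr_sqr ler_wsqrtr//.
  by rewrite lerDl sqr_ge0.
by rewrite lerDr sqr_ge0.
Qed.

Lemma normc_le_absD z : Normc.normc z <= `|complex.Re z| + `|complex.Im z|.
Proof.
rewrite -(@ler_pXn2r _ 2)// ?nnegrE ?normc_ge0 ?addr_ge0//.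
rewrite sqr_normcE sqrrD !real_normK ?num_real// addrAC lerDl.
by rewrite mulrn_wge0// mulr_ge0.
Qed.

Lemma cvg_complexP {T : Type} {F : set_system T} {FF : Filter F}
    (f : T -> R[i]^o) (l : R[i]^o) : f @ F --> l <->
  (complex.Re (f t) @[t --> F] --> (complex.Re l : R^o)) /\
  (complex.Im (f t) @[t --> F] --> (complex.Im l : R^o)).
Proof.
split=> [/cvgrPdist_lt fl|[/cvgrPdist_lt fr /cvgrPdist_lt fi]].
  split; apply/cvgrPdist_lt => eps e0.
    have eC : 0 < eps%:C :> R[i] by rewrite ltcR.
    apply: filterS (fl _ eC) => t; rewrite normcC ltcR; apply: le_lt_trans.
    by have [+ _] := abs_Re_Im_le_normc (l - f t); case: (l) (f t) => ? ? [? ?].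
  have eC : 0 < eps%:C :> R[i] by rewrite ltcR.
  apply: filterS (fl _ eC) => t; rewrite normcC ltcR; apply: le_lt_trans.
  by have [_ +] := abs_Re_Im_le_normc (l - f t); case: (l) (f t) => ? ? [? ?].
(* A positive element of [R[i]] has zero imaginary part, so only its real part matters. *)
apply/cvgrPdist_lt => eps; rewrite ltcE/= => /andP[/eqP Ie e0].
have e2 : 0 < complex.Re eps / 2 by rewrite divr_gt0.
apply: filterS2 (fr _ e2) (fi _ e2) => t hr hi; rewrite normcC ltcE/= Ie eqxx/=.
apply: (le_lt_trans (normc_le_absD _)); rewrite [ltRHS]splitr ltrD//.
  by move: hr; case: (l) (f t) => ? ? [? ?].
by move: hi; case: (l) (f t) => ? ? [? ?].
Qed.

Lemma continuous_complexP {T : topologicalType} (f : T -> R[i]^o) :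
  continuous f <-> continuous ((fun t => complex.Re (f t)) : T -> R^o) /\
    continuous ((fun t => complex.Im (f t)) : T -> R^o).
Proof.
split=> [cf|[cr ci] t]; last by apply/cvg_complexP; split; [exact: cr|exact: ci].
by split=> t; have /cvg_complexP[] := cf t.
Qed.

End complex_convergence.

(** * Mean almost periodicity of generic points *)

Section generic_points.
Context {R : realType} {G : topologicalZmodType} {X : pmetricType R}.
Variable act : G -> X -> X.
Variable m : probability (borel_space X) R.
Variables (mu : {measure set (borel_group G) -> \bar R}) (B : nat -> set G).

Lemma caverageE (h : G -> R[i]) n : caverage mu B h n =
  Complex (average mu B (fun t => complex.Re (h t)) n)
          (average mu B (fun t => complex.Im (h t)) n).
Proof. by rewrite /caverage /cintegral /average; simpc. Qed.

Lemma caverage_cvgP (f : X -> R[i]^o) y :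
  (caverage mu B (fun t => f (act t y)) n @[n --> \oo] --> cintegral m setT f) <->
  (average mu B (fun t => complex.Re (f (act t y))) n @[n --> \oo] -->
     \int[m]_x complex.Re (f x)) /\
  (average mu B (fun t => complex.Im (f (act t y))) n @[n --> \oo] -->
     \int[m]_x complex.Im (f x)).
Proof.
rewrite cvg_complexP; under eq_fun do rewrite caverageE/=.
by under [in X in _ /\ X]eq_fun do rewrite caverageE/=.
Qed.

Definition generic_real y := forall f : X -> R, continuous (f : X -> R^o) ->
  average mu B (fun t => f (act t y)) n @[n --> \oo] --> \int[m]_x f x.

Lemma genericP y : generic act m mu B y <-> generic_real y.
Proof.
split=> [gy f cf|gy f /continuous_complexP[cr ci]]; last first.
  by apply/caverage_cvgP; split; exact: gy.
have /gy/caverage_cvgP[] : continuous ((fun x => (f x)%:C%C) : X -> R[i]^o) => //.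
by apply/continuous_complexP; split => //; exact: cst_continuous.
Qed.

Hypothesis act_cont : continuous_action act.

Lemma generic_mean_dist y t : generic act m mu B y ->
  mean_dist act mu B y (act t y) = orbit_mdist act m 0 t.
Proof.
move=> /genericP gy; rewrite /mean_dist /upper_mean.
(* [act 0 x] is written for x so that the integrand is literally that of [orbit_mdist]. *)
have cf : continuous ((fun x => mdist (act 0 x) (act t x)) : X -> R^o).
  by apply: mdist_continuous => //; exact: act_continuous.
rewrite -[RHS](cvg_limn_inf_sup (gy _ cf)).2; congr limn_sup.
apply/funext => n; congr (_ * _); apply: eq_Rintegral => s _.
by rewrite (action0 act_cont) (actC act_cont).
Qed.

Lemma generic_mean_ap y : generic act m mu B y ->
  (mean_almost_periodic act mu B y <->
   forall eps : R, 0 < eps ->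
     relatively_dense [set t | orbit_mdist act m 0 t < eps]).
Proof.
move=> gy; rewrite /mean_almost_periodic.
have E (eps : R) : [set t | mean_dist act mu B y (act t y) < eps] =
    [set t | orbit_mdist act m 0 t < eps].
  by apply/funext => t /=; rewrite generic_mean_dist.
by split=> ap eps e0; move: (ap eps e0); rewrite E.
Qed.

End generic_points.

(** * The Koopman representation *)

Section koopman.
Context {R : realType} {G : topologicalZmodType} {X : pmetricType R}.
Hypothesis X_compact : compact [set: X].
Variable act : G -> X -> X.
Hypothesis act_cont : continuous_action act.
Variable m : probability (borel_space X) R.
Hypothesis m_inv : invariant_measure act m.
Notation L2 := (LfunType m (lee1n 2)).
Notation dot := (@L2_dot _ _ _ m).

Lemma comp_act_Lfun2 t (u : L2) :
  ((u : X -> R) \o act t : borel_space X -> R) \in Lfun m 2%:E.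
Proof.
apply: square_integrable_Lfun2.
  exact: (measurableT_comp (L2_measurable u) (act_measurable act_cont t)).
have iu : m.-integrable setT (EFin \o (fun x => u x ^+ 2)).
  by apply: Lfun2_integrable_sqr; exact: LfunP.
by have [] := integrable_act act_cont m_inv t iu.
Qed.

Definition koopman t (u : L2) : L2 := L2_of (comp_act_Lfun2 t u).

Lemma koopmanE t (u : L2) x : koopman t u x = u (act t x).
Proof. by []. Qed.

Lemma koopman_lin t (a : R) u v :
  koopman t (a *: u + v) = a *: koopman t u + koopman t v.
Proof. by apply/LfuneqP. Qed.

Lemma koopman_isom t u v : dot (koopman t u) (koopman t v) = dot u v.
Proof.
have [_] := integrable_act act_cont m_inv t (L2_mul_integrable u v).
by move=> h; congr fine.
Qed.

(** Uniform continuity as an affine bound in d. Points closer than the radius of a covering ball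
    differ little; for the others d is at least that radius, and a multiple of it dominates the
    maximal oscillation. Such a bound can be integrated directly. *)
Lemma continuous_modulus (f : X -> R) (eps : R) : continuous (f : X -> R^o) ->
  0 < eps -> exists2 C : R, 0 <= C &
  forall x y, (f x - f y) ^+ 2 <= eps + C * mdist x y.
Proof.
move=> cf e0; have [c fc] := continuous_compact_bounded X_compact cf.
have s0 : 0 < Num.sqrt eps / 2 by rewrite divr_gt0// sqrtr_gt0.
(* The oscillation is controlled at twice the radius, so that a point near the centre and a second
   point near the first are both covered. *)
have /choice[r rP] : forall x, exists r : R, 0 < r /\
    forall y, mdist x y < 2 * r -> `|f x - f y| <= Num.sqrt eps / 2.
  move=> x; have /cvgrPdist_le /(_ _ s0) := cf x.
  move=> /nbhs_ballP[r /= r0 rP]; exists (r / 2); split; first by rewrite divr_gt0.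
  by move=> y xy; apply: rP; rewrite ballEmdist/= (lt_le_trans xy)// mulrC divfK.
have r0 x : 0 < r x by have [] := rP x.
have [|s _ sP] := compact_seq_cover (U := fun x => ball x (r x)) X_compact.
  by move=> x _; exact: nbhsx_ballx.
pose C := \sum_(x <- s) (2 * c) ^+ 2 / r x.
have C0 x : 0 <= (2 * c) ^+ 2 / r x by rewrite divr_ge0 ?sqr_ge0// ltW.
exists C => [|y y']; first by apply: sumr_ge0.
have [x xs] := sP y I; rewrite ballEmdist/= => xy.
have [yy'|yy'] := ltP (mdist y y') (r x); last first.
  have h1 : (f y - f y') ^+ 2 <= (2 * c) ^+ 2.
    rewrite -[leLHS]real_normK ?num_real// lerXn2r ?nnegrE//.
      by rewrite mulr_ge0// (le_trans _ (fc x)).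
    by apply: (le_trans (ler_normB _ _)); have := fc y; have := fc y'; lra.
  apply: (le_trans h1); apply: (@le_trans _ _ (C * mdist y y')); last first.
    by rewrite lerDr ltW.
  apply: (@le_trans _ _ ((2 * c) ^+ 2 / r x * mdist y y')).
    by rewrite mulrAC ler_pdivlMr// ler_wpM2l// sqr_ge0.
  rewrite ler_wpM2r ?mdist_ge0// /C (big_rem x)//= lerDl.
  exact: sumr_ge0.
apply: (@le_trans _ _ eps); last by rewrite lerDl mulr_ge0 ?mdist_ge0// sumr_ge0.
rewrite -[leRHS](sqr_sqrtr (ltW e0)) -[leLHS]real_normK ?num_real//.
rewrite lerXn2r ?nnegrE ?sqrtr_ge0//.
have [_ xP] := rP x.
have h1 : `|f x - f y| <= Num.sqrt eps / 2.
  by apply: xP; apply: (lt_trans xy); rewrite ltr_pMl// ltr1n.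
have h2 : `|f x - f y'| <= Num.sqrt eps / 2.
  apply: xP; apply: (le_lt_trans (metric_triangle _ y _)).
  by rewrite mulr2n mulrDl mul1r ltrD.
have -> : f y - f y' = (f x - f y') - (f x - f y) by ring.
by apply: (le_trans (ler_normB _ _)); rewrite [leRHS]splitr lerD.
Qed.

Lemma continuous_orbit_dist (u : L2) (eps : R) : continuous (u : X -> R^o) ->
  0 < eps -> exists2 C : R, 0 <= C & forall s t,
  orbit_dist dot koopman u s t <= eps + C * orbit_mdist act m s t.
Proof.
move=> cu e0; have [C C0 CP] := continuous_modulus cu e0; exists C => // s t.
have cd : continuous ((fun x => mdist (act s x) (act t x)) : X -> R^o).
  by apply: mdist_continuous; exact: act_continuous.
have cc : continuous ((fun=> eps) : X -> R^o) by exact: cst_continuous.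
have ie := continuous_m_integrable X_compact m cc.
have id := continuous_m_integrable X_compact m cd.
have -> : eps + C * orbit_mdist act m s t =
    \int[m]_x (eps + C * mdist (act s x) (act t x)).
  rewrite RintegralD//; last first.
    exact: (@integrableZl _ _ _ m setT measurableT C _ id).
  rewrite RintegralZl//; congr (_ + _).
  transitivity (eps * fine (m setT)); last by rewrite (@Rintegral_cst _ _ _ m).
  by rewrite probability_setT mulr1.
apply: le_Rintegral => //.
- exact: L2_mul_integrable.
- apply: (continuous_m_integrable X_compact m
    (f := fun x => eps + C * mdist (act s x) (act t x))) => x.
  apply: cvgD; first exact: cvg_cst.
  by apply: cvgM; [exact: cvg_cst|exact: cd].
- by move=> x _; rewrite -expr2; exact: CP.
Qed.

(** Continuous functions are handled by comparison with [orbit_mdist], which is continuous on the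
    diagonal; the others follow since the property is closed. *)
Lemma koopman_strongly_continuous (u : L2) : strongly_continuous dot koopman u.
Proof.
move: u; apply: continuous_dense => //.
  apply: strongly_continuous_closed; [exact: L2_hilbert|exact: koopman_lin|].
  exact: koopman_isom.
move=> u cu s eps e0; have e2 : 0 < eps / 2 by rewrite divr_gt0.
have [C C0 CP] := continuous_orbit_dist cu e2.
have e3 : 0 < eps / 2 / (C + 1) by rewrite divr_gt0// ltr_wpDl.
apply: filterS (orbit_mdist_near X_compact act_cont m s e3) => t.
rewrite ler_pdivlMr ?ltr_wpDl// => h; apply: (le_trans (CP _ _)).
rewrite [leRHS]splitr lerD2l; apply: le_trans h.
by rewrite mulrC ler_wpM2l ?orbit_mdist_ge0// lerDl.
Qed.

Lemma koopman_totally_bounded : totally_bounded (orbit_mdist act m) ->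
  forall u : L2, totally_bounded (orbit_dist dot koopman u).
Proof.
move=> tb; apply: continuous_dense => //.
  apply: totally_bounded_orbit_closed; [exact: L2_hilbert|exact: koopman_lin|].
  exact: koopman_isom.
move=> u cu; apply: totally_bounded_le => eps e0.
have [C C0 CP] := continuous_orbit_dist cu e0.
by exists C, (orbit_mdist act m).
Qed.

Local Notation V := (L2 * L2)%type.
Definition koopman_pair t (p : V) : V := (koopman t p.1, koopman t p.2).
Local Notation dotV := (dot_prod dot).

Lemma koopman_unitary : unitary_action dotV koopman_pair mul_i.
Proof.
have hV := L2_hilbert m; have sd := hilbert_sym hV.
have kD t u v : koopman t (u + v) = koopman t u + koopman t v by exact/LfuneqP.
have kN t u : koopman t (- u) = - koopman t u by exact/LfuneqP.
have kZ t (a : R) u : koopman t (a *: u) = a *: koopman t u by exact/LfuneqP.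
split.
(* Composition reverses the order of products; commutativity of the group makes these operators an
   action nevertheless. *)
- move=> s t [u v]; congr pair; apply/LfuneqP => x;
    by rewrite !koopmanE addrC (actionD act_cont).
- by move=> [u v]; congr pair; apply/LfuneqP => x; rewrite koopmanE (action0 act_cont).
- by move=> t [u v] [u' v']; congr pair; rewrite /= kD.
- by move=> t a [u v]; congr pair; rewrite /= kZ.
- by move=> t [u v] [u' v']; rewrite /dot_prod/= !koopman_isom.
- by move=> [u v] [u' v']; congr pair; rewrite /= opprD.
- by move=> a [u v]; congr pair; rewrite /= scalerN.
- move=> [u v] [u' v']; rewrite /dot_prod/= (symformNl sd) (symformNr sd) opprK.
  by rewrite addrC.
- by move=> [u v].
- by move=> t [u v]; congr pair; rewrite /= kN.
Qed.

Lemma koopman_pair_lin t (a : R) p q :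
  koopman_pair t (a *: p + q) = a *: koopman_pair t p + koopman_pair t q.
Proof. by congr pair; rewrite /= koopman_lin. Qed.

Lemma koopman_pair_isom t p q : dotV (koopman_pair t p) (koopman_pair t q) = dotV p q.
Proof. by rewrite (actionT_isom koopman_unitary). Qed.

Lemma orbit_dist_pair (p : V) s t : orbit_dist dotV koopman_pair p s t =
  orbit_dist dot koopman p.1 s t + orbit_dist dot koopman p.2 s t.
Proof. by []. Qed.

Lemma koopman_pair_totally_bounded : totally_bounded (orbit_mdist act m) ->
  forall p : V, totally_bounded (orbit_dist dotV koopman_pair p).
Proof. by move=> tb p; apply: totally_boundedD; exact: koopman_totally_bounded. Qed.

Lemma koopman_pair_strongly_continuous (p : V) :
  strongly_continuous dotV koopman_pair p.
Proof.
move=> s eps e0; have e2 : 0 < eps / 2 by rewrite divr_gt0.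
apply: filterS2 (koopman_strongly_continuous p.1 s e2)
  (koopman_strongly_continuous p.2 s e2) => t h1 h2.
by rewrite orbit_dist_pair (splitr eps) lerD.
Qed.

End koopman.

(** * Eigenfunctions *)

Lemma ae_imply d (T : measurableType d) (R : realType)
    (mu : {measure set T -> \bar R}) (P Q : T -> Prop) :
  (forall x, P x -> Q x) -> {ae mu, forall x, P x} -> {ae mu, forall x, Q x}.
Proof. by move=> PQ; apply: filterS. Qed.

Section complex_L2.
Context {d : measure_display} {T : measurableType d} {R : realType}.
Variable m : probability T R.
Notation L2 := (LfunType m (lee1n 2)).
Notation dot := (@L2_dot _ _ _ m).
Local Notation V := (L2 * L2)%type.
Local Notation dotV := (dot_prod dot).
Local Open Scope complex_scope.

Definition toC (p : V) : T -> R[i] := fun x => p.1 x +i* p.2 x.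

Definition cscale (c : R[i]) (p : V) : V :=
  complex.Re c *: p + complex.Im c *: mul_i p.

Definition ccomb (s : seq (R[i] * V)) : V := \sum_(q <- s) cscale q.1 q.2.

Lemma toCD p q x : toC (p + q) x = toC p x + toC q x.
Proof. by []. Qed.

Lemma toCB p q x : toC (p - q) x = toC p x - toC q x.
Proof. by []. Qed.

Lemma toC_cscale c p x : toC (cscale c p) x = c * toC p x.
Proof.
case: c => a b.
transitivity (Complex (a * p.1 x + b * - p.2 x) (a * p.2 x + b * p.1 x)) => //.
by rewrite mulrN.
Qed.

Lemma toC_ccomb s x : toC (ccomb s) x = \sum_(q <- s) q.1 * toC q.2 x.
Proof.
elim: s => [|q s IH]; rewrite /ccomb ?big_nil// !big_cons toCD toC_cscale.
by congr (_ + _).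
Qed.

Lemma ccomb_cat s t : ccomb (s ++ t) = ccomb s + ccomb t.
Proof. by rewrite /ccomb big_cat. Qed.

Lemma toC_inj p q : toC p =1 toC q -> p = q.
Proof.
case: p q => [u v] [u' v'] h; congr pair; apply/LfuneqP => x.
  by have [] := h x.
by have [_] := h x.
Qed.

Lemma ccomb_scale (a : R) s :
  ccomb [seq (a%:C * q.1, q.2) | q <- s] = a *: ccomb s.
Proof.
apply: toC_inj => x.
rewrite toC_ccomb big_map/= (_ : toC (a *: ccomb s) x = a%:C * toC (ccomb s) x).
  by rewrite toC_ccomb mulr_sumr; apply: eq_bigr => q _; rewrite mulrA.
by rewrite /toC/=; simpc.
Qed.

Lemma sqr_normc_toC p x :
  Normc.normc (toC p x) ^+ 2 = p.1 x * p.1 x + p.2 x * p.2 x.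
Proof. by rewrite sqr_normcE -!expr2. Qed.

Lemma L2norm_toC p : L2norm m (toC p) = (Num.sqrt (dotV p p))%:E.
Proof.
rewrite /L2norm unlock.
have -> : (\int[m]_x `|(Normc.normc (toC p x))%:E| `^ 2 = (dotV p p)%:E)%E.
  rewrite /dot_prod EFinD !EFin_L2_dot -integralD//; last 2 first.
  - exact: L2_mul_integrable.
  - exact: L2_mul_integrable.
  apply: eq_integral => x _; rewrite abse_EFin poweR_EFin ger0_norm ?normc_ge0//.
  by rewrite powR_mulrn ?normc_ge0// sqr_normc_toC.
by rewrite poweR_EFin powR12_sqrt// addr_ge0// L2_dot_ge0.
Qed.

Lemma in_L2_toC p : in_L2 m (toC p).
Proof.
split; last by rewrite L2norm_toC ltry.
by split; exact: L2_measurable.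
Qed.

Lemma in_L2_ex_toC f : in_L2 m f -> exists p, f = toC p.
Proof.
move=> [[mr mi] f2].
have msum : measurable_fun setT (fun x => complex.Re (f x) ^+ 2 + complex.Im (f x) ^+ 2).
  by apply: measurable_funD; exact: measurable_funX.
have E2 : (\int[m]_x `|(Normc.normc (f x))%:E| `^ 2 =
    \int[m]_x (complex.Re (f x) ^+ 2 + complex.Im (f x) ^+ 2)%:E)%E.
  apply: eq_integral => x _; rewrite abse_EFin poweR_EFin ger0_norm ?normc_ge0//.
  by rewrite powR_mulrn ?normc_ge0// sqr_normcE.
have int2 : m.-integrable setT
    (EFin \o (fun x => complex.Re (f x) ^+ 2 + complex.Im (f x) ^+ 2)).
  apply/integrableP; split; first exact/measurable_EFinP.
  move: f2; rewrite /L2norm unlock E2 => /(lty_poweRy _) h.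
  rewrite (_ : (\int[m]_x _)%E =
    (\int[m]_x (complex.Re (f x) ^+ 2 + complex.Im (f x) ^+ 2)%:E)%E); first exact: h.
  by apply: eq_integral => x _; rewrite gee0_abs//= lee_fin addr_ge0// sqr_ge0.
have fr : (fun x => complex.Re (f x)) \in Lfun m 2%:E.
  apply: square_integrable_Lfun2 => //; apply: le_integrable int2 => //.
    by apply/measurable_EFinP; exact: measurable_funX.
  by move=> x _ /=; rewrite lee_fin !ger0_norm ?addr_ge0 ?sqr_ge0// lerDl sqr_ge0.
have fi : (fun x => complex.Im (f x)) \in Lfun m 2%:E.
  apply: square_integrable_Lfun2 => //; apply: le_integrable int2 => //.
    by apply/measurable_EFinP; exact: measurable_funX.
  by move=> x _ /=; rewrite lee_fin !ger0_norm ?addr_ge0 ?sqr_ge0// lerDr sqr_ge0.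
exists (L2_of fr, L2_of fi); apply/funext => x.
by rewrite /toC/=; case: (f x).
Qed.

(** The imaginary part is a real product with iq, so complex orthogonality to q is real
    orthogonality to q and to iq. *)
Lemma L2dot_toC p q : L2dot m (toC p) (toC q) = dotV p q +i* dotV p (mul_i q).
Proof.
rewrite /L2dot /cintegral /dot_prod/=; congr Complex.
  rewrite /L2_dot -RintegralD//; try exact: L2_mul_integrable.
  by apply: eq_Rintegral => x _ /=; rewrite mulrN opprK.
by rewrite /L2_dot -RintegralD//; exact: L2_mul_integrable.
Qed.

Lemma dotV_eq0 p : dotV p p = 0 <-> {ae m, forall x, toC p x = 0}.
Proof.
split=> [p0|p0].
  have := L2_dot_ge0 p.1; have := L2_dot_ge0 p.2; move: p0; rewrite /dot_prod => p0 h2 h1.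
  have /L2_dot_eq0 a1 : dot p.1 p.1 = 0 by lra.
  have /L2_dot_eq0 a2 : dot p.2 p.2 = 0 by lra.
  by apply: filterS2 a1 a2 => x h3 h4; rewrite /toC h3 h4.
have a1 : dot p.1 p.1 = 0 by apply/L2_dot_eq0; apply: filterS p0 => x [].
have a2 : dot p.2 p.2 = 0 by apply/L2_dot_eq0; apply: filterS p0 => x [].
by rewrite /dot_prod a1 a2 addr0.
Qed.

End complex_L2.

(** Points are coloured by the integer part of (phi + 1) * (N+1). Equal colours force a difference
    of at most 1/(N+1), whose square is no larger. *)
Lemma bounded_totally_bounded (R : realType) (G : eqType) (phi : G -> R) :
  (forall t, `|phi t| <= 1) -> totally_bounded (fun s t => (phi s - phi t) ^+ 2).
Proof.
move=> phi1 eps e0.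
have [N NP] := exists_small e0 ler01.
have N0 : 0 < (N.+1%:R : R) by rewrite ltr0n.
pose f t := Num.trunc ((phi t + 1) * N.+1%:R).
have f0 t : 0 <= (phi t + 1) * N.+1%:R.
  rewrite mulr_ge0// -lerBlDr sub0r.
  by have := phi1 t; rewrite ler_norml => /andP[].
have fN t : (f t < (2 * N.+1).+1)%N.
  rewrite ltnS -(ler_nat R) natrM; have /andP[h _] := Num.Theory.truncn_itv (f0 t).
  apply: (le_trans h); rewrite ler_pM2r//.
  by have := phi1 t; rewrite ler_norml => /andP[_]; lra.
exists 'I_(2 * N.+1).+1, (fun t => Ordinal (fN t)) => s t [fst].
have itv u : (f u)%:R <= (phi u + 1) * N.+1%:R < (f u)%:R + 1.
  by rewrite natr1; exact: Num.Theory.truncn_itv.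
have /andP[h1 h2] := itv s; have /andP[h3 h4] := itv t.
rewrite fst in h1 h2.
have h5 : `|(phi s - phi t) * N.+1%:R| <= 1.
  have -> : (phi s - phi t) * N.+1%:R =
      (phi s + 1) * N.+1%:R - (phi t + 1) * N.+1%:R by ring.
  move: (_ * _) (_ * _) (f t)%:R h1 h2 h3 h4 => x y z *.
  by rewrite ler_norml; apply/andP; split; lra.
have h6 : `|phi s - phi t| <= N.+1%:R^-1.
  by rewrite -[leRHS]mul1r ler_pdivlMr// -(gtr0_norm N0) -normrM.
rewrite -[leLHS]real_normK ?num_real//.
apply: (@le_trans _ _ (N.+1%:R^-1)); last by have := NP N (leqnn _); rewrite mul1r.
apply: (le_trans _ h6); rewrite expr2 ler_piMr//.
by apply: (le_trans h6); rewrite invf_le1 ?ler1n.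
Qed.

(** * From eigenfunctions to total boundedness *)

Section pure_point.
Context {R : realType} {G : topologicalZmodType} {X : pmetricType R}.
Hypothesis X_compact : compact [set: X].
Variable act : G -> X -> X.
Hypothesis act_cont : continuous_action act.
Variable m : probability (borel_space X) R.
Hypothesis m_inv : invariant_measure act m.
Notation L2 := (LfunType m (lee1n 2)).
Notation dot := (@L2_dot _ _ _ m).
Local Notation V := (L2 * L2)%type.
Local Notation dotV := (dot_prod dot).
Local Notation K := (koopman_pair act_cont m_inv).
Implicit Types p q : V.
Let hV : hilbert_form dotV := hilbert_prod (L2_hilbert m).
Let sV := hilbert_sym hV.
Let uA : unitary_action dotV K (@mul_i R L2) := koopman_unitary act_cont m_inv.

Lemma cscale_nsq c p :
  dotV (cscale c p) (cscale c p) = Normc.normc c ^+ 2 * dotV p p.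
Proof.
have pJ : dotV p (mul_i p) = 0.
  have h1 := actionJ_adj hV uA p p; rewrite (symformC sV) in h1.
  by move: (dotV _ _) h1 => x; lra.
rewrite /cscale (symform_sqD sV) !(symformZl sV) !(symformZr sV).
by rewrite pJ (actionJ_isom uA) sqr_normcE; ring.
Qed.

Lemma nsq_sub_eq0 p q : dotV (p - q) (p - q) = 0 -> dotV p p = dotV q q.
Proof.
move=> pq; rewrite -{1 2}(subrK q p) (symform_sqD sV) pq.
by rewrite (nsq_eq0_dot hV)// mulr0 !add0r.
Qed.

Lemma eigenfunction_toC p : eigenfunction act m (toC p) <->
  0 < dotV p p /\
  forall t, exists xi, dotV (K t p - cscale xi p) (K t p - cscale xi p) = 0.
Proof.
have d0 := hilbert_ge0 hV.
have ae_eq t xi : {ae m, forall x, toC p (act t x) = xi * toC p x} <->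
    dotV (K t p - cscale xi p) (K t p - cscale xi p) = 0.
  rewrite dotV_eq0; split; apply: ae_imply => x; rewrite toCB toC_cscale.
    by move=> <-; rewrite subrr.
  by move=> /eqP; rewrite subr_eq0 => /eqP.
split=> [[_ p0 pK]|[p0 pK]]; split.
- rewrite lt_neqAle d0 andbT; apply/eqP => /esym/dotV_eq0; exact: p0.
- by move=> t; have [xi /ae_eq] := pK t; exists xi.
- exact: in_L2_toC.
- by move/dotV_eq0 => p0'; move: p0; rewrite p0' ltxx.
- by move=> t; have [xi /ae_eq] := pK t; exists xi.
Qed.

Lemma orbit_dist_mul_i p s t :
  orbit_dist dotV K (mul_i p) s t = orbit_dist dotV K p s t.
Proof.
rewrite /orbit_dist -!(actionJT uA) -(actionJ_opp uA) -(actionJ_add uA).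
exact: (actionJ_isom uA).
Qed.

(** Isometry forces eigenvalues of modulus 1, so the orbit moves, up to null vectors, along a circle
    in the complex line of p. *)
Lemma eigenfunction_totally_bounded p : eigenfunction act m (toC p) ->
  totally_bounded (orbit_dist dotV K p).
Proof.
move=> /eigenfunction_toC[p0 /choice[xi xiP]].
have xi1 t : Normc.normc (xi t) = 1.
  have := nsq_sub_eq0 (xiP t); rewrite (actionT_isom uA) cscale_nsq => h.
  have h1 : Normc.normc (xi t) ^+ 2 = 1.
    by apply: (mulIf (lt0r_neq0 p0)); rewrite -h mul1r.
  apply/eqP; rewrite -(@eqrXn2 _ 2)// ?normc_ge0// h1 expr1n//.
apply: totally_bounded_le => eps e0.
exists (2 * dotV p p), (fun s t => (complex.Re (xi s) - complex.Re (xi t)) ^+ 2 +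
  (complex.Im (xi s) - complex.Im (xi t)) ^+ 2).
split; first by rewrite mulr_ge0// ltW.
  apply: totally_boundedD; apply: bounded_totally_bounded => t.
    by rewrite -(xi1 t); have [] := abs_Re_Im_le_normc (xi t).
  by rewrite -(xi1 t); have [] := abs_Re_Im_le_normc (xi t).
move=> s t; rewrite -[leLHS]add0r lerD ?(ltW e0)//.
have -> : (complex.Re (xi s) - complex.Re (xi t)) ^+ 2 +
    (complex.Im (xi s) - complex.Im (xi t)) ^+ 2 = Normc.normc (xi s - xi t) ^+ 2.
  by rewrite sqr_normcE; case: (xi s) (xi t) => ? ? [? ?].
rewrite -mulrA [dotV p p * _]mulrC -cscale_nsq /orbit_dist.
have -> : K s p - K t p = (K s p - cscale (xi s) p - (K t p - cscale (xi t) p)) +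
    cscale (xi s - xi t) p.
  have -> : cscale (xi s - xi t) p = cscale (xi s) p - cscale (xi t) p.
    by apply: toC_inj => x; rewrite toCB !toC_cscale mulrBl.
  by rewrite opprB addrACA subrK [X in _ = _ + X]addrAC subrr add0r.
apply: (le_trans (nsqD_le hV _ _)); rewrite gerDr pmulr_rle0//.
apply: (le_trans (nsqB_le hV _ _)).
by rewrite !xiP mulr0 addr0.
Qed.

Lemma pure_point_orbits_totally_bounded : pure_point_spectrum act m ->
  forall p : V, totally_bounded (orbit_dist dotV K p).
Proof.
move=> [E [[orthoE totalE] eigE]] p.
have cW := totally_bounded_orbit_closed hV (koopman_pair_lin act_cont m_inv)
  (koopman_pair_isom act_cont m_inv).
have [sW cW'] := cW; apply: cW' => eps e0.
(* [L2_total] bounds the norm, whereas approximation here is measured by its square. *)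
have s0 : 0 < Num.sqrt eps by rewrite sqrtr_gt0.
have [n [c [e [Ee pe]]]] := totalE _ (in_L2_toC p) _ s0.
have [onE _ _] := orthoE.
have /choice[u uP] : forall i, exists u : V, e i = toC u.
  by move=> i; apply: in_L2_ex_toC; exact: onE.
exists (\sum_(i < n) cscale (c i) (u i)).
  apply: big_ind => [|v w|i _]; first exact: (subspace0 sW).
    exact: (subspaceD sW).
  have tu : totally_bounded (orbit_dist dotV K (u i)).
    by apply: eigenfunction_totally_bounded; rewrite -uP; exact: eigE.
  apply: (subspaceD sW); apply: (subspaceZ _ sW) => //.
  by move=> eps' /tu[F [cl clP]]; exists F, cl => s t /clP; rewrite orbit_dist_mul_i.
move: pe; rewrite (_ : (fun x => _) = toC (p - \sum_(i < n) cscale (c i) (u i))).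
  rewrite L2norm_toC lte_fin => h.
  have d0 := hilbert_ge0 hV (p - \sum_(i < n) cscale (c i) (u i)).
  by rewrite -(sqr_sqrtr d0) -[leRHS](sqr_sqrtr (ltW e0)) lerXn2r ?nnegrE ?sqrtr_ge0// ltW.
apply/funext => x; rewrite toCB; congr (_ - _).
rewrite (_ : toC (\sum_(i < n) cscale (c i) (u i)) x =
  \sum_(i < n) toC (cscale (c i) (u i)) x); last first.
  by elim/big_ind2 : _ => [//|v a w b <- <-|//]; rewrite toCD.
by apply: eq_bigr => i _; rewrite uP toC_cscale.
Qed.

Lemma pure_point_totally_bounded : pure_point_spectrum act m ->
  totally_bounded (orbit_mdist act m).
Proof.
move=> pp; apply: totally_bounded_le => eps e0.
have e4 : 0 < eps / 4 by rewrite divr_gt0.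
have [|s _ sP] := compact_seq_cover (U := fun x => ball x (eps / 4)) X_compact.
  by move=> x _; exact: nbhsx_ballx.
have cdist (y : X) : continuous ((fun x => mdist x y) : X -> R^o).
  by apply: mdist_continuous => x; [exact: cvg_id|exact: cvg_cst].
pose f y : L2 := L2_of (continuous_Lfun2 X_compact m (@cdist y)).
have tbf y : totally_bounded (orbit_dist dot (koopman act_cont m_inv) (f y)).
  move=> eps' /(pure_point_orbits_totally_bounded pp (f y, 0))[F [c cP]].
  by exists F, c => t t' /cP; apply: le_trans; rewrite orbit_dist_pair lerDl L2_dot_ge0.
(* [del] is at most eps/2 and will be the additive error in bounding |F| by its square. *)
pose del := eps / 2 / ((size s)%:R + 1).
have del0 : 0 < del by rewrite !divr_gt0// ltr_wpDl.
exists del^-1, (fun t t' => \sum_(y <- s)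
  orbit_dist dot (koopman act_cont m_inv) (f y) t t').
split; [by rewrite invr_ge0 ltW|exact: totally_bounded_sum|move=> t t'].
pose F y x := mdist (act t x) y - mdist (act t' x) y.
have cF y : continuous ((fun x => F y x * F y x) : X -> R^o).
  have cFy : continuous (F y : X -> R^o).
    move=> x; apply: cvgB; apply: mdist_continuous; try exact: act_continuous.
      by move=> ?; exact: cvg_cst.
    by move=> ?; exact: cvg_cst.
  by move=> x; apply: cvgM; exact: cFy.
have cS (r : seq X) : continuous ((fun x => \sum_(y <- r) F y x * F y x) : X -> R^o).
  elim: r => [|y r IH].
    rewrite (_ : (fun _ => _) = fun=> 0); first exact: cst_continuous.
    by apply/funext => x; rewrite big_nil.
  rewrite (_ : (fun _ => _) = fun x => F y x * F y x + \sum_(z <- r) F z x * F z x).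
    by move=> x; apply: cvgD; [exact: cF|exact: IH].
  by apply/funext => x; rewrite big_cons.
have iS (r : seq X) : \int[m]_x (\sum_(y <- r) F y x * F y x) =
    \sum_(y <- r) orbit_dist dot (koopman act_cont m_inv) (f y) t t'.
  elim: r => [|y r IH].
    rewrite big_nil; under eq_Rintegral do rewrite big_nil.
    by rewrite /Rintegral integral0.
  rewrite big_cons -IH; under eq_Rintegral do rewrite big_cons.
  by rewrite RintegralD//; exact: continuous_m_integrable.
have cbound : continuous ((fun x => eps + del^-1 * \sum_(y <- s) F y x * F y x) : X -> R^o).
  move=> x; apply: cvgD; first exact: cvg_cst.
  by apply: cvgM; [exact: cvg_cst|exact: cS].
apply: (@le_trans _ _ (\int[m]_x (eps + del^-1 * \sum_(y <- s) F y x * F y x))).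
  apply: le_Rintegral => //.
  - by apply: continuous_m_integrable => //; apply: mdist_continuous; exact: act_continuous.
  - exact: continuous_m_integrable.
  move=> x _; have [y ys] := sP (act t x) I; rewrite ballEmdist/= => ty.
  (* With y within eps/4 of tx, passing through y costs d(tx, y) twice, plus the change of d(., y)
     between tx and t'x. *)
  have h1 : mdist (act t x) (act t' x) <= eps / 2 + `|F y x|.
    have h2 := metric_triangle (act t x) y (act t' x).
    have h3 := ler_norm (- F y x); rewrite normrN /F in h3.
    rewrite (metric_sym y (act t' x)) (metric_sym (act t x) y) in h2.
    rewrite (metric_sym (act t x) y) in h3.
    by rewrite /F (metric_sym (act t x) y); lra.
  apply: (le_trans h1); rewrite [X in _ <= X + _](splitr eps) -addrA lerD2l.
  (* Arithmetic-geometric mean: this replaces a distance by a square, whose integral is an orbit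
     distance in $L^2$. *)
  have h2 : `|F y x| <= del + del^-1 * (F y x * F y x).
    rewrite -(ler_pM2l del0) mulrDr mulVKf ?gt_eqF//.
    have : `|F y x| ^+ 2 = F y x * F y x by rewrite real_normK ?num_real// expr2.
    have := sqr_ge0 (`|F y x| - del); have := normr_ge0 (F y x).
    by move: (`|F y x|) => a h3 h4 <-; nra.
  apply: (le_trans h2); rewrite lerD//.
    by rewrite /del ler_pdivrMr ?ltr_wpDl// ler_peMr ?lerDr// divr_ge0// ltW.
  rewrite ler_wpM2l ?invr_ge0 ?(ltW del0)// (big_rem y)//= lerDl.
  by apply: sumr_ge0 => ? _; rewrite -expr2 sqr_ge0.
rewrite RintegralD//; last 2 first.
- by apply: (continuous_m_integrable X_compact m (f := fun=> eps)); exact: cst_continuous.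
- apply: (continuous_m_integrable X_compact m
    (f := fun x => del^-1 * \sum_(y <- s) F y x * F y x)) => x.
  by apply: cvgM; [exact: cvg_cst|exact: cS].
rewrite RintegralZl//; last exact: continuous_m_integrable.
rewrite iS lerD2r (_ : \int[m]_x eps = eps)//.
transitivity (eps * fine (m setT)); first exact: Rintegral_cst.
by rewrite probability_setT mulr1.
Qed.

End pure_point.

(** * From total boundedness to a basis of eigenfunctions *)

Section pure_point_converse.
Context {R : realType} {G : topologicalZmodType} {X : pmetricType R}.
Hypothesis X_compact : compact [set: X].
Variable act : G -> X -> X.
Hypothesis act_cont : continuous_action act.
Variable m : probability (borel_space X) R.
Hypothesis m_inv : invariant_measure act m.
Notation L2 := (LfunType m (lee1n 2)).
Notation dot := (@L2_dot _ _ _ m).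
Local Notation V := (L2 * L2)%type.
Local Notation dotV := (dot_prod dot).
Local Notation K := (koopman_pair act_cont m_inv).
Implicit Types p u v w : V.
Implicit Types E : set (X -> R[i]).
Let hV : hilbert_form dotV := hilbert_prod (L2_hilbert m).
Let sV := hilbert_sym hV.
Let dV0 := hilbert_ge0 hV.
Let uA : unitary_action dotV K (@mul_i R L2) := koopman_unitary act_cont m_inv.

Definition orthonormal_eigenfunctions E :=
  L2_orthonormal m E /\ forall e, E e -> eigenfunction act m e.

(** Zorn's lemma applies because each condition involves at most two functions, and two members of
    the union of a chain lie in one member of the chain. *)
Lemma maximal_orthonormal_eigenfunctions : exists E,
  orthonormal_eigenfunctions E /\
  forall E', E `<` E' -> ~ orthonormal_eigenfunctions E'.
Proof.
apply: Zorn_bigcup => F FP Ftot; split; first split.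
- by move=> e [E FE Ee]; have [[h _ _] _] := FP _ FE; exact: h.
- by move=> e [E FE Ee]; have [[_ h _] _] := FP _ FE; exact: h.
- move=> e e' [E FE Ee] [E' FE' Ee'].
  have [EE'|E'E] := Ftot _ _ FE FE'.
    by have [[_ _ h] _] := FP _ FE'; apply: h => //; exact: EE'.
  by have [[_ _ h] _] := FP _ FE; apply: h => //; exact: E'E.
- by move=> e [E FE Ee]; have [_ h] := FP _ FE; exact: h.
Qed.

Definition closed_cspan E : set V := [set v | forall eps : R, 0 < eps ->
  exists s : seq (R[i] * V), (forall q, q \in s -> E (toC q.2)) /\
    dotV (v - ccomb s) (v - ccomb s) <= eps].

Lemma closed_cspan_subspace E : closed_subspace dotV (closed_cspan E).
Proof.
split; first split.
- move=> eps e0; exists [::]; split => //.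
  by rewrite /ccomb big_nil subr0 (symform0l sV) ltW.
- move=> a u v Uu Uv eps e0.
  have a1 : 0 < 2 * a ^+ 2 + 1 by rewrite ltr_wpDl// mulr_ge0// sqr_ge0.
  have e1 : 0 < eps / 2 / (2 * a ^+ 2 + 1) by rewrite !divr_gt0.
  have e4 : 0 < eps / 4 by rewrite divr_gt0.
  have [s [sE us]] := Uu _ e1; have [t [tE vt]] := Uv _ e4.
  exists ([seq (a%:C%C * q.1, q.2) | q <- s] ++ t); split.
    move=> q; rewrite mem_cat => /orP[/mapP[q' /sE ? ->]//|]; exact: tE.
  rewrite ccomb_cat ccomb_scale.
  have -> : a *: u + v - (a *: ccomb s + ccomb t) =
      a *: (u - ccomb s) + (v - ccomb t).
    by rewrite opprD addrACA scalerBr.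
  apply: (le_trans (nsqD_le hV _ _)).
  rewrite (symformZl sV) (symformZr sV) (splitr eps) lerD//; last first.
    by move: (dotV _ _) vt => *; lra.
  move: us; rewrite ler_pdivlMr//; apply: le_trans.
  have := dV0 (u - ccomb s); move: (dotV _ _) => D D0.
  by rewrite (_ : 2 * _ = D * (2 * a ^+ 2)); [rewrite ler_wpM2l// lerDl|ring].
- move=> v vU eps e0; have e4 : 0 < eps / 4 by rewrite divr_gt0.
  have [u Uu uv] := vU _ e4; have [s [sE us]] := Uu _ e4.
  exists s; split => //.
  have -> : v - ccomb s = (v - u) + (u - ccomb s) by rewrite addrA subrK.
  apply: (le_trans (nsqD_le hV _ _)).
  by move: (dotV _ _) (dotV _ _) uv us => *; lra.
Qed.

Lemma mem_closed_cspan E u c : E (toC u) -> closed_cspan E (cscale c u).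
Proof.
move=> Eu eps e0; exists [:: (c, u)]; split.
  by move=> q; rewrite inE => /eqP ->.
by rewrite /ccomb big_seq1/= subrr (symform0l sV) ltW.
Qed.

Lemma closed_cspan_total E : (forall v, closed_cspan E v) -> L2_total m E.
Proof.
move=> EV f /in_L2_ex_toC[p ->] eps e0.
have e2 : 0 < (eps / 2) ^+ 2 by rewrite exprn_gt0// divr_gt0.
have [s [sE ps]] := EV p _ e2.
exists (size s), (fun i => (nth (0, 0) s i).1), (fun i => toC (nth (0, 0) s i).2).
split=> [i|]; first by apply: sE; rewrite mem_nth.
rewrite (_ : (fun x => _) = toC (p - ccomb s)).
  rewrite L2norm_toC lte_fin; apply: (@le_lt_trans _ _ (eps / 2)).
    rewrite -(@ler_pXn2r _ 2)// ?nnegrE ?sqrtr_ge0 ?divr_ge0 ?(ltW e0)//.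
    by rewrite sqr_sqrtr.
  by rewrite ltr_pdivrMr// ltr_pMr// ltr1n.
apply/funext => x; rewrite toCB toC_ccomb; congr (_ - _).
by rewrite (big_nth (0, 0)) big_mkord.
Qed.

Lemma dotV_mul_i u : dotV u (mul_i u) = 0.
Proof.
have := actionJ_adj hV uA u u; rewrite (symformC sV).
by move: (dotV _ _) => x h; lra.
Qed.

Lemma null_dot u v w : dotV (u - v) (u - v) = 0 -> dotV w u = dotV w v.
Proof.
move=> uv; apply/eqP; rewrite -subr_eq0 -(symformNr sV) -(symformDr sV).
by rewrite (symformC sV) (nsq_eq0_dot hV).
Qed.

(** The complex orthogonal complement, phrased by real products with v and iv so that
    [orthogonal_closed] applies. *)
Definition complement_of E : set V := [set w | forall u,
  [set u | exists v, E (toC v) /\ (u = v \/ u = mul_i v)] u -> dotV w u = 0].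

Lemma complement_ofP E w : complement_of E w <->
  forall v, E (toC v) -> dotV w v = 0 /\ dotV w (mul_i v) = 0.
Proof.
split=> [Ww v Ev|h u [v [Ev [->|->]]]]; last 2 first.
- by have [] := h v Ev.
- by have [] := h v Ev.
by split; apply: Ww; exists v; split; [|left|exact: Ev|right].
Qed.

Lemma complement_of_mul_i E w : complement_of E w -> complement_of E (mul_i w).
Proof.
move=> /complement_ofP Ww; apply/complement_ofP => v /Ww[h1 h2].
rewrite !(actionJ_adj hV uA) h2 oppr0; split => //.
by rewrite (actionJJ uA) (symformNr sV) opprK.
Qed.

(** The adjoint of T_t is T_{-t}, which maps each eigenfunction v of the family to a combination of
    v and iv, up to a null vector. *)
Lemma complement_of_koopman E t w : (forall e, E e -> eigenfunction act m e) ->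
  complement_of E w -> complement_of E (K t w).
Proof.
move=> Eeig Ww; apply/complement_ofP => v Ev.
have /eigenfunction_toC[_ /(_ (- t))[xi xiP]] := Eeig _ Ev.
have key w' : complement_of E w' -> dotV (K t w') v = 0.
  move=> /complement_ofP/(_ _ Ev)[h1 h2].
  rewrite (actionT_adj uA) (null_dot _ xiP) (symformDr sV) !(symformZr sV).
  by rewrite h1 h2 !mulr0 addr0.
split; first exact: key.
have := key _ (complement_of_mul_i Ww).
by rewrite -(actionJT uA) (actionJ_adj hV uA) => /eqP; rewrite oppr_eq0 => /eqP.
Qed.

Lemma totally_bounded_pure_point (M : (G -> R) -> R) : invariant_mean M ->
  totally_bounded (orbit_mdist act m) -> pure_point_spectrum act m.
Proof.
move=> hM tb; have [E [[orthoE eigE] maxE]] := maximal_orthonormal_eigenfunctions.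
exists E; split => //; split => //; apply: closed_cspan_total => p.
apply: contrapT => pU.
have cU := closed_cspan_subspace E.
have [q Uq pq] := projection hV p cU.
pose z := p - q.
have nz : 0 < dotV z z.
  rewrite lt_neqAle dV0 andbT; apply/eqP => z0; apply: pU; apply: cU.2 => eps e0.
  by exists q => //; rewrite -/z -z0 ltW.
have Wz : complement_of E z.
  apply/complement_ofP => v Ev; split; apply: pq.
    rewrite (_ : v = cscale 1 v); first exact: mem_closed_cspan.
    by apply: toC_inj => x; rewrite toC_cscale mul1r.
  rewrite (_ : mul_i v = cscale (Complex 0 1) v); first exact: mem_closed_cspan.
  by rewrite /cscale/= scale0r add0r scale1r.
have [w [Ww nw wP]] := unitary_eigenvector hV uA hM (orthogonal_closed hV _)
  (fun t u => @complement_of_koopman E t u eigE) (@complement_of_mul_i E)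
  (koopman_pair_strongly_continuous X_compact act_cont m_inv z)
  (koopman_pair_totally_bounded X_compact act_cont m_inv tb z) Wz nz.
have [c nc] : exists c : R, dotV (c *: w) (c *: w) = 1.
  by exists (Num.sqrt (dotV w w))^-1; exact: nsq_normalize.
have [w1 [nw1 Ww1 w1P]] : exists w1, [/\ dotV w1 w1 = 1, complement_of E w1 &
    forall t, exists xi, dotV (K t w1 - cscale xi w1) (K t w1 - cscale xi w1) = 0].
  exists (c *: w); split; [exact: nc| |].
    exact: (subspaceZ _ (orthogonal_closed hV _).1).
  move=> t; have [a [b h]] := wP t; exists (Complex a b).
  have -> : K t (c *: w) - cscale (Complex a b) (c *: w) =
      c *: (K t w - (a *: w + b *: mul_i w)).
    rewrite (actionT_scale uA) /cscale/= (actionJ_scale uA) scalerBr scalerDr.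
    by rewrite !scalerA !(mulrC c).
  by rewrite (symform_sqZ sV) h mulr0.
have eig1 : eigenfunction act m (toC w1).
  have p1 : 0 < dotV w1 w1 by rewrite nw1; exact: ltr01.
  exact: ((eigenfunction_toC act_cont m_inv w1).2 (conj p1 w1P)).
have nE : ~ E (toC w1).
  move=> /((complement_ofP E w1).1 Ww1)[+ _].
  by rewrite nw1 => /eqP; rewrite oner_eq0.
have [inE oneE crossE] := orthoE.
(* The normalised eigenfunction found in the complement enlarges the family, against maximality. *)
apply: (maxE (E `|` [set toC w1])).
  split; first exact: subsetUl.
  by move=> /(_ (toC w1)) h; apply: nE; apply: h; right.
split; first split.
- by move=> e [/inE//|->]; exact: in_L2_toC.
- by move=> e [/oneE//|->]; rewrite L2dot_toC nw1 dotV_mul_i.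
- move=> e e' [Ee|->] [Ee'|->] ee'.
  + exact: crossE.
  + have [v ev] := in_L2_ex_toC (inE _ Ee); rewrite ev in Ee *.
    have [h1 h2] := (complement_ofP E w1).1 Ww1 _ Ee.
    rewrite L2dot_toC (symformC sV) h1 (symformC sV) (actionJ_adj hV uA) h2.
    by rewrite oppr0.
  + have [v ev] := in_L2_ex_toC (inE _ Ee'); rewrite ev in Ee' *.
    have [h1 h2] := (complement_ofP E w1).1 Ww1 _ Ee'.
    by rewrite L2dot_toC h1 h2.
  + by [].
- by move=> e [/eigE//|->].
Qed.

End pure_point_converse.

(** * Almost every point is generic *)

Section separability.
Context {R : realType} {X : pmetricType R}.
Hypothesis X_compact : compact [set: X].

(* An approximation by rational step functions is indexed by countable data;
   for each index keep one continuous function so approximated, if any. *)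
Lemma continuous_separable : exists g : nat -> X -> R,
  (forall n, continuous (g n : X -> R^o)) /\
  forall f : X -> R, continuous (f : X -> R^o) -> forall eps : R, 0 < eps ->
    exists n, forall x, `|f x - g n x| <= eps.
Proof.
have /choice[s sP] : forall k : nat, exists s : seq X, forall x,
    exists2 y, y \in s & mdist y x < k.+1%:R^-1.
  move=> k; have k0 : 0 < k.+1%:R^-1 :> R by rewrite invr_gt0.
  have [|s _ sP] := compact_seq_cover (U := fun x => ball x k.+1%:R^-1) X_compact.
    by move=> x _; exact: nbhsx_ballx.
  exists s => x; have [y ys] := sP x I.
  by rewrite ballEmdist => yx; exists y.
have /choice[y yP] : forall kx : nat * X, exists y, y \in s kx.1 /\
    mdist y kx.2 < kx.1.+1%:R^-1.
  by move=> [k x]; have [y ys yx] := sP k x; exists y.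
(* The index holds the fineness k of the net, the precision j and the rational values on the net; a
   point takes the value listed for its chosen neighbour. *)
pose step (i : nat * nat * seq rat) x : R :=
  ratr (nth 0 i.2 (index (y (i.1.1, x)) (s i.1.1))).
pose close i (f : X -> R) := continuous (f : X -> R^o) /\
  forall x, `|f x - step i x| <= i.1.2.+1%:R^-1.
have /choice[g gP] : forall i, exists g : X -> R, continuous (g : X -> R^o) /\
    ((exists f, close i f) -> close i g).
  move=> i; have [[f fi]|nf] := pselect (exists f, close i f).
    by exists f; split => //; case: fi.
  by exists (fun=> 0); split; [exact: cst_continuous|].
exists (fun n => if unpickle n is Some i then g i else fun=> 0); split.
  move=> n; case: unpickle => [i|]; first by case: (gP i).
  exact: cst_continuous.
move=> f cf eps e0.
(* Two functions within 1/(j+1) of the same step function differ by at most 2/(j+1). Half of 1/(j+1)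
   goes to the net and half to the rational values. *)
have [j jP] := exists_small e0 (ler0n R 2).
pose del : R := j.+1%:R^-1 / 2.
have del0 : 0 < del by rewrite divr_gt0// invr_gt0.
have del2 : 0 < del ^+ 2 / 2 by rewrite divr_gt0// exprn_gt0.
have [C C0 CP] := continuous_modulus X_compact cf del2.
have [k kP] := exists_small del2 C0.
have near_y x : `|f x - f (y (k, x))| <= del.
  have [_ /ltW yx] := yP (k, x).
  rewrite -(@ler_pXn2r _ 2)// ?nnegrE ?(ltW del0)// real_normK ?num_real//.
  apply: (le_trans (CP _ _)); rewrite [leRHS]splitr lerD2l.
  apply: (le_trans _ (kP k (leqnn _))); rewrite ler_wpM2l//.
  by rewrite metric_sym.
have /choice[q qP] : forall r : R, exists q : rat, `|r - ratr q| <= del.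
  move=> r; have [|q] := @rat_in_itvoo R (r - del) (r + del).
    by move: del0 => *; lra.
  rewrite in_itv/= => /andP[h1 h2]; exists q.
  by rewrite ler_norml; apply/andP; split; lra.
pose i := ((k, j), [seq q (f x) | x <- s k]).
have fi : close i f.
  split => // x; have [yk _] := yP (k, x).
  rewrite /step/= (nth_map (y (k, x))) ?index_mem// nth_index//.
  have -> : f x - ratr (q (f (y (k, x)))) =
    (f x - f (y (k, x))) + (f (y (k, x)) - ratr (q (f (y (k, x))))) by ring.
  by apply: (le_trans (ler_normD _ _)); rewrite [leRHS]splitr lerD.
exists (pickle i) => x; rewrite pickleK.
have [_ /(_ (ex_intro _ f fi))[_ gi]] := gP i.
have -> : f x - g i x = (f x - step i x) - (g i x - step i x) by ring.
apply: (le_trans (ler_normB _ _)); apply: (le_trans (lerD (fi.2 x) (gi x))).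
by have := jP j (leqnn _); rewrite /i/= mulrDl mul1r.
Qed.

End separability.

Section birkhoff_generic.
Context {R : realType} {G : topologicalZmodType} {X : pmetricType R}.
Hypotheses (G_hausdorff : hausdorff_space G) (G_sigma_compact : sigma_compact G).
Variables (mu : {measure set (borel_group G) -> \bar R}) (B : nat -> set G).
Hypotheses (mu_haar : haar_measure mu) (B_folner : folner mu B).
Hypothesis X_compact : compact [set: X].
Variable act : G -> X -> X.
Hypothesis act_cont : continuous_action act.
Variable m : probability (borel_space X) R.

Lemma bounded_continuous_orbit (f : X -> R) x : continuous (f : X -> R^o) ->
  bounded_continuous (fun t => f (act t x)).
Proof.
move=> cf; have [c fc] := continuous_compact_bounded X_compact cf.
split; last by exists c.
move=> t; apply: (@continuous_comp _ _ _ (fun t => act t x) f); last exact: cf.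
apply: (@cvg_comp _ _ _ (fun t => (t, x)) (fun p => act p.1 p.2) _ (nbhs (t, x))).
  by apply: cvg_pair; [exact: cvg_id|exact: cvg_cst].
exact: (action_continuous act_cont (x := (t, x))).
Qed.

(** Averages and integrals do not increase the sup norm, so convergence for a countable dense set of
    continuous functions, which holds off one null set, gives it for all of them. *)
Lemma birkhoff_ae_generic : birkhoff act m mu B ->
  {ae m, forall x, generic act m mu B x}.
Proof.
move=> bk; have [g [cg gP]] := @continuous_separable R X X_compact.
have : {ae m, forall x n,
    average mu B (fun t => g n (act t x)) k @[k --> \oo] --> \int[m]_x g n x}.
  apply: ae_foralln => n.
  have ig : cintegrable m (fun x => (g n x)%:C%C).
    split; first exact: (continuous_m_integrable X_compact m (@cg n)).
    apply: (continuous_m_integrable X_compact m (f := fun=> 0)).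
    exact: cst_continuous.
  by apply: ae_imply (bk _ ig) => x /caverage_cvgP[].
apply: ae_imply => x gx; apply/genericP => f cf.
apply/cvgrPdist_le => /= eps e0; have e3 : 0 < eps / 3 by rewrite divr_gt0.
have [n fn] := gP f cf _ e3.
have bf := bounded_continuous_orbit x cf.
have bg := bounded_continuous_orbit x (cg n).
have h1 : `|\int[m]_x f x - \int[m]_x g n x| <= eps / 3.
  have cfg : continuous ((fun x => f x - g n x) : X -> R^o).
    by move=> z; apply: cvgB; [exact: cf|exact: cg].
  rewrite -RintegralB//; try exact: continuous_m_integrable.
  apply: (le_trans (le_normr_Rintegral _ _)) => //.
    exact: (continuous_m_integrable X_compact m cfg).
  have -> : eps / 3 = \int[m]_x (eps / 3).
    transitivity (eps / 3 * fine (m setT)); last by rewrite (@Rintegral_cst _ _ _ m).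
    by rewrite probability_setT mulr1.
  apply: le_Rintegral => //.
  - apply: (continuous_m_integrable X_compact m (f := fun x => `|f x - g n x|)).
    by move=> z; apply: cvg_norm; exact: cfg.
  - apply: (continuous_m_integrable X_compact m (f := fun=> eps / 3)).
    exact: cst_continuous.
have h2 k : `|average mu B (fun t => g n (act t x)) k -
    average mu B (fun t => f (act t x)) k| <= eps / 3.
  have : average mu B (fun t => -1 * f (act t x) + g n (act t x)) k =
      -1 * average mu B (fun t => f (act t x)) k +
      average mu B (fun t => g n (act t x)) k by exact: average_lin.
  rewrite mulN1r addrC => <-; apply: average_bound => //.
    by apply: bounded_continuousD => //; exact: bounded_continuousZ.
  by move=> t; rewrite mulN1r addrC distrC.
move/cvgrPdist_le : (gx n) => /(_ _ e3); apply: filterS => k h3.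
have -> : \int[m]_x f x - average mu B (fun t => f (act t x)) k =
    (\int[m]_x f x - \int[m]_x g n x) +
    (\int[m]_x g n x - average mu B (fun t => g n (act t x)) k) +
    (average mu B (fun t => g n (act t x)) k -
      average mu B (fun t => f (act t x)) k) by ring.
apply: (le_trans (ler_normD _ _)); have := h2 k.
have := ler_normD (\int[m]_x f x - \int[m]_x g n x)
  (\int[m]_x g n x - average mu B (fun t => g n (act t x)) k).
by move: (`|_ + _|) => y; lra.
Qed.

End birkhoff_generic.

Lemma ae_exists2 d (T : measurableType d) (R : realType) (P : probability T R)
    (Q Q' : T -> Prop) : {ae P, forall x, Q x} -> {ae P, forall x, Q' x} ->
  exists x, Q x /\ Q' x.
Proof.
move=> aeQ aeQ'; have [A [mA A0 QA]] : {ae P, forall x, Q x /\ Q' x}.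
  by apply: filterS2 aeQ aeQ' => x; split.
apply/not_existsP => nQ.
have AT : A = setT by apply/seteqP; split => // x _; apply: QA; exact: nQ.
by move: A0; rewrite AT probability_setT => /eqP; rewrite onee_eq0.
Qed.

Theorem theorem2p8 (R : realType) (G : topologicalZmodType)
    (G_hausdorff : hausdorff_space G)
    (G_locally_compact : locally_compact [set: G])
    (G_sigma_compact : sigma_compact G)
    (mu : {measure set (borel_group G) -> \bar R}) (mu_haar : haar_measure mu)
    (X : pmetricType R) (X_compact : compact [set: X])
    (act : G -> X -> X) (act_continuous : continuous_action act)
    (m : probability (borel_space X) R) (m_invariant : invariant_measure act m)
    (B : nat -> set G) (B_folner : folner mu B)
    (exists_generic : exists y : X, generic act m mu B y) :
  let pure_point := pure_point_spectrum act m in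
  let every_generic_mean_ap :=
    forall y : X, generic act m mu B y -> mean_almost_periodic act mu B y in
  let one_generic_mean_ap :=
    exists y : X, generic act m mu B y /\ mean_almost_periodic act mu B y in
  let ae_mean_ap := {ae m, forall x : X, mean_almost_periodic act mu B x} in
  [<-> pure_point; every_generic_mean_ap; one_generic_mean_ap] /\
  (ergodic act m -> birkhoff act m mu B ->
    [<-> pure_point; every_generic_mean_ap; one_generic_mean_ap; ae_mean_ap]).
Proof.
move=> pp every one ae.
have [M hM] := folner_mean G_hausdorff mu_haar G_sigma_compact B_folner.
have ppP : pp <-> totally_bounded (orbit_mdist act m).
  split; first exact: (pure_point_totally_bounded X_compact act_continuous m_invariant).
  exact: (totally_bounded_pure_point X_compact act_continuous m_invariant hM).
(* Each single generic point already decides pure point spectrum, so the first three assertions are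
   equivalent as soon as one generic point exists. *)
have genP y : generic act m mu B y -> (mean_almost_periodic act mu B y <-> pp).
  move=> gy; rewrite ppP (generic_mean_ap act_continuous gy).
  by rewrite (orbit_mdist_totally_bounded X_compact act_continuous m_invariant).
have pp_every : pp -> every by move=> hpp y gy; apply/genP.
have every_one : every -> one.
  by move=> hy; have [y gy] := exists_generic; exists y; split => //; exact: hy.
have one_pp : one -> pp by move=> [y [gy /genP]]; exact.
split; first by tfae.
move=> _ bk.
have aeg := birkhoff_ae_generic G_hausdorff G_sigma_compact mu_haar B_folner
  X_compact act_continuous bk.
tfae => // [|hae].
  move=> /one_pp hpp; apply: ae_imply aeg => x gx; exact/genP.
(* Two properties that hold almost everywhere share a point, here one that is both generic and mean
   almost periodic. *)
have [x [gx ax]] := ae_exists2 aeg hae.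
exact/(genP x gx).
Qed.
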